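(* Let $k\in\mathbb{Z}$ and $r>0$. If $0<r\le 1$, then $$\inf_{\mathbf{n}\in\mathcal{M}_k}E_r[\mathbf{n}]=\begin{cases}4\pi|k|(1-2r^2) & (k<0),\\ 4\pi k & (k\ge 0).\end{cases}$$ If $r>1$, then $\inf_{\mathbf{n}\in\mathcal{M}_k}E_r[\mathbf{n}]=-\infty$ for every $k\in\mathbb{Z}$.
   Context: Maps $\mathbf{n}=(n_1,n_2,n_3):\mathbb{R}^2\to\mathbb{S}^2\subset\mathbb{R}^3$ (with weak derivatives in $L^2_{loc}$); $\mathbf{e}_1,\mathbf{e}_2,\mathbf{e}_3$ is the canonical basis of $\mathbb{R}^3$. Define $D[\mathbf{n}]=\frac12\int_{\mathbb{R}^2}|\nabla\mathbf{n}|^2dx$, $H[\mathbf{n}]=\int_{\mathbb{R}^2}(\mathbf{n}-\mathbf{e}_3)\cdot(\nabla\times\mathbf{n})dx$ where $\nabla\times\mathbf{n}=(\partial_1,\partial_2,0)\times(n_1,n_2,n_3)=(\partial_2 n_3,-\partial_1 n_3,\partial_1 n_2-\partial_2 n_1)$, $V[\mathbf{n}]=\frac18\int_{\mathbb{R}^2}|\mathbf{n}-\mathbf{e}_3|^4dx=\frac12\int_{\mathbb{R}^2}(1-n_3)^2dx$, and for $r>0$, $E_r[\mathbf{n}]=D[\mathbf{n}]+rH[\mathbf{n}]+V[\mathbf{n}]$. The energy space is $\mathcal{M}=\{\mathbf{n}:\mathbb{R}^2\to\mathbb{S}^2\mid D[\mathbf{n}]+V[\mathbf{n}]<\infty\}$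 with metric $d_{\mathcal{M}}(\mathbf{n},\mathbf{m})=\|\mathbf{n}-\mathbf{m}\|_{L^4(\mathbb{R}^2)}+\|\nabla(\mathbf{n}-\mathbf{m})\|_{L^2(\mathbb{R}^2)}$; all terms of $E_r$ are finite on $\mathcal{M}$. The topological degree is $Q[\mathbf{n}]=\frac1{4\pi}\int_{\mathbb{R}^2}\mathbf{n}\cdot(\partial_1\mathbf{n}\times\partial_2\mathbf{n})dx$, which is an integer for $\mathbf{n}\in\mathcal{M}$, and $\mathcal{M}_k=\{\mathbf{n}\in\mathcal{M}\mid Q[\mathbf{n}]=k\}$ for $k\in\mathbb{Z}$. *)

(* Defs.v *)
From HB Require Import structures.
From mathcomp Require Import all_boot all_order all_algebra.
From mathcomp Require Import all_classical all_reals all_analysis.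
Set Implicit Arguments. Unset Strict Implicit. Unset Printing Implicit Defensive.
Import Order.TTheory GRing.Theory Num.Theory.
Import numFieldNormedType.Exports.
Local Open Scope classical_set_scope.
Local Open Scope ring_scope.

Section Skyrmion.
Variable R : realType.

Definition leb2 := ((@lebesgue_measure R) \x (@lebesgue_measure R))%E.

Definition c1 : 'I_3 := @Ordinal 3 0 isT.
Definition c2 : 'I_3 := @Ordinal 3 1 isT.
Definition c3 : 'I_3 := @Ordinal 3 2 isT.
Definition d1 : 'I_2 := @Ordinal 2 0 isT.
Definition d2 : 'I_2 := @Ordinal 2 1 isT.

Definition shift (j : 'I_2) (x : R * R) (t : R) : R * R :=
  if j == d1 then (x.1 + t, x.2) else (x.1, x.2 + t).

Definition pd (j : 'I_2) (phi : R * R -> R) (x : R * R) : R :=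
  derive1 (fun t => phi (shift j x t)) 0.

Definition square (M : R) : set (R * R) := `[- M, M] `*` `[- M, M].

Definition test_fun (phi : R * R -> R) : Prop :=
  [/\ (exists M : R, forall x, ~ square M x -> phi x = 0),
      continuous phi &
      forall j : 'I_2,
        (forall x, derivable (fun t => phi (shift j x t)) 0 1) /\
        continuous (pd j phi)].

Definition L2loc (f : R * R -> R) : Prop :=
  measurable_fun setT f /\
  forall M : R, (\int[leb2]_(x in square M) ((f x) ^+ 2)%:E < +oo)%E.

Definition weak_pd (j : 'I_2) (f g : R * R -> R) : Prop :=
  L2loc g /\
  forall phi, test_fun phi ->
    (\int[leb2]_x (f x * pd j phi x)%:E = - \int[leb2]_x (g x * phi x)%:E)%E.

Definition sphere_map (n : 'I_3 -> R * R -> R) : Prop :=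
  (forall i, measurable_fun setT (n i)) /\
  forall x, (n c1 x) ^+ 2 + (n c2 x) ^+ 2 + (n c3 x) ^+ 2 = 1.

Definition weak_grad (n : 'I_3 -> R * R -> R)
  (g : 'I_3 -> 'I_2 -> R * R -> R) : Prop :=
  forall i j, weak_pd j (n i) (g i j).

Local Open Scope ereal_scope.

Definition Dir (g : 'I_3 -> 'I_2 -> R * R -> R) : \bar R :=
  (2^-1)%:E * \int[leb2]_x (\sum_(i < 3) \sum_(j < 2) (g i j x) ^+ 2)%:E.

Definition Helic (n : 'I_3 -> R * R -> R)
  (g : 'I_3 -> 'I_2 -> R * R -> R) : \bar R :=
  \int[leb2]_x (n c1 x * g c3 d2 x - n c2 x * g c3 d1 x
                + (n c3 x - 1) * (g c2 d1 x - g c1 d2 x))%:E.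

Definition Pot (n : 'I_3 -> R * R -> R) : \bar R :=
  (2^-1)%:E * \int[leb2]_x ((1 - n c3 x) ^+ 2)%:E.

Definition Energy (r : R) n g : \bar R := Dir g + r%:E * Helic n g + Pot n.

(* topological degree Q[n] = 1/(4 pi) \int n . (d1 n x d2 n) *)
Definition degree (n : 'I_3 -> R * R -> R)
  (g : 'I_3 -> 'I_2 -> R * R -> R) : \bar R :=
  ((4 * pi)^-1)%:E *
  \int[leb2]_x (n c1 x * (g c2 d1 x * g c3 d2 x - g c3 d1 x * g c2 d2 x)
              + n c2 x * (g c3 d1 x * g c1 d2 x - g c1 d1 x * g c3 d2 x)
              + n c3 x * (g c1 d1 x * g c2 d2 x - g c2 d1 x * g c1 d2 x))%:E.

Definition in_Mk (k : int) n g : Prop :=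
  [/\ sphere_map n, weak_grad n g, Dir g < +oo, Pot n < +oo &
      degree n g = (k%:~R)%:E].

Definition energy_values (r : R) (k : int) : set (\bar R) :=
  [set e | exists n g, in_Mk k n g /\ e = Energy r n g].

End Skyrmion.

(* Main.v *)
(* Lower bounds. Completing the square gives, almost everywhere,
   jac <= |grad n|^2 / 2 + r hel + r^2 (1 - n_3)^2 / 2, where jac is the degree density;
   integrating, 4 pi k <= D + r H + r^2 V <= E_r for r <= 1. For k < 0, r^2 times the
   inequality with 1 / r in place of r, plus (1 - r^2) |jac| <= (1 - r^2) |grad n|^2 / 2, bounds
   the energy density below by (2 r^2 - 1) jac. These pointwise
   inequalities need n . d_j n = 0 almost everywhere for weak derivatives, obtained by slicing
   the plane into lines and mollifying on almost every line.

   Upper bounds. Take n = (+-s y, s x, c), where s and c are radial stereographic profiles of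
   scale al, cut off at radius^2 between T and 2 T so that n = e_3 outside a compact set.
   Disjoint translates of such blocks can be glued, which adds degrees and energies. Degree 1
   blocks have energy close to 4 pi (al -> oo) and degree -1 blocks energy close to
   4 pi (1 - 2 r^2) (al = 1 / (2 r), T -> oo). For r > 1 a pair of opposite blocks has
   negative energy and degree 0, so adding pairs drives the energy to -oo. *)
Require Import Defs.
From HB Require Import structures.
From mathcomp Require Import all_boot all_order all_algebra.
From mathcomp Require Import all_classical all_reals all_analysis.
From mathcomp Require Import measurable_realfun ring lra.
Import Order.TTheory GRing.Theory Num.Theory.
Import numFieldNormedType.Exports.
Local Open Scope classical_set_scope.
Local Open Scope ring_scope.
Set Implicit Arguments. Unset Strict Implicit. Unset Printing Implicit Defensive.

(** * Calculus on the line *)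

(** A weak gradient is tied to [n] only through integrals against test functions, so the relation n
    . d_j n = 0 cannot be had by differentiating |n|^2 = 1 pointwise. On almost every line, however,
    each component agrees at its Lebesgue points with a constant plus the primitive of its weak
    derivative. These primitives are differentiable almost everywhere, and their squared norm is 1
    on a dense set. The exceptional null sets depend on the scale and the centre of the mollifier,
    so scales are taken integer and centres rational, and continuity in the centre recovers the real
    ones.

    For degree -1 the stereographic map without cutoff already has the wanted energy density, but it
    is not constant near infinity and could not be glued. The cutoff is applied to the stereographic
    coordinate and not to [n]: the values stay on the sphere, the profile [c] still runs from -1 to
    1, so the degree is unchanged, and all densities beyond radius^2 T are of order 1/t^2 in t = x^2
    + y^2. They cost an energy of order 1/T. *)

Section sqpos.
Context {R : realType}.
Implicit Types u x : R.

Definition pos u : R := Num.max 0 u.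
(** The square of the positive part is C^1, the regularity that [test_fun] asks for. The mollifier
    and the radial cutoff are both built from it. *)
Definition sqpos u : R := pos u ^+ 2.

Lemma pos_ge0 u : 0 <= pos u. Proof. by rewrite /pos le_max lexx. Qed.
Lemma pos_gt0E u : 0 <= u -> pos u = u. Proof. by move=> u0; rewrite /pos max_r. Qed.
Lemma pos_le0E u : u <= 0 -> pos u = 0. Proof. by move=> u0; rewrite /pos max_l. Qed.

Lemma sqpos_ge0 u : 0 <= sqpos u. Proof. exact: sqr_ge0. Qed.
Lemma sqpos_gt0E u : 0 <= u -> sqpos u = u ^+ 2. Proof. by move=> u0; rewrite /sqpos pos_gt0E. Qed.
Lemma sqpos_le0E u : u <= 0 -> sqpos u = 0. Proof. by move=> u0; rewrite /sqpos pos_le0E ?expr0n. Qed.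

Lemma continuous_pos : continuous pos.
Proof. by move=> x; apply: continuous_max => //; exact: cvg_cst. Qed.

Lemma continuous_sqpos : continuous sqpos.
Proof.
by move=> x; apply: (@continuous_comp _ _ _ pos (fun u => u ^+ 2)); [exact: continuous_pos|exact: exprn_continuous].
Qed.

(** A quadratic remainder valid on both sides of the kink of [pos], so that one estimate yields the
    derivative at every point. *)
Lemma sqpos_incr_bound x h : `|sqpos (h + x) - sqpos x - h * (2 * pos x)| <= h ^+ 2.
Proof.
rewrite /sqpos ler_norml; have [x0|x0] := leP 0 x; have [y0|y0] := leP 0 (h + x).
- rewrite !pos_gt0E//; apply/andP; split; nra.
- rewrite (pos_le0E (ltW y0)) (pos_gt0E x0); apply/andP; split; nra.
- rewrite (pos_le0E (ltW x0)) (pos_gt0E y0); apply/andP; split; nra.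
- rewrite (pos_le0E (ltW x0)) (pos_le0E (ltW y0)); apply/andP; split; nra.
Qed.

Global Instance is_derive_sqpos x : is_derive x 1 sqpos (2 * pos x).
Proof.
have H : h^-1 *: (sqpos (h *: 1 + x) - sqpos x) @[h --> 0^'] --> 2 * pos x.
  apply/cvgrPdist_le => e e0; near=> h.
  have h0 : h != 0 by near: h; exact: nbhs_dnbhs_neq.
  have hn : 0 < `|h| by rewrite normr_gt0.
  rewrite [h *: 1]mulr1 -(ler_pM2l hn) -normrM mulrBr /GRing.scale/= mulVKf//.
  rewrite distrC (le_trans (sqpos_incr_bound x h))// -real_normK ?num_real// expr2 ler_pM2l//.
  by near: h; apply: dnbhs0_le.
apply: DeriveDef; first by apply/cvg_ex; eexists; exact: H.
exact/cvg_lim.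
Unshelve. all: by end_near. Qed.

End sqpos.

(** * Integrability criteria *)

Section integral_facts.
Context d (T : measurableType d) (R : realType) (mu : {measure set T -> \bar R}).

Lemma bounded_funP (f : T -> R) (A : set T) (C : R) :
  (forall x, A x -> `|f x| <= C) -> [bounded f x | x in A].
Proof.
move=> fC; exists C; split; first exact: num_real.
by move=> r Cr x Ax; exact: le_trans (fC x Ax) (ltW Cr).
Qed.

Lemma integrable_bounded_supp (A : set T) (f : T -> R) (C : R) :
  measurable A -> (mu A < +oo)%E -> measurable_fun setT f ->
  (forall x, `|f x| <= C) -> (forall x, ~ A x -> f x = 0) ->
  mu.-integrable setT (EFin \o f).
Proof.
move=> mA Afin mf fC f0.
have -> : EFin \o f = (EFin \o f) \_ A.
  apply/funext => x; rewrite patchE; case: ifPn => // /negP; rewrite inE => xA.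
  by rewrite /= f0.
apply/(integrable_mkcond (EFin \o f) mA); apply: (measurable_bounded_integrable mA Afin).
- exact: measurable_funTS.
- by apply: bounded_funP => x _; exact: fC.
Qed.

Lemma integrable_mul_bounded (f h : T -> R) (C : R) (D : set T) : measurable D ->
  mu.-integrable D (EFin \o f) -> measurable_fun D h ->
  (forall x, D x -> `|h x| <= C) ->
  mu.-integrable D (EFin \o (fun x => f x * h x)).
Proof.
move=> mD If mh hC.
exact: (integrableMl mD If mh (bounded_funP hC)).
Qed.

Lemma Rintegral_supp (A : set T) (f : T -> R) :
  (forall x, ~ A x -> f x = 0) ->
  (\int[mu]_x f x = \int[mu]_(x in A) f x)%R.
Proof.
move=> f0; rewrite [RHS]Rintegral_mkcond; congr (Rintegral _ _ _).
apply/funext => x; rewrite patchE; case: ifPn => // /negP; rewrite inE => xA.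
by rewrite f0.
Qed.

Lemma integrable_setTS (D : set T) (f : T -> \bar R) : measurable D ->
  mu.-integrable setT f -> mu.-integrable D f.
Proof. by move=> mD; apply: integrableS. Qed.

Lemma integrable_sub (D : set T) (f g : T -> R) : measurable D ->
  mu.-integrable D (EFin \o f) -> mu.-integrable D (EFin \o g) ->
  mu.-integrable D (EFin \o (fun x => f x - g x)).
Proof. by move=> mD If Ig; exact: (integrableB mD If Ig). Qed.

Lemma integrable_add (D : set T) (f g : T -> R) : measurable D ->
  mu.-integrable D (EFin \o f) -> mu.-integrable D (EFin \o g) ->
  mu.-integrable D (EFin \o (fun x => f x + g x)).
Proof. by move=> mD If Ig; exact: (integrableD mD If Ig). Qed.

Lemma integrable_scale (D : set T) (c : R) (f : T -> R) : measurable D ->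
  mu.-integrable D (EFin \o f) -> mu.-integrable D (EFin \o (fun x => c * f x)).
Proof. by move=> mD If; exact: (integrableZl mD c If). Qed.

Lemma integrable_le (D : set T) (f g : T -> R) : measurable D ->
  measurable_fun D f -> (forall x, D x -> `|f x| <= g x) ->
  mu.-integrable D (EFin \o g) -> mu.-integrable D (EFin \o f).
Proof.
move=> mD mf fg; apply: le_integrable => //; first exact/measurable_EFinP.
by move=> x Dx /=; rewrite lee_fin (le_trans (fg _ Dx))// ler_norm.
Qed.

End integral_facts.

Section one_dim.
Context {R : realType}.
Notation mu := (@lebesgue_measure R).

Lemma is_derive_cont (f : R -> R) (x l : R) : is_derive x 1 f l -> {for x, continuous f}.
Proof. by move=> [/derivable1_diffP/differentiable_continuous + _]. Qed.

Lemma FTC_Rintegral (f F : R -> R) (a b : R) : a <= b ->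
  (forall x : R, is_derive x 1 F (f x)) -> continuous f ->
  (\int[mu]_(x in `[a, b]) f x = F b - F a)%R.
Proof.
rewrite le_eqVlt => /predU1P[<-|ab] dF cf.
  by rewrite set_itv1 Rintegral_set1 subrr.
have cF : continuous F by move=> x; exact: is_derive_cont.
rewrite /Rintegral (@continuous_FTC2 _ f F)//.
- exact: continuous_subspaceT.
- split; first by move=> x _; exact: (@ex_derive _ _ _ _ _ _ _ (dF x)).
  + by apply: cvg_at_right_filter; exact: cF.
  + by apply: cvg_at_left_filter; exact: cF.
- by move=> x _; rewrite derive1E; exact: derive_val.
Qed.

Lemma lebesgue_measure_itvcc_fin (a b : R) : (mu `[a, b] < +oo)%E.
Proof. by rewrite lebesgue_measure_itv/=; case: ifP => // _; rewrite -EFinB ltry. Qed.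

End one_dim.

(** * A C^1 bump and its primitive *)

Section kernel.
Context {R : realType}.
Notation mu := (@lebesgue_measure R).
Implicit Types u x a : R.

(** An unnormalised bump: its mass [kmass] stays symbolic and is divided out once the limit has been
    taken. *)
Definition ker u : R := sqpos (1 - u ^+ 2).

Lemma ker_ge0 u : 0 <= ker u. Proof. exact: sqpos_ge0. Qed.

Lemma ker_le1 u : `|ker u| <= 1.
Proof.
rewrite ger0_norm ?ker_ge0// /ker; have [u1|u1] := leP 0 (1 - u ^+ 2).
  by rewrite sqpos_gt0E// expr_le1// lerBlDr lerDl sqr_ge0.
by rewrite sqpos_le0E// ltW.
Qed.

Lemma ker_out u : 1 <= `|u| -> ker u = 0.
Proof.
by move=> u1; rewrite /ker sqpos_le0E// subr_le0 -real_normK ?num_real// -[1](expr1n _ 2%N) lerXn2r ?nnegrE.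
Qed.

Lemma ker_gt0 u : `|u| < 1 -> 0 < ker u.
Proof.
move=> u1; have : u ^+ 2 < 1 by rewrite -real_normK ?num_real// expr_lt1.
by rewrite -subr_gt0 => h; rewrite /ker sqpos_gt0E ?ltW// exprn_gt0.
Qed.

Definition dker u : R := 2 * pos (1 - u ^+ 2) * (- (2 * u)).

Lemma is_derive_ker u : is_derive u 1 ker (dker u).
Proof.
rewrite /ker; apply: (@is_derive1_comp _ sqpos (fun u => 1 - u ^+ 2)).
apply: is_derive_eq; rewrite /GRing.scale/=; ring.
Qed.

Lemma continuous_ker : continuous ker.
Proof. by move=> u; apply: is_derive_cont; exact: is_derive_ker. Qed.

Lemma continuous_dker : continuous dker.
Proof.
move=> u; apply: (@continuousM _ _ (fun u => 2 * pos (1 - u ^+ 2)) (fun u => - (2 * u))).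
  apply: continuousM; first exact: cvg_cst.
  apply: (@continuous_comp _ _ _ (fun u => 1 - u ^+ 2) pos); last exact: continuous_pos.
  by apply: continuousB; [exact: cvg_cst|exact: exprn_continuous].
by apply: continuousN; apply: continuousM; [exact: cvg_cst|exact: cvg_id].
Qed.

Lemma integrable_ker : mu.-integrable setT (EFin \o ker).
Proof.
apply: (@integrable_bounded_supp _ _ _ mu `[-1, 1] ker 1) => //.
- exact: lebesgue_measure_itvcc_fin.
- exact: continuous_measurable_fun continuous_ker.
- exact: ker_le1.
- move=> x /=; rewrite in_itv/= => /negP; rewrite -ler_norml -ltNge => /ltW; exact: ker_out.
Qed.

(** A smoothed Heaviside function. Two shifted copies differ by a function of compact support, which
    makes the difference of two kernels the derivative of a test function. *)
Definition kstep u : R := (\int[mu]_(t in `]-oo, u]) ker t)%R.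

Lemma is_derive_kstep u : is_derive u 1 kstep (ker u).
Proof.
have [] := @continuous_FTC1 R ker -oo%O u (u + 1); first by rewrite ltrDl.
- by apply: integrable_setTS => //; exact: integrable_ker.
- exact: ltNyr.
- exact: continuous_ker.
by move=> d e; apply: DeriveDef; [exact: d|rewrite -derive1E; exact: e].
Qed.

Lemma continuous_kstep : continuous kstep.
Proof. by move=> u; apply: is_derive_cont; exact: is_derive_kstep. Qed.

Lemma kstep_ge1 u : 1 <= u -> kstep u = kstep 1.
Proof.
move=> u1; rewrite /kstep [LHS]Rintegral_mkcond [RHS]Rintegral_mkcond.
apply: eq_Rintegral => x _; rewrite !patchE !mem_setE !in_itv/=.
case: ifPn; case: ifPn => //.
- by rewrite -ltNge => x1 _; apply: ker_out; rewrite (le_trans (ltW x1))// ler_norm.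
- by move=> /le_trans/(_ u1) ->.
Qed.

Lemma kstep_leN1 u : u <= -1 -> kstep u = 0.
Proof.
move=> u1; rewrite /kstep [LHS]Rintegral_mkcond.
rewrite -[RHS](@Rintegral_set0 _ _ _ mu ker) [RHS]Rintegral_mkcond.
apply: eq_Rintegral => x _; rewrite !patchE in_set0 !mem_setE in_itv/=.
case: ifPn => // xu; apply: ker_out.
by rewrite -normrN (le_trans _ (ler_norm _))// lerNr (le_trans xu).
Qed.

Definition kmass : R := kstep 1.

(** By the mean value theorem the mass is twice a value of [ker] inside ]-1, 1[, where the bump is
    positive. *)
Lemma kmass_gt0 : 0 < kmass.
Proof.
have [|||c] := @MVT R kstep ker (-1) 1.
- by rewrite -subr_gt0 opprK addr_gt0.
- by move=> x _; exact: is_derive_kstep.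
- by apply: continuous_subspaceT; exact: continuous_kstep.
rewrite in_itv/= -ltr_norml => c1; rewrite (kstep_leN1 (lexx _)) subr0 /kmass => ->.
by rewrite mulr_gt0// ?ker_gt0// opprK addr_gt0.
Qed.

Lemma kstep_bound u : `|kstep u| <= kmass.
Proof.
have mono : {homo kstep : x y / x <= y}.
  move=> x y xy.
  have E := FTC_Rintegral xy is_derive_kstep continuous_ker.
  rewrite -subr_ge0 -E.
  by apply: Rintegral_ge0 => t _; exact: ker_ge0.
have lo : 0 <= kstep u.
  have m1 : Num.min u (-1) <= -1 by rewrite ge_min lexx orbT.
  by rewrite -(kstep_leN1 m1); apply: mono; rewrite ge_min lexx.
have m2 : 1 <= Num.max u 1 by rewrite le_max lexx orbT.
by rewrite ger0_norm// /kmass -(kstep_ge1 m2); apply: mono; rewrite le_max lexx.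
Qed.

End kernel.

(** * Mollification at Lebesgue points *)

Section kernel_limit.
Context {R : realType}.
Notation mu := (@lebesgue_measure R).
Implicit Types (a x m : R) (f : R -> R).

Definition kerm m a x : R := m * ker (m * (x - a)).

Lemma is_derive_kstep_aff m a x :
  is_derive x 1 (fun y => kstep (m * (y - a))) (kerm m a x).
Proof.
have H : is_derive x 1 (fun y : R => m * (y - a)) m.
  by apply: is_derive_eq; rewrite /GRing.scale/=; ring.
have K := is_derive_kstep (m * (x - a)).
by rewrite /kerm mulrC; exact: (@is_derive1_comp _ kstep (fun y : R => m * (y - a))).
Qed.

Lemma continuous_kerm m a : continuous (kerm m a).
Proof.
move=> x; apply: (@continuousM _ _ (cst m) (fun x => ker (m * (x - a)))); first exact: cvg_cst.
apply: (@continuous_comp _ _ _ (fun x => m * (x - a)) ker); last exact: continuous_ker.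
apply: continuousM; first exact: cvg_cst.
by apply: continuousB; [exact: cvg_id|exact: cvg_cst].
Qed.

Definition dkerm m a x : R := m * (dker (m * (x - a)) * m).

Lemma is_derive_kerm m a x : is_derive x 1 (kerm m a) (dkerm m a x).
Proof.
have hd : is_derive x 1 (fun y : R => m * (y - a)) m.
  by apply: is_derive_eq; rewrite /GRing.scale/=; ring.
have K := @is_derive1_comp _ ker (fun y : R => m * (y - a)) x _ _ (is_derive_ker _) hd.
exact: (is_deriveZ m K).
Qed.

Lemma continuous_dkerm m a : continuous (dkerm m a).
Proof.
move=> x; apply: (@continuousM _ _ (cst m) (fun x => dker (m * (x - a)) * m)); first exact: cvg_cst.
apply: (@continuousM _ _ (fun x => dker (m * (x - a))) (cst m)); last exact: cvg_cst.
apply: (@continuous_comp _ _ _ (fun x => m * (x - a)) dker); last exact: continuous_dker.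
apply: continuousM; first exact: cvg_cst.
by apply: continuousB; [exact: cvg_id|exact: cvg_cst].
Qed.

Lemma kerm_out m a x : 0 < m -> m^-1 <= `|x - a| -> kerm m a x = 0.
Proof.
move=> m0 h; rewrite /kerm ker_out ?mulr0// normrM gtr0_norm//.
by rewrite -(divff (lt0r_neq0 m0)) ler_pM2l.
Qed.

Lemma kerm_ball m a x : 0 < m -> ~ ball a m^-1 x -> kerm m a x = 0.
Proof.
move=> m0 /= /negP h; apply: kerm_out => //.
by move: h; rewrite /ball/= -leNgt distrC.
Qed.

Lemma kerm_le m a x : 0 < m -> `|kerm m a x| <= m.
Proof.
by move=> m0; rewrite /kerm normrM gtr0_norm// ler_piMr ?ker_le1// ltW.
Qed.

Lemma Rintegral_kerm m a : 0 < m -> (\int[mu]_x kerm m a x = kmass)%R.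
Proof.
move=> m0; rewrite (@Rintegral_supp _ _ _ mu `[a - m^-1, a + m^-1]); last first.
  move=> x /=; rewrite in_itv/= => /negP xa; apply: kerm_out => //.
  by rewrite leNgt; apply: contra xa; rewrite ltr_distl => /andP[/ltW -> /ltW ->].
have am : a - m^-1 <= a + m^-1 by rewrite lerD2l ge0_cp ?invr_ge0// ltW.
rewrite (FTC_Rintegral am (is_derive_kstep_aff m a) (@continuous_kerm m a)).
have -> : m * (a + m^-1 - a) = 1 by field; rewrite gt_eqF.
have -> : m * (a - m^-1 - a) = -1 by field; rewrite gt_eqF.
by rewrite (kstep_leN1 (lexx _)) subr0.
Qed.

Lemma lebesgue_measure_ball_fin a m : (mu (ball a m) < +oo)%E.
Proof. by rewrite ball_itv lebesgue_measure_itv/=; case: ifP => // _; rewrite -EFinB ltry. Qed.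

Lemma integrable_kerm m a : 0 < m -> mu.-integrable setT (EFin \o kerm m a).
Proof.
move=> m0.
apply: (@integrable_bounded_supp _ _ _ mu (ball a m^-1) (kerm m a) m) => //.
- exact: measurable_ball.
- exact: lebesgue_measure_ball_fin.
- exact: continuous_measurable_fun (@continuous_kerm m a).
- by move=> x; exact: kerm_le.
- by move=> x; exact: kerm_ball.
Qed.

(** The kernel is at most m and lives on a ball of measure 2/m, so the mollification error is at
    most twice the mean oscillation of [f] on that ball. This oscillation tends to 0 at a Lebesgue
    point, which gives convergence at the point itself. *)
Lemma kerm_davg f a m : 0 < m -> mu.-integrable setT (EFin \o f) ->
  `| \int[mu]_x (f x * kerm m a x) - kmass * f a | <= 2 * fine (davg f a m^-1).
Proof.
move=> m0 If; set B := ball a m^-1.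
have mB : measurable B by exact: measurable_ball.
have mk : measurable_fun setT (kerm m a).
  exact: continuous_measurable_fun (@continuous_kerm m a).
have Ik := integrable_kerm a m0.
have IfB : mu.-integrable B (EFin \o f) by exact: integrable_setTS.
have Icst : mu.-integrable B (EFin \o cst (f a)).
  apply: (@measurable_bounded_integrable _ _ _ mu (cst (f a)) B mB) => //.
    exact: lebesgue_measure_ball_fin.
  exact: (@bounded_funP _ _ _ (cst (f a)) B `|f a|).
have Id : mu.-integrable B (EFin \o (fun x => f x - f a)).
  exact: integrable_sub.
have Idn := integrable_norm Id.
rewrite -(Rintegral_kerm a m0) mulrC.
rewrite (@Rintegral_supp _ _ _ mu B (fun x => f x * kerm m a x)); last first.
  by move=> x xB; rewrite kerm_ball ?mulr0.
rewrite (@Rintegral_supp _ _ _ mu B (kerm m a)); last first.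
  by move=> x xB; rewrite kerm_ball.
rewrite -RintegralZl//; last exact: integrable_setTS.
rewrite -RintegralB//; last 2 first.
- apply: (@integrable_mul_bounded _ _ _ _ _ _ m) => //; first exact: measurable_funTS.
  by move=> x _; exact: kerm_le.
- apply: (@integrable_mul_bounded _ _ _ _ (cst (f a)) _ m) => //; first exact: measurable_funTS.
  by move=> x _; exact: kerm_le.
have -> : fine (davg f a m^-1) = m / 2 * (\int[mu]_(x in B) `|f x - f a|)%R.
  rewrite /davg /iavg -/B lebesgue_measure_ball ?invr_ge0 ?ltW//.
  rewrite inver mulrn_eq0/= invr_eq0 gt_eqF// fineM//=; last first.
    by apply: integrable_fin_num => //; apply: Idn.
  have -> : (m^-1 *+ 2)^-1 = m / 2 by field; rewrite gt_eqF.
  by [].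
rewrite mulrA mulrCA divff// mulr1 -RintegralZl//.
apply: le_trans (le_normr_Rintegral _ _) _ => //.
  under eq_fun do rewrite -mulrBl.
  apply: (@integrable_mul_bounded _ _ _ _ _ _ m) => //; first exact: measurable_funTS.
  by move=> x _; exact: kerm_le.
apply: le_Rintegral => //.
- under eq_fun do rewrite -mulrBl.
  apply: integrable_norm.
  apply: (@integrable_mul_bounded _ _ _ _ _ _ m) => //; first exact: measurable_funTS.
  by move=> x _; exact: kerm_le.
- exact: integrable_scale.
- move=> x _; rewrite -mulrBl normrM mulrC ler_wpM2r//; exact: kerm_le.
Qed.

Lemma lebesgue_pt_kerm f a : mu.-integrable setT (EFin \o f) -> lebesgue_pt f a ->
  (\int[mu]_x (f x * kerm n.+1%:R a x))%R @[n --> \oo] --> kmass * f a.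
Proof.
move=> If fa.
have h n : 0 < n.+1%:R :> R by [].
have D : fine (davg f a (n.+1%:R^-1)) @[n --> \oo] --> (0 : R).
  apply: fine_cvg.
  move/cvge_at_rightP : fa => /(_ (fun n => n.+1%:R^-1)); apply.
  by split => [n|]; [rewrite invr_gt0|exact: cvg_harmonic].
apply/cvgrPdist_le => e e0.
have e20 : 0 < e / 2 by rewrite divr_gt0.
move/cvgrPdist_le : D => /(_ _ e20); apply: filterS => n.
rewrite sub0r normrN => dn; rewrite distrC.
apply: (le_trans (kerm_davg a (h n) If)).
by rewrite -ler_pdivlMl// mulrC (le_trans (ler_norm _)).
Qed.

End kernel_limit.

(** * Weak derivatives on a line *)

Section line_slice.
Context {R : realType}.
Notation mu := (@lebesgue_measure R).
Implicit Types (a x m : R) (f g : R -> R).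

Definition kstepm m a x : R := kstep (m * (x - a)).

Lemma continuous_kstepm m a : continuous (kstepm m a).
Proof. by move=> x; apply: is_derive_cont; exact: is_derive_kstep_aff. Qed.

Lemma continuous_kstepm_center m x : continuous (fun a => kstepm m a x).
Proof.
move=> a; apply: (@continuous_comp _ _ _ (fun a => m * (x - a)) kstep); last exact: continuous_kstep.
apply: continuousM; first exact: cvg_cst.
by apply: continuousB; [exact: cvg_cst|exact: cvg_id].
Qed.

Lemma continuous_kerm_center m x : continuous (fun a => kerm m a x).
Proof.
move=> a; apply: (@continuousM _ _ (cst m) (fun a => ker (m * (x - a)))); first exact: cvg_cst.
apply: (@continuous_comp _ _ _ (fun a => m * (x - a)) ker); last exact: continuous_ker.
apply: continuousM; first exact: cvg_cst.
by apply: continuousB; [exact: cvg_cst|exact: cvg_id].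
Qed.

Lemma continuous_param_integral (k : R -> R -> R) f (C : R) :
  mu.-integrable setT (EFin \o f) ->
  (forall x, continuous (fun a => k a x)) -> (forall a, continuous (k a)) ->
  (forall a x, `|k a x| <= C) ->
  continuous (fun a => \int[mu]_x (f x * k a x))%R.
Proof.
move=> If ck ck' kC a.
have Ik b : mu.-integrable setT (EFin \o (fun x => f x * k b x)).
  apply: (@integrable_mul_bounded _ _ _ mu f (k b) C) => //.
  exact: continuous_measurable_fun.
apply: (@continuity_under_integral _ _ _ mu (fun a x => f x * k a x) setT measurableT (a - 1) (a + 1)
  (fun l _ => Ik l) _ (fun x => C * `|f x|)).
- apply: aeW => x _ b _; apply: continuousM; [exact: cvg_cst|exact: ck].
- exact/integrable_scale/integrable_norm.
- by move=> b _; apply: aeW => x _; rewrite normrM mulrC ler_wpM2r.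
- by rewrite inE/= in_itv/= ltrBlDr ltrDl ltr01.
Qed.

(** Between two centres the difference of [slice_avg] is the integral of f eta' + g eta, where eta
    is a difference of two smoothed steps. Hence [g] being the weak derivative of [f] appears as
    independence of the centre [a]. *)
Definition slice_avg f g m a : R :=
  (\int[mu]_x (f x * kerm m a x) + \int[mu]_x (g x * kstepm m a x))%R.

Lemma continuous_slice_avg f g m : 0 < m ->
  mu.-integrable setT (EFin \o f) -> mu.-integrable setT (EFin \o g) ->
  continuous (slice_avg f g m).
Proof.
move=> m0 If Ig a; apply: cvgD.
- apply: (@continuous_param_integral (kerm m) f m) => //.
  + exact: continuous_kerm_center.
  + exact: continuous_kerm.
  + by move=> b x; exact: kerm_le.
- apply: (@continuous_param_integral (kstepm m) g kmass) => //.
  + exact: continuous_kstepm_center.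
  + exact: continuous_kstepm.
  + by move=> b x; exact: kstep_bound.
Qed.

Lemma cvg_kstepm_integral g a : mu.-integrable setT (EFin \o g) ->
  (\int[mu]_x (g x * kstepm n.+1%:R a x))%R @[n --> \oo] -->
  kmass * (\int[mu]_(x in `]a, +oo[) g x)%R.
Proof.
move=> Ig.
rewrite -RintegralZl//; last exact: integrable_setTS.
pose L x := if a < x then kmass * g x else 0.
have -> : (\int[mu]_(x in `]a, +oo[) (kmass * g x) = \int[mu]_x L x)%R.
  rewrite Rintegral_mkcond; apply: eq_Rintegral => x _.
  by rewrite patchE mem_setE in_itv/= andbT /L; case: ifP.
have mg : measurable_fun setT g by case/integrableP : Ig => /measurable_EFinP.
have [] := @dominated_convergence _ _ _ mu setT measurableT
  (fun n x => (g x * kstepm n.+1%:R a x)%:E) (EFin \o L) (fun x => (kmass * `|g x|)%:E).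
- move=> n; apply/measurable_EFinP; apply: measurable_funM => //.
  exact: continuous_measurable_fun (@continuous_kstepm _ _).
- apply/measurable_EFinP; apply: measurable_fun_ifT => //; last exact: measurable_funM.
  exact: measurable_fun_ltr.
(* At x = a the smoothed step equals [kstep 0] for every n, so the pointwise limit is claimed only
   off the null set {a}. *)
- exists [set a]; split => //; first exact: lebesgue_measure_set1.
  move=> x /=; apply: contra_notP => /eqP xa _; apply: cvg_EFin; first exact: nearW.
  rewrite /L; move: xa; rewrite neq_lt => /orP[xa|ax].
    rewrite ltNge (ltW xa)/=; apply: cvg_near_cst; near=> n.
    rewrite /= /kstepm kstep_leN1 ?mulr0//.
    rewrite -opprB mulrN lerN2 -ler_pdivrMr ?subr_gt0// mul1r.
    by rewrite (@le_trans _ _ n%:R)// ?ler_nat//; near: n; exact: nbhs_infty_ger.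
  rewrite ax; apply: cvg_near_cst; near=> n.
  rewrite /= /kstepm kstep_ge1 1?mulrC//.
  rewrite mulrC -ler_pdivrMr ?subr_gt0// mul1r.
  by rewrite (@le_trans _ _ n%:R)// ?ler_nat//; near: n; exact: nbhs_infty_ger.
- exact/integrable_scale/integrable_norm.
- apply: aeW => x n _; rewrite /= lee_fin normrM mulrC ler_wpM2r//; exact: kstep_bound.
move=> IL _ H.
by apply: fine_cvg; rewrite /Rintegral fineK//; apply: integrable_fin_num.
Unshelve. all: by end_near. Qed.

(** As the width tends to 0, independence of the centre becomes, after division by [kmass],
    constancy of f(a) plus the integral of [g] over ]a, +oo[. Subtracting the total integral of [g]
    replaces this half line by ]-oo, a]. *)
Lemma slice_lebesgue_pt f g (M : R) : 0 < M ->
  mu.-integrable setT (EFin \o f) -> mu.-integrable setT (EFin \o g) ->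
  (forall (n : nat) (q q' : rat),
    `|ratr q| + n.+1%:R^-1 < M -> `|ratr q'| + n.+1%:R^-1 < M ->
    slice_avg f g n.+1%:R (ratr q) = slice_avg f g n.+1%:R (ratr q')) ->
  exists K : R, forall a, `|a| < M -> lebesgue_pt f a ->
    f a = K + (\int[mu]_(x in `]-oo, a]) g x)%R.
Proof.
move=> M0 If Ig H.
(* By continuity in the centre, a value at [a] different from the value at 0 would persist at a
   nearby rational centre, against [H]. *)
have E n a : `|a| + n.+1%:R^-1 < M -> slice_avg f g n.+1%:R a = slice_avg f g n.+1%:R 0.
  move=> aM; apply/eqP; apply/negPn/negP => neq.
  have c := @continuous_slice_avg f g n.+1%:R (ltr0Sn _ _) If Ig a.
  have : \forall b \near a, slice_avg f g n.+1%:R b != slice_avg f g n.+1%:R 0.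
    have d0 : 0 < `|slice_avg f g n.+1%:R a - slice_avg f g n.+1%:R 0|.
      by rewrite normr_gt0 subr_eq0.
    move/cvgrPdist_lt : c => /(_ _ d0); apply: filterS => b; apply: contraTN => /eqP ->.
    by rewrite ltxx.
  have e0 : 0 < M - (`|a| + n.+1%:R^-1) by rewrite subr_gt0.
  move=> /(@nbhs_ballP _ _)[e /= e1 He].
  pose e2 := Num.min e (M - (`|a| + n.+1%:R^-1)).
  have e20 : 0 < e2 by rewrite lt_min e0 e1.
  have [q] := @rat_in_itvoo R (a - e2) (a + e2) ltac:(by rewrite ltrBlDr -addrA ltrDl addr_gt0).
  rewrite in_itv/= -ltr_distl => qa.
  have qM : `|ratr q| + n.+1%:R^-1 < M.
    have h1 : `|ratr q - a| < M - (`|a| + n.+1%:R^-1).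
      by rewrite (lt_le_trans qa)// /e2 ge_min lexx orbT.
    have h2 : `|ratr q| <= `|ratr q - a| + `|a| :> R.
      by have := ler_normD (ratr q - a) a; rewrite subrK.
    rewrite (le_lt_trans (lerD h2 (lexx _)))// -addrA -ltrBrDr//.
  have zM : `|@ratr R 0| + n.+1%:R^-1 < M.
    by rewrite rmorph0 normr0 (le_lt_trans _ aM)// lerD2r.
  have := He (ratr q); rewrite /ball/= distrC (lt_le_trans qa) ?ge_min ?lexx// => /(_ isT).
  by rewrite (H n q 0 qM zM) rmorph0 eqxx.
pose L := lim (slice_avg f g n.+1%:R 0 @[n --> \oo]).
pose tot := (\int[mu]_x g x)%R.
exists (L / kmass - tot) => a aM fa.
have aM' : 0 < M - `|a| by rewrite subr_gt0.
have c : slice_avg f g n.+1%:R 0 @[n --> \oo] -->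
   kmass * f a + kmass * (\int[mu]_(x in `]a, +oo[) g x)%R.
  apply: (@cvg_trans _ (slice_avg f g n.+1%:R a @[n --> \oo])); last first.
    by apply: cvgD; [exact: lebesgue_pt_kerm|exact: cvg_kstepm_integral].
  apply: near_eq_cvg; near=> n; rewrite E// -ltrBrDl.
  by near: n; exact: (near_infty_natSinv_lt (PosNum aM')).
have -> : L / kmass = f a + (\int[mu]_(x in `]a, +oo[) g x)%R.
  rewrite /L (cvg_lim _ c)//.
  by rewrite -mulrDr mulrC mulKf// gt_eqF ?kmass_gt0.
have -> : tot = (\int[mu]_(x in `]-oo, a]) g x + \int[mu]_(x in `]a, +oo[) g x)%R.
  rewrite -Rintegral_setU//; last 2 first.
  - by apply: integrable_setTS => //; exact: measurableU.
  - by rewrite -setCitvl; apply/disj_setPCl.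
  by rewrite /tot -setCitvl setUv.
by ring.
Unshelve. all: by end_near. Qed.

End line_slice.

Section ae_facts.
Context d (T : measurableType d) (R : realType) (mu : {measure set T -> \bar R}).

Lemma ae_imp (P Q : T -> Prop) : (forall x, P x -> Q x) ->
  {ae mu, forall x, P x} -> {ae mu, forall x, Q x}.
Proof. by move=> PQ; apply: filterS. Qed.

Lemma ae_imp2 (P Q S : T -> Prop) : (forall x, P x -> Q x -> S x) ->
  {ae mu, forall x, P x} -> {ae mu, forall x, Q x} -> {ae mu, forall x, S x}.
Proof. by move=> PQ; apply: filterS2. Qed.

Lemma ae_forall_count (I : countType) (Q : I -> T -> Prop) :
  (forall i, {ae mu, forall x, Q i x}) -> {ae mu, forall x, forall i, Q i x}.
Proof.
move=> H; have : {ae mu, forall x, forall n,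
    if unpickle n is Some j then Q (j : I) x else True}.
  by apply: ae_foralln => n; case: unpickle => [j|]; [exact: H|exact: aeW].
by apply: ae_imp => x Hx i; have := Hx (pickle i); rewrite pickleK.
Qed.

End ae_facts.

(** * Orthogonality of a unit vector and its derivative on a line *)

Section line_orthogonality.
Context {R : realType}.
Notation mu := (@lebesgue_measure R).

Lemma ae_integrable_lebesgue_pt (f : R -> R) : mu.-integrable setT (EFin \o f) ->
  {ae mu, forall x, lebesgue_pt f x}.
Proof.
by move=> If; apply: lebesgue_differentiation; exact: (open_integrable_locally openT).
Qed.

(** A null set contains no interval of positive length. *)
Lemma ae_dense (P : R -> Prop) (a b : R) : a < b -> {ae mu, forall x, P x} ->
  exists2 x, a < x < b & P x.
Proof.
move=> ab [N [mN N0 PN]].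
have : ~ (`]a, b[ `<=` N).
  move=> abN; have : (mu `]a, b[ <= 0)%E.
    by rewrite -N0; exact: (le_measure mu (mem_set (measurable_itv `]a, b[)) (mem_set mN) abN).
  by rewrite lebesgue_measure_itv/= lte_fin ab -EFinB lee_fin subr_le0 leNgt ab.
move=> /existsNP[x /not_implyP[/=]]; rewrite in_itv/= => xab Nx.
by exists x => //; apply: contrapT => Px; apply: Nx; exact: PN.
Qed.

(** The primitives [N i] have derivative [g i] almost everywhere, but their squared norm is known to
    be 1 only at common Lebesgue points of the [f i], not on a neighbourhood. Such points exist
    arbitrarily close to [a]; there the difference quotient of the squared norm is 0, which excludes
    a nonzero derivative. *)
Lemma line_orthogonality (p : nat) (f g : 'I_p -> R -> R) (M : R) :
  (forall i, mu.-integrable setT (EFin \o f i)) ->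
  (forall i, mu.-integrable setT (EFin \o g i)) ->
  (forall i, exists K : R, forall a, `|a| < M -> lebesgue_pt (f i) a ->
    f i a = K + (\int[mu]_(x in `]-oo, a]) g i x)%R) ->
  (forall a, `|a| < M -> \sum_i f i a ^+ 2 = 1) ->
  {ae mu, forall a, `|a| < M -> \sum_i f i a * g i a = 0}.
Proof.
move=> If Ig /choice[K HK] S1.
pose N i a := K i + (\int[mu]_(x in `]-oo, a]) g i x)%R.
have gd : {ae mu, forall a, forall i, lebesgue_pt (f i) a}.
  by apply: ae_forall_count => i; exact: ae_integrable_lebesgue_pt.
have gd' := gd.
have dN : {ae mu, forall a, forall i, is_derive (a : R) (1 : R) (N i) (g i a)}.
  apply: ae_forall_count => i.
  have Iy (y : R) : mu.-integrable `]-oo, y] (EFin \o g i).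
    by apply: integrable_setTS => //; exact: Ig.
  have := @FTC1Ny R (g i) Iy (open_integrable_locally openT (Ig i)).
  apply: ae_imp => a [d e].
  rewrite /N -[g i a]add0r; apply: is_deriveD.
  by apply: DeriveDef; [exact: d|rewrite -derive1E; exact: e].
have NS a : `|a| < M -> (forall i, lebesgue_pt (f i) a) -> \sum_i N i a ^+ 2 = 1.
  by move=> aM fa; rewrite -(S1 a aM); apply: eq_bigr => i _; rewrite (HK i a aM (fa i)).
apply: (ae_imp2 _ gd dN) => a fa da aM.
have -> : \sum_i f i a * g i a = \sum_i N i a * g i a.
  by apply: eq_bigr => i _; rewrite (HK i a aM (fa i)).
have dS : is_derive a 1 (fun x => \sum_i N i x ^+ 2) (2 * \sum_i N i a * g i a).
  have -> : (fun x => \sum_i N i x ^+ 2) = \sum_i (fun x => N i x ^+ 2).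
    by apply/funext => x; rewrite fct_sumE.
  rewrite mulr_sumr; apply: (@is_derive_sum _ _ _ p (fun i x => N i x ^+ 2)) => i.
  have := da i => dai.
  by apply: is_derive_eq; rewrite /GRing.scale/=; ring.
apply/eqP; apply/negPn/negP => n0.
have := @ex_derive _ _ _ _ _ _ _ dS; have := @derive_val _ _ _ _ _ _ _ dS.
set S := (fun x => \sum_i N i x ^+ 2) => D1 /cvg_ex[/= l Sl].
have l0 : l != 0.
  have -> : l = 2 * \sum_i N i a * g i a by rewrite -D1; apply/esym/cvg_lim.
  by rewrite mulf_neq0.
have e0 : 0 < `|l| by rewrite normr_gt0.
move/cvgrPdist_lt : Sl => /(_ _ e0).
rewrite near_withinE => /(@nbhs_ballP _ _)[d /= d0 Hd].
pose d' := Num.min d (M - `|a|).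
have d'0 : 0 < d' by rewrite lt_min d0 subr_gt0.
have [x /andP[ax xd] fx] := @ae_dense _ a (a + d') ltac:(by rewrite ltrDl) gd'.
have xM : `|x| < M.
  have : `|x - a| < M - `|a|.
    rewrite gtr0_norm ?subr_gt0// ltrBlDl (lt_le_trans xd)// lerD2l.
    by rewrite ge_min lexx orbT.
  rewrite ltrBrDr; apply: le_lt_trans.
  by have := ler_normD (x - a) a; rewrite subrK.
have := Hd (x - a); rewrite /ball/= sub0r normrN gtr0_norm ?subr_gt0//.
rewrite ltrBlDl (lt_le_trans xd) ?lerD2l ?ge_min ?lexx// => /(_ isT).
rewrite subr_eq0 gt_eqF// => /(_ isT).
rewrite [_%:A]mulr1 subrK /S (NS x xM fx) (NS a aM fa) subrr scaler0 subr0.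
by rewrite ltxx.
Qed.

End line_orthogonality.

(** * Slices of weak derivatives *)

Section plane.
Context {R : realType}.
Notation mu := (@lebesgue_measure R).
Notation mu2 := (mu \x mu)%E.

Lemma integrable_fubini_G (f : R * R -> \bar R) : mu2.-integrable setT f ->
  mu.-integrable setT (fubini_G mu f).
Proof.
move=> If; have mf := measurable_int _ If.
have maf : measurable_fun setT (abse \o f) by exact: measurableT_comp.
apply/integrableP; split; first exact: measurable_fubini_G If.
have := (integrable21ltyP _ _ mf).1 If; apply: le_lt_trans.
apply: ge0_le_integral => //.
- exact: measurableT_comp (measurable_fubini_G If).
- exact: (@measurable_fun_fubini_tonelli_G _ _ _ _ R mu (abse \o f) maf (fun z => abse_ge0 (f z))).
- move=> y _; apply: le_abse_integral => //.
  exact: measurable_fun_pair1.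
Qed.

(** Tonelli on the positive and the negative part, so that integrability never enters. It serves to
    reduce the second partial derivative to the first. *)
Lemma integral_swap (F : R * R -> \bar R) : measurable_fun setT F ->
  (\int[mu2]_z F (z.2, z.1) = \int[mu2]_z F z)%E.
Proof.
have ms : measurable_fun setT (fun z : R * R => (z.2, z.1)).
  exact: measurable_fun_pair.
have H (G : R * R -> \bar R) : measurable_fun setT G -> (forall z, 0 <= G z)%E ->
    (\int[mu2]_z G (z.2, z.1) = \int[mu2]_z G z)%E.
  move=> mG G0.
  have mGs : measurable_fun setT (fun z : R * R => G (z.2, z.1)).
    exact: (measurableT_comp mG ms).
  apply: etrans (@fubini_tonelli1 _ _ _ _ R mu mu _ mGs (fun z => G0 _)) _.
  exact: esym (@fubini_tonelli2 _ _ _ _ R mu mu G mG G0).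
move=> mF; rewrite integralE [RHS]integralE; congr (_ - _)%E.
- rewrite -(H _ (measurable_funepos mF) (fun z => funepos_ge0 F z)).
  by apply: eq_integral => z _; rewrite !funeposE.
- rewrite -(H _ (measurable_funeneg mF) (fun z => funeneg_ge0 F z)).
  by apply: eq_integral => z _; rewrite !funenegE.
Qed.

Lemma integral_product_Rintegral (F : R * R -> R) (psi : R -> R) (C : R) :
  mu2.-integrable setT (EFin \o F) -> measurable_fun setT psi ->
  (forall y, `|psi y| <= C) ->
  let P y := (\int[mu]_x F (x, y))%R in
  mu.-integrable setT (EFin \o P) /\
  (\int[mu]_y (P y * psi y) = \int[mu2]_z (F z * psi z.2))%R.
Proof.
move=> IF mpsi psiC P.
have IG := integrable_fubini_G IF.
have aeF := ae_integrable2 IF.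
have PE y : mu.-integrable setT (fun x => (EFin \o F) (x, y)) ->
    fubini_G mu (EFin \o F) y = (P y)%:E.
  by move=> Iy; rewrite /fubini_G /P /Rintegral fineK//; exact: integrable_fin_num.
have PF y : P y = fine (fubini_G mu (EFin \o F) y) by [].
have IP : mu.-integrable setT (EFin \o P).
  apply: (le_integrable _ _ _ IG) => //.
    apply/measurable_EFinP; rewrite (_ : P = fine \o fubini_G mu (EFin \o F))//.
    exact: (measurableT_comp (fine_measurable measurableT) (measurable_int _ IG)).
  by move=> y _; rewrite /= PF; case: fubini_G => [s||]//=; rewrite normr0 leey.
split => //.
have mF : measurable_fun setT F by move/measurable_EFinP: (measurable_int _ IF).
have mpsi2 : measurable_fun setT (fun z : R * R => psi z.2).
  exact: measurableT_comp mpsi measurable_snd.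
have IFp : mu2.-integrable setT (EFin \o (fun z => F z * psi z.2)).
  by apply: (@integrable_mul_bounded _ _ _ mu2 F (fun z => psi z.2) C).
rewrite /Rintegral; congr fine; rewrite -(integral21_prod_meas1 IFp).
apply: ae_eq_integral => //.
- apply/measurable_EFinP; apply: measurable_funM => //.
  by move/measurable_EFinP : (measurable_int _ IP).
- exact: measurable_int (integrable_fubini_G IFp).
- apply: ae_imp aeF => y Iy _ /=; rewrite /fubini_G EFinM -PE//.
  rewrite -integralZr//=.
Qed.

(** Testing with eta(x) psi(y) and letting psi concentrate at a height y0 isolates the line at that
    height, provided y0 is a Lebesgue point of the integral over the lines. The exceptional null set
    depends on the scale and the two centres, which therefore range over countable sets. *)
Lemma ae_slice_avg (f g : R * R -> R) (M : R) :
  mu2.-integrable setT (EFin \o f) -> mu2.-integrable setT (EFin \o g) ->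
  (forall eta deta psi dpsi : R -> R,
    (forall x : R, is_derive x 1 eta (deta x)) -> continuous deta ->
    (forall x : R, is_derive x 1 psi (dpsi x)) -> continuous dpsi ->
    (forall x, M <= `|x| -> eta x = 0 /\ deta x = 0) ->
    (forall x, M <= `|x| -> psi x = 0) ->
    (\int[mu2]_z ((f z * deta z.1 + g z * eta z.1) * psi z.2) = 0)%R) ->
  {ae mu, forall y, `|y| < M ->
    forall (n : nat) (q q' : rat),
    `|ratr q| + n.+1%:R^-1 < M -> `|ratr q'| + n.+1%:R^-1 < M ->
    slice_avg (fun x => f (x, y)) (fun x => g (x, y)) n.+1%:R (ratr q) =
    slice_avg (fun x => f (x, y)) (fun x => g (x, y)) n.+1%:R (ratr q')}.
Proof.
move=> If Ig H.
have mfst (h : R -> R) : measurable_fun setT h -> measurable_fun setT (fun z : R * R => h z.1).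
  by move=> mh; exact: measurableT_comp mh measurable_fst.
have main n (q q' : rat) : `|ratr q| + n.+1%:R^-1 < M -> `|ratr q'| + n.+1%:R^-1 < M ->
    {ae mu, forall y, `|y| < M ->
    slice_avg (fun x => f (x, y)) (fun x => g (x, y)) n.+1%:R (ratr q) =
    slice_avg (fun x => f (x, y)) (fun x => g (x, y)) n.+1%:R (ratr q')}.
  set m : R := n.+1%:R; set a : R := ratr q; set a' : R := ratr q' => qM qM'.
  have m0 : 0 < m by rewrite ltr0Sn.
  pose eta x := kstepm m a x - kstepm m a' x.
  pose deta x := kerm m a x - kerm m a' x.
  have ceta : continuous eta.
    by move=> x; apply: cvgB; exact: continuous_kstepm.
  have cdeta : continuous deta.
    by move=> x; apply: cvgB; exact: continuous_kerm.
  have meta : measurable_fun setT eta by exact: continuous_measurable_fun.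
  have mdeta : measurable_fun setT deta by exact: continuous_measurable_fun.
  have beta x : `|eta x| <= kmass + kmass.
    by rewrite (le_trans (ler_normB _ _))// lerD// kstep_bound.
  have bdeta x : `|deta x| <= m + m.
    by rewrite (le_trans (ler_normB _ _))// lerD// kerm_le.
  have deta_der (x : R) : is_derive x 1 eta (deta x).
    by apply: is_deriveB; exact: is_derive_kstep_aff.
  (* Outside ]-M, M[ both smoothed steps sit on the same plateau, 0 on the left and [kmass] on the
     right, so [eta] vanishes there. *)
  have out x b : `|b| + m^-1 < M -> M <= `|x| -> kerm m b x = 0 /\
      (kstepm m b x = if 0 <= x then kmass else 0).
    move=> bM Mx; have far : m^-1 <= `|x - b|.
      have := ler_normD (x - b) b; rewrite subrK => h.
      have := lt_le_trans bM (le_trans Mx h).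
      by rewrite addrC => /ltW; rewrite lerD2r.
    split; first exact: kerm_out.
    have b1 := ler_norm b; have b2 := ler_norm (- b); rewrite normrN in b2.
    case: ifPn => x0; rewrite /kstepm.
      rewrite ger0_norm// in Mx.
      apply: kstep_ge1; rewrite -ler_pdivrMl// mulr1.
      by move: bM Mx b1; clear; set w := m^-1; lra.
    rewrite -ltNge in x0; rewrite ltr0_norm// in Mx.
    apply: kstep_leN1; rewrite -ler_pdivlMl// mulrN1.
    by move: bM Mx b2; clear; set w := m^-1; lra.
  have out0 x : M <= `|x| -> eta x = 0 /\ deta x = 0.
    move=> Mx; have [e1 e2] := out x a qM Mx; have [e3 e4] := out x a' qM' Mx.
    by rewrite /eta /deta e1 e2 e3 e4 !subrr.
  pose F z := f z * deta z.1 + g z * eta z.1.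
  have IF : mu2.-integrable setT (EFin \o F).
    apply: integrable_add => //.
    - apply: (@integrable_mul_bounded _ _ _ mu2 f (fun z => deta z.1) (m + m)) => //.
      exact: mfst.
    - apply: (@integrable_mul_bounded _ _ _ mu2 g (fun z => eta z.1) (kmass + kmass)) => //.
      exact: mfst.
  pose P y := (\int[mu]_x F (x, y))%R.
  have IP : mu.-integrable setT (EFin \o P).
    by have [] := @integral_product_Rintegral F (cst 0) 0 IF (measurable_cst _) (fun y => ltac:(by rewrite normr0)).
  (* The role of psi is played by [kerm] centred at y0 with scale p + 1; it vanishes beyond M as
     soon as 1/(p + 1) < M - |y0|. *)
  have P0 : {ae mu, forall y, `|y| < M -> P y = 0}.
    apply: ae_imp (ae_integrable_lebesgue_pt IP) => y0 Py0 y0M.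
    have L := lebesgue_pt_kerm IP Py0.
    have : kmass * P y0 = 0.
      rewrite -(cvg_lim (@Rhausdorff R) L); apply: cvg_lim; first exact: Rhausdorff.
      apply: cvg_near_cst; near=> p.
      have p0 : 0 < p.+1%:R :> R by rewrite ltr0Sn.
      have [_ ->] := @integral_product_Rintegral F (kerm p.+1%:R y0) p.+1%:R IF
        (continuous_measurable_fun (@continuous_kerm _ _ _)) (fun x => kerm_le y0 x p0).
      apply: (H eta deta (kerm p.+1%:R y0) (dkerm p.+1%:R y0)) => //.
      - by move=> x; exact: is_derive_kerm.
      - exact: continuous_dkerm.
      - move=> x Mx; apply: kerm_out => //.
        have : p.+1%:R^-1 < M - `|y0| :> R.
          near: p; have y0M' : 0 < M - `|y0| by rewrite subr_gt0.
          exact: (near_infty_natSinv_lt (PosNum y0M')).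
        have := ler_normD (x - y0) y0; rewrite subrK.
        by move=> h1 h2; rewrite (le_trans (ltW h2))// lerBlDr (le_trans Mx).
    by move=> /eqP; rewrite mulf_eq0 gt_eqF ?kmass_gt0//= => /eqP.
  apply: (ae_imp2 _ P0 (ae_imp2 (fun y h1 h2 => conj h1 h2) (ae_integrable2 If) (ae_integrable2 Ig))).
  move=> y P0y [Ify Igy] yM; apply/eqP; rewrite -subr_eq0 -(P0y yM).
  have Ik (k h : R -> R) (C : R) : mu.-integrable setT (EFin \o h) ->
      continuous k -> (forall x, `|k x| <= C) -> mu.-integrable setT (EFin \o (fun x => h x * k x)).
    move=> Ih ck kC; apply: (@integrable_mul_bounded _ _ _ mu h k C) => //.
    exact: continuous_measurable_fun.
  have I1 b : mu.-integrable setT (EFin \o (fun x => f (x, y) * kerm m b x)).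
    by apply: (@Ik (kerm m b) _ m) => // [|x]; [exact: continuous_kerm|exact: kerm_le].
  have I2 b : mu.-integrable setT (EFin \o (fun x => g (x, y) * kstepm m b x)).
    by apply: (@Ik (kstepm m b) _ kmass) => // [|x]; [exact: continuous_kstepm|exact: kstep_bound].
  rewrite /slice_avg opprD addrACA -!RintegralB// -RintegralD//; last 2 first.
  - exact: integrable_sub.
  - exact: integrable_sub.
  by apply/eqP; rewrite /P; apply: eq_Rintegral => x _; rewrite /F /deta /eta /= !mulrBr.
pose Q n q q' y := slice_avg (fun x => f (x, y)) (fun x => g (x, y)) n.+1%:R (ratr q) =
    slice_avg (fun x => f (x, y)) (fun x => g (x, y)) n.+1%:R (ratr q').
pose B (n : nat) (q : rat) := `|ratr q| + n.+1%:R^-1 < M.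
have H2 : {ae mu, forall y, forall n q q', `|y| < M -> B n q -> B n q' -> Q n q q' y}.
  apply: ae_forall_count => n; apply: ae_forall_count => q; apply: ae_forall_count => q'.
  have := main n q q'; rewrite -/(B n q) -/(B n q').
  (* The range conditions on q and q' do not involve y, so they are decided before the almost
     everywhere statement is used. *)
  case: (B n q) => [/(_ isT)|_]; last first.
    apply: aeW.
    move=> y _ F.
    exfalso; discriminate F.
  case: (B n q') => [/(_ isT)|_]; last first.
    apply: aeW.
    move=> y _ _ F.
    exfalso; discriminate F.
  by apply: ae_imp => y hy yM _ _; exact: hy.
by apply: ae_imp H2 => y hy yM n q q'; exact: (hy n q q' yM).
Unshelve. all: by end_near. Qed.

End plane.

Section plane_ae.
Context {R : realType}.
Notation mu := (@lebesgue_measure R).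
Notation mu2 := (mu \x mu)%E.

Lemma ae_plane0P (F : R * R -> R) : measurable_fun setT F ->
  (\int[mu2]_z `|(F z)%:E| = 0)%E <-> {ae mu2, forall z, F z = 0}.
Proof.
move=> mF; have mF' : measurable_fun setT (EFin \o F) by exact/measurable_EFinP.
rewrite (ae_eq_integral_abs mu2 measurableT mF').
by split; apply: ae_imp => z /=; [move=> /(_ I) [->]|move=> -> _].
Qed.

End plane_ae.

(** * From almost every line to the plane *)

Section weak_slices.
Context {R : realType}.
Notation mu := (@lebesgue_measure R).
Notation mu2 := (mu \x mu)%E.

Definition swapz (z : R * R) : R * R := (z.2, z.1).

Lemma measurable_swapz : measurable_fun setT swapz.
Proof. exact: measurable_fun_pair. Qed.

(** Tonelli for |F|: the integral over the plane is an integral of slice integrals, almost all of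
    which are 0. *)
Lemma ae_plane_slices (F : R * R -> R) : measurable_fun setT F ->
  {ae mu, forall y, {ae mu, forall x, F (x, y) = 0}} -> {ae mu2, forall z, F z = 0}.
Proof.
move=> mF H; apply/ae_plane0P => //.
have maF : measurable_fun setT (abse \o (EFin \o F)).
  by apply: measurableT_comp => //; exact/measurable_EFinP.
have aF0 z : (0 <= (abse \o (EFin \o F)) z)%E by exact: abse_ge0.
have mG := @measurable_fun_fubini_tonelli_G _ _ _ _ R mu _ maF aF0.
apply: etrans (@fubini_tonelli2 _ _ _ _ R mu mu _ maF aF0) _.
rewrite -[RHS](@integral0 _ _ _ mu setT); apply: ae_eq_integral => //.
apply: ae_imp H => y Hy _; rewrite /fubini_G.
apply/(ae_eq_integral_abs mu measurableT).
  by apply/measurable_EFinP; exact: measurable_fun_pair1.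
by apply: ae_imp Hy => x /= -> _.
Qed.

Lemma ae_plane_swap (F : R * R -> R) : measurable_fun setT F ->
  {ae mu2, forall z, F (swapz z) = 0} -> {ae mu2, forall z, F z = 0}.
Proof.
move=> mF /ae_plane0P H; apply/ae_plane0P => //.
rewrite -(@integral_swap R (fun z => `|(F z)%:E|)%E); last first.
  by apply: measurableT_comp => //; exact/measurable_EFinP.
by apply: H; exact: (measurableT_comp mF measurable_swapz).
Qed.

Definition insq (M : R) (z : R * R) : bool := (`|z.1| <= M) && (`|z.2| <= M).

(** Truncation makes [n] and its weak gradient integrable on the whole plane, as the results on
    lines require, and it does not change the weak identity for test functions supported in the
    square. *)
Definition trunc M (f : R * R -> R) z : R := if insq M z then f z else 0.

Lemma insqP M z : insq M z <-> square M z.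
Proof.
rewrite /insq /square !ler_norml; split; first by move=> /andP[].
by move=> [] /=; rewrite !in_itv/= => -> ->.
Qed.

Lemma measurable_square M : measurable (square M : set (R * R)).
Proof. by apply: measurableX; exact: measurable_itv. Qed.

Lemma square_fin (M : R) : (mu2 (square M) < +oo)%E.
Proof.
rewrite /square product_measure1E; [|exact: measurable_itv|exact: measurable_itv].
by rewrite lte_mul_pinfty// ?lebesgue_measure_itvcc_fin// ge0_fin_numE// lebesgue_measure_itvcc_fin.
Qed.

Lemma truncE M (f : R * R -> R) : EFin \o trunc M f = (EFin \o f) \_ (square M).
Proof.
apply/funext => z; rewrite patchE /= /trunc.
case: ifPn => [/insqP h|h]; first by rewrite mem_set.
by rewrite memNset// => /insqP h'; rewrite h' in h.
Qed.

Lemma integrable_cst_square (M c : R) : mu2.-integrable (square M) (EFin \o cst c).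
Proof.
apply: (@measurable_bounded_integrable _ _ _ mu2 (cst c) (square M) (measurable_square M)).
- exact: square_fin.
- exact: measurable_cst.
- exact: (@bounded_funP _ _ _ (cst c) (square M) `|c|).
Qed.

Lemma integrable_trunc_bounded (M : R) (f : R * R -> R) :
  measurable_fun setT f -> (forall z, `|f z| <= 1) ->
  mu2.-integrable setT (EFin \o trunc M f).
Proof.
move=> mf f1; rewrite truncE; apply/(integrable_mkcond (mu := mu2) (EFin \o f)); first exact: measurable_square.
apply: (@integrable_le _ _ _ mu2 (square M) f (cst 1) (measurable_square M)) => //.
- exact: measurable_funTS.
- exact: integrable_cst_square.
Qed.

(** On a set of finite measure |g| <= 1 + g^2 suffices. *)
Lemma integrable_trunc_L2loc (M : R) (g : R * R -> R) :
  L2loc g -> mu2.-integrable setT (EFin \o trunc M g).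
Proof.
move=> [mg gM]; rewrite truncE; apply/(integrable_mkcond (mu := mu2) (EFin \o g)); first exact: measurable_square.
apply: (@integrable_le _ _ _ mu2 (square M) g (fun z => 1 + g z ^+ 2) (measurable_square M)).
- exact: measurable_funTS.
- move=> z _; have [g0|g0] := leP 0 (g z); [rewrite ger0_norm//|rewrite ltr0_norm//]; nra.
apply: integrable_add; first exact: measurable_square.
  exact: integrable_cst_square.
apply/integrableP; split.
  by apply/measurable_EFinP; apply: measurable_funTS; exact: measurable_funX.
apply: le_lt_trans (gM M); rewrite le_eqVlt; apply/orP; left; apply/eqP.
by apply: eq_integral => z _ /=; rewrite ger0_norm ?sqr_ge0.
Qed.

Lemma is_derive_shift (h : R -> R) (a l : R) : is_derive a 1 h l ->
  is_derive (0 : R) 1 (fun t => h (a + t)) l.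
Proof.
move=> H; have K : is_derive (0 : R) 1 (cst a + id) (0 + 1).
  by apply: is_deriveD.
rewrite add0r in K.
have H' : is_derive (a + 0) 1 h l by rewrite addr0.
by have := @is_derive1_comp _ h (fun t : R => a + t) 0 l 1 H' K; rewrite mulr1.
Qed.

Lemma pd_is_derive (j : 'I_2) (phi : R * R -> R) (z : R * R) (l : R) :
  is_derive (0 : R) 1 (fun t => phi (Defs.shift j z t)) l ->
  derivable (fun t => phi (Defs.shift j z t)) 0 1 /\ pd j phi z = l.
Proof.
by move=> H; split; [exact: ex_derive|rewrite /pd derive1E; exact: derive_val].
Qed.

Lemma test_fun_prod (eta deta psi dpsi : R -> R) (M : R) :
  (forall x : R, is_derive x 1 eta (deta x)) -> continuous deta ->
  (forall x : R, is_derive x 1 psi (dpsi x)) -> continuous dpsi ->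
  (forall x, M <= `|x| -> eta x = 0) -> (forall x, M <= `|x| -> psi x = 0) ->
  let phi z := eta z.1 * psi z.2 in
  [/\ test_fun phi, (forall z, pd d1 phi z = deta z.1 * psi z.2) &
      (forall z, pd d2 phi z = eta z.1 * dpsi z.2)].
Proof.
move=> deta_ cdeta dpsi_ cdpsi eta0 psi0 phi.
have ceta : continuous eta by move=> x; exact: is_derive_cont.
have cpsi : continuous psi by move=> x; exact: is_derive_cont.
have cprod (a b : R -> R) : continuous a -> continuous b ->
    continuous (fun z : R * R => a z.1 * b z.2).
  move=> ca cb z; apply: (@continuousM _ _ (fun z : R * R => a z.1) (fun z => b z.2)).
    by apply: (@continuous_comp _ _ _ fst a); [exact: cvg_fst|exact: ca].
  by apply: (@continuous_comp _ _ _ snd b); [exact: cvg_snd|exact: cb].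
have D1 z : is_derive (0 : R) 1 (fun t => phi (Defs.shift d1 z t)) (deta z.1 * psi z.2).
  have := is_deriveZ (psi z.2) (is_derive_shift (deta_ z.1)).
  move=> K; rewrite mulrC.
  rewrite (_ : (fun t => phi (Defs.shift d1 z t)) = psi z.2 \*: (fun t => eta (z.1 + t)))//.
  by apply/funext => t; rewrite /phi /Defs.shift eqxx /= mulrC.
have D2 z : is_derive (0 : R) 1 (fun t => phi (Defs.shift d2 z t)) (eta z.1 * dpsi z.2).
  by have := is_deriveZ (eta z.1) (is_derive_shift (dpsi_ z.2)).
have P1 z := (pd_is_derive (D1 z)).2; have P2 z := (pd_is_derive (D2 z)).2.
split=> //; split.
- exists M => z nz; have : ~~ insq M z by apply/negP => /insqP.
  rewrite negb_and -!ltNge => /orP[] /ltW h.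
    by rewrite /phi eta0 ?mul0r.
  by rewrite /phi psi0 ?mulr0.
- exact: cprod.
- move=> j; have [->|->] : j = d1 \/ j = d2.
    by case: j => -[|[|//]] p; [left|right]; exact: val_inj.
  + split; first by move=> z; have [] := pd_is_derive (D1 z).
    by rewrite (_ : pd d1 phi = fun z => deta z.1 * psi z.2); [exact: cprod|exact/funext].
  + split; first by move=> z; have [] := pd_is_derive (D2 z).
    by rewrite (_ : pd d2 phi = fun z => eta z.1 * dpsi z.2); [exact: cprod|exact/funext].
Qed.

Lemma bounded_continuous_supp (h : R -> R) (M : R) : continuous h ->
  (forall x, M <= `|x| -> h x = 0) -> exists C : R, forall x, `|h x| <= C.
Proof.
move=> ch h0.
have [M0|M0] := leP 0 M; last first.
  by exists 0 => x; rewrite h0 ?normr0// (le_trans (ltW M0)).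
have ch' : {within `[- M, M], continuous (fun x => `|h x|)}.
  by apply: continuous_subspaceT => x; apply: cvg_norm; exact: ch.
have [c _ H] := @EVT_max R (fun x => `|h x|) (- M) M (ge0_cp M0).2 ch'.
exists `|h c| => x; have [xM|xM] := leP M `|x|; first by rewrite h0// normr0.
by apply: H; rewrite in_itv/= -ler_norml ltW.
Qed.

Lemma trunc_mul M (h k : R * R -> R) z :
  (~~ insq M z -> k z = 0) -> trunc M h z * k z = h z * k z.
Proof. by rewrite /trunc; case: ifPn => // _ /(_ isT) ->; rewrite !mulr0. Qed.

Lemma weak_pd_trunc_test (j : 'I_2) (f g phi kap : R * R -> R) (M C : R) :
  measurable_fun setT f -> (forall z, `|f z| <= 1) -> weak_pd j f g ->
  test_fun phi -> (forall z, pd j phi z = kap z) ->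
  measurable_fun setT phi -> measurable_fun setT kap ->
  (forall z, `|phi z| <= C /\ `|kap z| <= C) ->
  (forall z, ~~ insq M z -> phi z = 0 /\ kap z = 0) ->
  (\int[mu2]_z (trunc M f z * kap z + trunc M g z * phi z) = 0)%R.
Proof.
move=> mf f1 [Lg wg] tphi pdphi mphi mkap bnd out.
have If := integrable_trunc_bounded M mf f1.
have Ig := integrable_trunc_L2loc M Lg.
have I1 : mu2.-integrable setT (EFin \o (fun z => trunc M f z * kap z)).
  by apply: (@integrable_mul_bounded _ _ _ mu2 _ kap C) => // z _; case: (bnd z).
have I2 : mu2.-integrable setT (EFin \o (fun z => trunc M g z * phi z)).
  by apply: (@integrable_mul_bounded _ _ _ mu2 _ phi C) => // z _; case: (bnd z).
have E1 : (\int[mu2]_z (f z * pd j phi z)%:E = \int[mu2]_z (trunc M f z * kap z)%:E)%E.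
  by apply: eq_integral => z _; rewrite pdphi trunc_mul// => /out[].
have E2 : (\int[mu2]_z (g z * phi z)%:E = \int[mu2]_z (trunc M g z * phi z)%:E)%E.
  by apply: eq_integral => z _; rewrite trunc_mul// => /out[].
have := wg _ tphi; rewrite (_ : leb2 (R:=R) = mu2)// E1 E2.
by move=> E; rewrite RintegralD// /Rintegral E fineN ?addNr.
Qed.

Lemma integrable_swap (h : R * R -> R) : mu2.-integrable setT (EFin \o h) ->
  mu2.-integrable setT (EFin \o (h \o swapz)).
Proof.
move=> /integrableP[mh hoo].
have mh' : measurable_fun setT (abse \o (EFin \o h)) by exact: measurableT_comp.
apply/integrableP; split; first exact: (measurableT_comp mh measurable_swapz).
by have := @integral_swap R (abse \o (EFin \o h)) mh'; rewrite /swapz => ->.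
Qed.

(** For [d2] the coordinates are exchanged, so that differentiation always acts on the first
    variable and a single slicing argument covers both directions. *)
Definition coordz (j : 'I_2) : R * R -> R * R := if j == d1 then id else swapz.

Lemma trunc_coordz j M (h : R * R -> R) : trunc M (h \o coordz j) = trunc M h \o coordz j.
Proof.
apply/funext => z; rewrite /trunc /coordz; case: (j == d1) => //=.
by rewrite /insq/= andbC.
Qed.

Lemma integrable_coordz j (h : R * R -> R) : mu2.-integrable setT (EFin \o h) ->
  mu2.-integrable setT (EFin \o (h \o coordz j)).
Proof. by rewrite /coordz; case: ifP => _ //; exact: integrable_swap. Qed.

Lemma Rintegral_swap (h : R * R -> R) : measurable_fun setT h ->
  (\int[mu2]_z h (swapz z) = \int[mu2]_z h z)%R.
Proof.
move=> mh; rewrite /Rintegral; congr fine.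
by apply: (@integral_swap R (EFin \o h)); exact/measurable_EFinP.
Qed.

(** This is the hypothesis that [ae_slice_avg] puts on the truncated pair. For [d2] the test
    function is psi(x) eta(y), which the exchange of coordinates turns back into eta(x) psi(y). *)
Lemma weak_pd_trunc (j : 'I_2) (f g : R * R -> R) (M : R) :
  measurable_fun setT f -> (forall z, `|f z| <= 1) -> weak_pd j f g ->
  forall eta deta psi dpsi : R -> R,
    (forall x : R, is_derive x 1 eta (deta x)) -> continuous deta ->
    (forall x : R, is_derive x 1 psi (dpsi x)) -> continuous dpsi ->
    (forall x, M <= `|x| -> eta x = 0 /\ deta x = 0) ->
    (forall x, M <= `|x| -> psi x = 0) ->
    (\int[mu2]_z ((trunc M (f \o coordz j) z * deta z.1 +
       trunc M (g \o coordz j) z * eta z.1) * psi z.2) = 0)%R.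
Proof.
move=> mf f1 wg eta deta psi dpsi Deta cdeta Dpsi cdpsi eta0 psi0.
have ceta : continuous eta by move=> x; exact: is_derive_cont.
have cpsi : continuous psi by move=> x; exact: is_derive_cont.
have [C1 hC1] := bounded_continuous_supp ceta (fun x h => (eta0 x h).1).
have [C2 hC2] := bounded_continuous_supp cdeta (fun x h => (eta0 x h).2).
have [C3 hC3] := bounded_continuous_supp cpsi psi0.
have C10 : 0 <= C1 by exact: le_trans (hC1 0).
have C20 : 0 <= C2 by exact: le_trans (hC2 0).
have C30 : 0 <= C3 by exact: le_trans (hC3 0).
have mprod (a b : R -> R) : continuous a -> continuous b ->
    measurable_fun setT (fun z : R * R => a z.1 * b z.2).
  move=> ca cb; apply: measurable_funM.
    exact: measurableT_comp (continuous_measurable_fun ca) measurable_fst.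
  exact: measurableT_comp (continuous_measurable_fun cb) measurable_snd.
have bprod x y : `|eta x * psi y| <= (C1 + C2) * C3 /\ `|deta x * psi y| <= (C1 + C2) * C3.
  rewrite !normrM; split; apply: ler_pM => //.
    by rewrite (le_trans (hC1 x))// lerDl.
  by rewrite (le_trans (hC2 x))// lerDr.
have oprod x y : ~~ insq M (x, y) -> eta x * psi y = 0 /\ deta x * psi y = 0.
  rewrite negb_and -!ltNge => /orP[] /ltW; last by move=> /psi0 ->; rewrite !mulr0.
  by move=> /eta0[-> ->]; rewrite !mul0r.
have : j = d1 \/ j = d2.
  by case: (j) => -[|[|//]] p; [left|right]; exact: val_inj.
move=> [] ej; rewrite {}ej in wg *.
- have [tf pd1 _] := test_fun_prod Deta cdeta Dpsi cdpsi (fun x h => (eta0 x h).1) psi0.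
  have := weak_pd_trunc_test mf f1 wg tf pd1 (mprod _ _ ceta cpsi) (mprod _ _ cdeta cpsi)
    (fun z => bprod z.1 z.2) _ => /(_ M) <-; last by case=> x y /=; exact: oprod.
  by apply: eq_Rintegral => z _ /=; rewrite mulrDl !mulrA.
- have [tf _ pd2] := test_fun_prod Dpsi cdpsi Deta cdeta psi0 (fun x h => (eta0 x h).1).
  have m1 := mprod _ _ cpsi ceta; have m2 := mprod _ _ cpsi cdeta.
  have bnd z : `|psi z.1 * eta z.2| <= (C1 + C2) * C3 /\ `|psi z.1 * deta z.2| <= (C1 + C2) * C3.
    by rewrite ![psi _ * _]mulrC.
  have out z : ~~ insq M z -> psi z.1 * eta z.2 = 0 /\ psi z.1 * deta z.2 = 0.
    by rewrite ![psi _ * _]mulrC => h; apply: oprod; rewrite /insq andbC.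
  have := weak_pd_trunc_test mf f1 wg tf pd2 m1 m2 bnd out => <-.
  have /measurable_EFinP mtf := measurable_int _ (integrable_trunc_bounded M mf f1).
  have /measurable_EFinP mtg := measurable_int _ (integrable_trunc_L2loc M wg.1).
  rewrite -[RHS]Rintegral_swap; last by apply: measurable_funD; apply: measurable_funM.
  rewrite !trunc_coordz; apply: eq_Rintegral => z _ /=.
  by rewrite /coordz /=; ring.
Qed.

Lemma orthogonality (n : 'I_3 -> R * R -> R) (g : 'I_3 -> 'I_2 -> R * R -> R) (j : 'I_2) :
  sphere_map n -> weak_grad n g ->
  {ae mu2, forall z, \sum_i n i z * g i j z = 0}.
Proof.
move=> [mn n1] wg.
have n1' z : \sum_i n i z ^+ 2 = 1.
  rewrite -(n1 z) !big_ord_recl big_ord0 addr0 addrA.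
  by congr (n _ _ ^+ 2 + n _ _ ^+ 2 + n _ _ ^+ 2); exact: val_inj.
have bn i z : `|n i z| <= 1.
  rewrite -(@ler_pXn2r _ 2%N)// ?nnegrE// expr1n real_normK ?num_real// -(n1' z).
  by rewrite (bigD1 i)//= lerDl sumr_ge0// => k _; exact: sqr_ge0.
have mg i : measurable_fun setT (g i j) by case: (wg i j) => -[].
have mS : measurable_fun setT (fun z => \sum_i n i z * g i j z).
  rewrite (_ : (fun z => \sum_i n i z * g i j z) =
     (fun z => \sum_(i <- index_enum 'I_3) (fun i z => n i z * g i j z) i z))//.
  by apply: measurable_sum => i; apply: measurable_funM.
have mc : measurable_fun setT (coordz j).
  by rewrite /coordz; case: ifP => _; [exact: measurable_id|exact: measurable_swapz].
have main : {ae mu2, forall z, \sum_i n i (coordz j z) * g i j (coordz j z) = 0}.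
  apply: (@ae_plane_slices (fun z => \sum_i n i (coordz j z) * g i j (coordz j z))).
    exact: (measurableT_comp mS mc).
  (* The squares of half side N + 1 exhaust the plane, and their countably many null sets are
     collected at once. *)
  pose fM N i := trunc N.+1%:R (n i \o coordz j).
  pose gM N i := trunc N.+1%:R (g i j \o coordz j).
  have If N i : mu2.-integrable setT (EFin \o fM N i).
    apply: integrable_trunc_bounded; first exact: measurableT_comp (mn i) mc.
    by move=> z; exact: bn.
  have Ig N i : mu2.-integrable setT (EFin \o gM N i).
    rewrite /gM trunc_coordz; apply: integrable_coordz.
    by apply: integrable_trunc_L2loc; case: (wg i j).
  have A N i := ae_slice_avg (If N i) (Ig N i) (weak_pd_trunc (mn i) (bn i) (wg i j)).
  have B : {ae mu, forall y, forall N i,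
     [/\ mu.-integrable setT (EFin \o (fun x => fM N i (x, y))),
         mu.-integrable setT (EFin \o (fun x => gM N i (x, y))) &
      `|y| < N.+1%:R -> forall m (q q' : rat),
        `|ratr q| + m.+1%:R^-1 < N.+1%:R :> R -> `|ratr q'| + m.+1%:R^-1 < N.+1%:R :> R ->
      slice_avg (fun x => fM N i (x, y)) (fun x => gM N i (x, y)) m.+1%:R (ratr q) =
      slice_avg (fun x => fM N i (x, y)) (fun x => gM N i (x, y)) m.+1%:R (ratr q')]}.
    apply: ae_forall_count => N; apply: ae_forall_count => i.
    apply: (ae_imp2 _ (ae_imp2 (fun y h1 h2 => conj h1 h2) (ae_integrable2 (If N i)) (ae_integrable2 (Ig N i))) (A N i)).
    by move=> y [h1 h2] h3.
  apply: ae_imp B => y By.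
  have C : {ae mu, forall x, forall N, `|y| < N.+1%:R -> `|x| < N.+1%:R ->
      \sum_i fM N i (x, y) * gM N i (x, y) = 0}.
    apply: ae_forall_count => N.
    have [yN|yN] := ltP `|y| N.+1%:R; last first.
      by apply: aeW => x F; exfalso; discriminate F.
    have := @line_orthogonality R 3 (fun i x => fM N i (x, y)) (fun i x => gM N i (x, y)) N.+1%:R
      (fun i => let: And3 h _ _ := By N i in h) (fun i => let: And3 _ h _ := By N i in h).
    move=> H; apply: ae_imp (H _ _) => [x Hx _|i|a aN]; first exact: Hx.
    - have [h1 h2 h3] := By N i.
      exact: slice_lebesgue_pt (ltr0Sn R N) h1 h2 (h3 yN).
    - rewrite -[RHS](n1' (coordz j (a, y))); apply: eq_bigr => i _.
      by rewrite /fM /trunc /insq/= !ltW.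
  apply: ae_imp C => x Cx.
  (* In a square with the point (x, y) in its interior, the truncated functions take the original
     values there. *)
  have [N xyN] : exists N : nat, Num.max `|x| `|y| < N.+1%:R.
    exists (Num.trunc (Num.max `|x| `|y|)).
    by apply: truncnS_gt.
  move: xyN; rewrite gt_max => /andP[xN yN].
  rewrite -[RHS](Cx N yN xN); apply: eq_bigr => i _.
  by rewrite /fM /gM /trunc /insq /= !ltW.
move: main; rewrite /coordz; case: ifP => _ //.
exact: ae_plane_swap.
Qed.

End weak_slices.

(** * Lower bounds *)

Section pointwise.
Context {R : realFieldType}.
Implicit Types n a b r : R.

Definition grad2 a1 a2 a3 b1 b2 b3 : R := a1 ^+ 2 + b1 ^+ 2 + (a2 ^+ 2 + b2 ^+ 2) + (a3 ^+ 2 + b3 ^+ 2).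
Definition hel n1 n2 n3 a2 a3 b1 b3 : R := n1 * b3 - n2 * a3 + (n3 - 1) * (a2 - b1).
Definition jac n1 n2 n3 a1 a2 a3 b1 b2 b3 : R :=
  n1 * (a2 * b3 - a3 * b2) + n2 * (a3 * b1 - a1 * b3) + n3 * (a1 * b2 - a2 * b1).

(* Completing the square |A + n x B|^2 with A = d_1 n - r e_1 x n, B = d_2 n - r e_2 x n. *)
Lemma bogomolny n1 n2 n3 a1 a2 a3 b1 b2 b3 r :
  n1 ^+ 2 + n2 ^+ 2 + n3 ^+ 2 = 1 ->
  n1 * a1 + n2 * a2 + n3 * a3 = 0 -> n1 * b1 + n2 * b2 + n3 * b3 = 0 ->
  jac n1 n2 n3 a1 a2 a3 b1 b2 b3 <=
    2^-1 * grad2 a1 a2 a3 b1 b2 b3 + r * hel n1 n2 n3 a2 a3 b1 b3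
    + r ^+ 2 * (2^-1 * (1 - n3) ^+ 2).
Proof.
move=> nn na nb.
pose A2 := a2 + r * n3; pose A3 := a3 - r * n2.
pose B1 := b1 - r * n3; pose B3 := b3 + r * n1.
pose S := (a1 + (n2 * B3 - n3 * b2)) ^+ 2 + (A2 + (n3 * B1 - n1 * B3)) ^+ 2
  + (A3 + (n1 * b2 - n2 * B1)) ^+ 2.
have S0 : 0 <= S by rewrite !addr_ge0 ?sqr_ge0.
rewrite -subr_ge0.
(* Every summand on the right other than [2^-1 * S] carries a factor that vanishes under the three
   constraints. *)
have -> : 2^-1 * grad2 a1 a2 a3 b1 b2 b3 + r * hel n1 n2 n3 a2 a3 b1 b3
    + r ^+ 2 * (2^-1 * (1 - n3) ^+ 2) - jac n1 n2 n3 a1 a2 a3 b1 b2 b3 =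
  2^-1 * S + 2^-1 * (B1 ^+ 2 + b2 ^+ 2 + B3 ^+ 2) * (1 - (n1 ^+ 2 + n2 ^+ 2 + n3 ^+ 2))
  + 2^-1 * (n1 * b1 + n2 * b2 + n3 * b3) ^+ 2
  - r * n2 * (n1 * a1 + n2 * a2 + n3 * a3) + r * n1 * (n1 * b1 + n2 * b2 + n3 * b3)
  + (n1 ^+ 2 + n2 ^+ 2 + n3 ^+ 2 - 1) * (r * a2 - r * b1 + r ^+ 2 * n3 - 2^-1 * r ^+ 2).
  by rewrite /grad2 /hel /jac /S /A2 /A3 /B1 /B3; field.
by rewrite nn na nb !subrr expr0n/= !(mulr0, mul0r, addr0, subr0) mulr_ge0// invr_ge0.
Qed.

(** This is [bogomolny] at r = 0, used twice: exchanging the two derivatives flips the sign of [jac]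
    and preserves [grad2]. *)
Lemma jac_bound n1 n2 n3 a1 a2 a3 b1 b2 b3 :
  n1 ^+ 2 + n2 ^+ 2 + n3 ^+ 2 = 1 ->
  n1 * a1 + n2 * a2 + n3 * a3 = 0 -> n1 * b1 + n2 * b2 + n3 * b3 = 0 ->
  `|jac n1 n2 n3 a1 a2 a3 b1 b2 b3| <= 2^-1 * grad2 a1 a2 a3 b1 b2 b3.
Proof.
move=> nn na nb.
have h1 := @bogomolny n1 n2 n3 a1 a2 a3 b1 b2 b3 0 nn na nb.
have h2 := @bogomolny n1 n2 n3 b1 b2 b3 a1 a2 a3 0 nn nb na.
rewrite expr0n/= !mul0r !addr0 in h1 h2.
have E : jac n1 n2 n3 b1 b2 b3 a1 a2 a3 = - jac n1 n2 n3 a1 a2 a3 b1 b2 b3 by rewrite /jac; ring.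
have E2 : grad2 b1 b2 b3 a1 a2 a3 = grad2 a1 a2 a3 b1 b2 b3 by rewrite /grad2; ring.
by rewrite ler_norml lerNl -E -E2 h2 E2 h1.
Qed.

Lemma mul_bound (s w b : R) : `|s| <= 2 * w -> `|s * b| <= w ^+ 2 + b ^+ 2.
Proof.
move=> sw; rewrite normrM (le_trans (ler_wpM2r (normr_ge0 b) sw))//.
rewrite -[b ^+ 2]real_normK ?num_real// -subr_ge0.
by rewrite (_ : _ - _ = (w - `|b|) ^+ 2) ?sqr_ge0//; ring.
Qed.

(* In the first two terms, n_3 d_j n_3 = - n_1 d_j n_1 - n_2 d_j n_2 trades d_j n_3 for
   terms carrying a factor of order 1 - n_3. *)
Lemma hel_bound n1 n2 n3 a1 a2 a3 b1 b2 b3 :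
  n1 ^+ 2 + n2 ^+ 2 + n3 ^+ 2 = 1 ->
  n1 * a1 + n2 * a2 + n3 * a3 = 0 -> n1 * b1 + n2 * b2 + n3 * b3 = 0 ->
  `|hel n1 n2 n3 a2 a3 b1 b3| <= 2 * grad2 a1 a2 a3 b1 b2 b3 + 8 * (1 - n3) ^+ 2.
Proof.
move=> nn na nb; pose w := 1 - n3.
have n31 : `|n3| <= 1.
  rewrite -(@ler_pXn2r _ 2%N)// ?nnegrE// expr1n real_normK ?num_real//.
  have := sqr_ge0 n1; have := sqr_ge0 n2; lra.
have /andP[n3l n3u] : -1 <= n3 <= 1 by rewrite -ler_norml.
have w0 : 0 <= w by rewrite subr_ge0.
(* The left side is (1 - n_3)(1 + n_3), and 1 + n_3 <= 2. *)
have n12 : n1 ^+ 2 + n2 ^+ 2 <= 2 * w by rewrite /w; nra.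
have s1 : `|n1 ^+ 2| <= 2 * w by rewrite ger0_norm ?sqr_ge0//; have := sqr_ge0 n2; lra.
have s2 : `|n2 ^+ 2| <= 2 * w by rewrite ger0_norm ?sqr_ge0//; have := sqr_ge0 n1; lra.
have s12 : `|n1 * n2| <= 2 * w.
  by apply: le_trans n12; rewrite ler_norml; apply/andP; split; nra.
have sw : `|w| <= 2 * w by rewrite ger0_norm//; lra.
have le1 x : x ^+ 2 <= 2 * w -> x ^+ 2 <= 1 -> `|w * x| <= 2 * w.
  move=> _ x1; rewrite normrM ger0_norm// mulrC ler_wpM2r//.
  by have : `|x| <= 1 by [rewrite -(@ler_pXn2r _ 2%N)// ?nnegrE// expr1n real_normK ?num_real//]; lra.
have n1w : `|w * n1| <= 2 * w by apply: le1; have := sqr_ge0 n2; have := sqr_ge0 n3; lra.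
have n2w : `|w * n2| <= 2 * w by apply: le1; have := sqr_ge0 n1; have := sqr_ge0 n3; lra.
have -> : hel n1 n2 n3 a2 a3 b1 b3 =
  (w * n1 * b3 - n1 ^+ 2 * b1 - n1 * n2 * b2)
  - (w * n2 * a3 - n1 * n2 * a1 - n2 ^+ 2 * a2) - w * a2 + w * b1
  + n1 * (n1 * b1 + n2 * b2 + n3 * b3) - n2 * (n1 * a1 + n2 * a2 + n3 * a3).
  by rewrite /hel /w; ring.
rewrite na nb !mulr0 addr0 subr0.
have := mul_bound b3 n1w; have := mul_bound b1 s1; have := mul_bound b2 s12.
have := mul_bound a3 n2w; have := mul_bound a1 s12; have := mul_bound a2 s2.
have := mul_bound a2 sw; have := mul_bound b1 sw.
rewrite !ler_norml => /andP[? ?] /andP[? ?] /andP[? ?] /andP[? ?] /andP[? ?] /andP[? ?] /andP[? ?] /andP[? ?].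
have := sqr_ge0 a1; have := sqr_ge0 a2; have := sqr_ge0 a3.
have := sqr_ge0 b1; have := sqr_ge0 b2; have := sqr_ge0 b3.
rewrite -/w /grad2 => ? ? ? ? ? ?.
by apply/andP; split; lra.
Qed.

End pointwise.

(** * Integrated lower bounds *)

Section lower_bound.
Context {R : realType}.
Notation mu := (@lebesgue_measure R).
Notation mu2 := (mu \x mu)%E.
Implicit Types (n : 'I_3 -> R * R -> R) (g : 'I_3 -> 'I_2 -> R * R -> R).

Lemma Rintegral_ae_ge0 (F : R * R -> R) : mu2.-integrable setT (EFin \o F) ->
  {ae mu2, forall z, 0 <= F z} -> (0 <= \int[mu2]_z F z)%R.
Proof.
move=> IF F0; have mF : measurable_fun setT F by move/measurable_EFinP : (measurable_int _ IF).
have -> : (\int[mu2]_z F z = \int[mu2]_z Num.max (F z) 0)%R.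
  rewrite /Rintegral; congr fine; apply: ae_eq_integral => //.
  - exact/measurable_EFinP.
  - by apply/measurable_EFinP; apply: measurable_maxr => //; exact: measurable_cst.
  - by apply: ae_imp F0 => z Fz _; rewrite max_l.
by apply: Rintegral_ge0 => z _; rewrite le_max lexx orbT.
Qed.

Lemma ae_integrable_le (F G : R * R -> R) : measurable_fun setT F -> measurable_fun setT G ->
  {ae mu2, forall z, `|F z| <= G z} ->
  mu2.-integrable setT (EFin \o G) -> mu2.-integrable setT (EFin \o F).
Proof.
move=> mF mG FG IG; apply/integrableP; split; first exact/measurable_EFinP.
case/integrableP : IG => _; apply: le_lt_trans.
apply: ae_ge0_le_integral => //.
- by apply: measurableT_comp => //; exact/measurable_EFinP.
- by apply: measurableT_comp => //; exact/measurable_EFinP.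
- by apply: ae_imp FG => z Fz _ /=; rewrite lee_fin (le_trans Fz)// ler_norm.
Qed.

Definition dens_dir g z : R :=
  grad2 (g c1 d1 z) (g c2 d1 z) (g c3 d1 z) (g c1 d2 z) (g c2 d2 z) (g c3 d2 z).
Definition dens_hel n g z : R :=
  hel (n c1 z) (n c2 z) (n c3 z) (g c2 d1 z) (g c3 d1 z) (g c1 d2 z) (g c3 d2 z).
Definition dens_pot n z : R := (1 - n c3 z) ^+ 2.
Definition dens_deg n g z : R :=
  jac (n c1 z) (n c2 z) (n c3 z) (g c1 d1 z) (g c2 d1 z) (g c3 d1 z)
      (g c1 d2 z) (g c2 d2 z) (g c3 d2 z).

Lemma dens_dirE g z : \sum_(i < 3) \sum_(j < 2) (g i j z) ^+ 2 = dens_dir g z.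
Proof.
rewrite !big_ord_recl !big_ord0 !addr0 /dens_dir /grad2 addrA.
by congr (g _ _ _ ^+ 2 + g _ _ _ ^+ 2 + (g _ _ _ ^+ 2 + g _ _ _ ^+ 2)
  + (g _ _ _ ^+ 2 + g _ _ _ ^+ 2)); exact: val_inj.
Qed.

Lemma DirE g : Dir g = ((2^-1)%:E * \int[mu2]_z (dens_dir g z)%:E)%E.
Proof. by rewrite /Dir; congr (_ * _)%E; apply: eq_integral => z _; rewrite dens_dirE. Qed.

Lemma HelicE n g : Helic n g = (\int[mu2]_z (dens_hel n g z)%:E)%E.
Proof. by []. Qed.

Lemma PotE n : Pot n = ((2^-1)%:E * \int[mu2]_z (dens_pot n z)%:E)%E.
Proof. by []. Qed.

Lemma degreeE n g : degree n g = (((4 * pi)^-1)%:E * \int[mu2]_z (dens_deg n g z)%:E)%E.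
Proof.
by rewrite /degree; congr (_ * _)%E; apply: eq_integral => z _; rewrite /dens_deg /jac; congr EFin; ring.
Qed.

Definition dens_energy (r : R) n g z : R :=
  2^-1 * dens_dir g z + r * dens_hel n g z + 2^-1 * dens_pot n z.

Lemma integral_fineK (F : R * R -> R) : mu2.-integrable setT (EFin \o F) ->
  (\int[mu2]_z (F z)%:E)%E = ((\int[mu2]_z F z)%R)%:E.
Proof. by move=> IF; rewrite /Rintegral fineK//; exact: integrable_fin_num. Qed.

Lemma EnergyE (r : R) n g :
  mu2.-integrable setT (EFin \o dens_dir g) ->
  mu2.-integrable setT (EFin \o dens_hel n g) ->
  mu2.-integrable setT (EFin \o dens_pot n) ->
  mu2.-integrable setT (EFin \o dens_energy r n g) /\
  Energy r n g = ((\int[mu2]_z dens_energy r n g z)%R)%:E.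
Proof.
move=> Id Ih Iv.
have Id' := @integrable_scale _ _ _ mu2 setT 2^-1 (dens_dir g) measurableT Id.
have Ih' := @integrable_scale _ _ _ mu2 setT r (dens_hel n g) measurableT Ih.
have Iv' := @integrable_scale _ _ _ mu2 setT 2^-1 (dens_pot n) measurableT Iv.
split; first by apply: integrable_add => //; apply: integrable_add.
rewrite /Energy DirE HelicE PotE !integral_fineK// -!EFinM -!EFinD; congr EFin.
have I12 := integrable_add measurableT Id' Ih'.
rewrite /dens_energy (RintegralD measurableT I12 Iv') (RintegralD measurableT Id' Ih').
by rewrite (RintegralZl _ measurableT Id) (RintegralZl _ measurableT Ih) (RintegralZl _ measurableT Iv).
Qed.

Lemma degree_Rintegral n g : mu2.-integrable setT (EFin \o dens_deg n g) ->
  degree n g = ((4 * pi)^-1 * \int[mu2]_z dens_deg n g z)%:E.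
Proof. by move=> Iq; rewrite degreeE integral_fineK// EFinM. Qed.

Lemma integrable_ge0_scaled (F : R * R -> R) : measurable_fun setT F -> (forall z, 0 <= F z) ->
  ((2^-1)%:E * \int[mu2]_z (F z)%:E < +oo)%E -> mu2.-integrable setT (EFin \o F).
Proof.
move=> mF F0 Foo; apply/integrableP; split; first exact/measurable_EFinP.
have -> : (\int[mu2]_z `|(EFin \o F) z| = \int[mu2]_z (F z)%:E)%E.
  by apply: eq_integral => z _; rewrite /= ger0_norm.
rewrite ltey; apply/eqP => E; move: Foo; rewrite E.
by rewrite gt0_muley ?lte_fin ?invr_gt0.
Qed.

(** Membership bounds only the Dirichlet and potential terms. The helicity and degree densities are
    dominated by them through [hel_bound] and [jac_bound], which makes the extended real sum in
    [Energy] a sum of finite terms. *)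
Lemma in_Mk_integrable (k : int) n g : in_Mk k n g ->
  [/\ mu2.-integrable setT (EFin \o dens_dir g),
      mu2.-integrable setT (EFin \o dens_hel n g),
      mu2.-integrable setT (EFin \o dens_pot n) &
      mu2.-integrable setT (EFin \o dens_deg n g)] /\
  {ae mu2, forall z,
    [/\ n c1 z ^+ 2 + n c2 z ^+ 2 + n c3 z ^+ 2 = 1,
        n c1 z * g c1 d1 z + n c2 z * g c2 d1 z + n c3 z * g c3 d1 z = 0 &
        n c1 z * g c1 d2 z + n c2 z * g c2 d2 z + n c3 z * g c3 d2 z = 0]}.
Proof.
move=> [sn wg Dfin Pfin _]; have [mn n1] := sn.
have mg i j : measurable_fun setT (g i j) by case: (wg i j) => -[].
have ortho : {ae mu2, forall z,
    [/\ n c1 z ^+ 2 + n c2 z ^+ 2 + n c3 z ^+ 2 = 1,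
        n c1 z * g c1 d1 z + n c2 z * g c2 d1 z + n c3 z * g c3 d1 z = 0 &
        n c1 z * g c1 d2 z + n c2 z * g c2 d2 z + n c3 z * g c3 d2 z = 0]}.
  have S (j : 'I_2) z : \sum_i n i z * g i j z =
      n c1 z * g c1 j z + n c2 z * g c2 j z + n c3 z * g c3 j z.
    rewrite !big_ord_recl big_ord0 addr0 addrA.
    by congr (n _ _ * g _ _ _ + n _ _ * g _ _ _ + n _ _ * g _ _ _); exact: val_inj.
  apply: (ae_imp2 _ (orthogonality d1 sn wg) (orthogonality d2 sn wg)) => z.
  by rewrite !S => h1 h2; split.
split=> //.
have mdir : measurable_fun setT (dens_dir g).
  by rewrite /dens_dir /grad2; do ?apply: measurable_funD; apply: measurable_funX.
have mhel : measurable_fun setT (dens_hel n g).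
  rewrite /dens_hel /hel; do ?[apply: measurable_funB|apply: measurable_funD|apply: measurable_funM] => //.
have mpot : measurable_fun setT (dens_pot n).
  by rewrite /dens_pot; apply: measurable_funX; apply: measurable_funB.
have mdeg : measurable_fun setT (dens_deg n g).
  rewrite /dens_deg /jac; do ?[apply: measurable_funB|apply: measurable_funD|apply: measurable_funM] => //.
have Id : mu2.-integrable setT (EFin \o dens_dir g).
  apply: integrable_ge0_scaled => //; last by rewrite -DirE.
  by move=> z; rewrite /dens_dir /grad2 !addr_ge0// sqr_ge0.
have Iv : mu2.-integrable setT (EFin \o dens_pot n).
  by apply: integrable_ge0_scaled => //; move=> z; exact: sqr_ge0.
split => //.
- apply: (@ae_integrable_le _ (fun z => 2 * dens_dir g z + 8 * dens_pot n z)) => //.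
  + by apply: measurable_funD; apply: measurable_funM.
  + by apply: ae_imp ortho => z [h1 h2 h3]; exact: hel_bound.
  + by apply: integrable_add => //; exact: integrable_scale.
- apply: (@ae_integrable_le _ (fun z => 2^-1 * dens_dir g z)) => //.
  + by apply: measurable_funM.
  + by apply: ae_imp ortho => z [h1 h2 h3]; exact: jac_bound.
  + exact: integrable_scale.
Qed.

(** Carries a pointwise inequality over to the integrals. It is used with c = 1 for the bound 4 pi
    k, and with c = 2 r^2 - 1 for the bound that is sharp at negative degree. *)
Lemma Energy_ge_degree (r c : R) (k : int) n g : in_Mk k n g ->
  (forall n1 n2 n3 a1 a2 a3 b1 b2 b3 : R,
     n1 ^+ 2 + n2 ^+ 2 + n3 ^+ 2 = 1 ->
     n1 * a1 + n2 * a2 + n3 * a3 = 0 -> n1 * b1 + n2 * b2 + n3 * b3 = 0 ->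
     c * jac n1 n2 n3 a1 a2 a3 b1 b2 b3 <= 2^-1 * grad2 a1 a2 a3 b1 b2 b3
       + r * hel n1 n2 n3 a2 a3 b1 b3 + 2^-1 * (1 - n3) ^+ 2) ->
  ((c * (4 * pi * k%:~R))%:E <= Energy r n g)%E.
Proof.
move=> M H; have [[Id Ih Iv Iq] ortho] := in_Mk_integrable M.
have [Ie ->] := EnergyE r Id Ih Iv.
have kE : 4 * pi * k%:~R = (\int[mu2]_z dens_deg n g z)%R.
  case: M => _ _ _ _; rewrite degree_Rintegral// => -[] <-.
  by rewrite mulVKf// mulf_neq0// gt_eqF ?pi_gt0.
rewrite lee_fin kE -RintegralZl// -subr_ge0 -RintegralB//; last exact: integrable_scale.
apply: Rintegral_ae_ge0; first by apply: integrable_sub => //; exact: integrable_scale.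
by apply: ae_imp ortho => z [h1 h2 h3]; rewrite subr_ge0; exact: H.
Qed.

Lemma Energy_ge_pos (r : R) (k : int) n g : 0 < r -> r <= 1 -> in_Mk k n g ->
  ((4 * pi * k%:~R)%:E <= Energy r n g)%E.
Proof.
move=> r0 r1 M; rewrite -[4 * pi * _]mul1r; apply: (Energy_ge_degree M).
move=> n1 n2 n3 a1 a2 a3 b1 b2 b3 h1 h2 h3; rewrite mul1r.
apply: le_trans (bogomolny r h1 h2 h3) _; rewrite lerD2l.
apply: ler_piMl; last by rewrite exprn_ile1// ltW.
by rewrite mulr_ge0// ?invr_ge0 ?sqr_ge0.
Qed.

Lemma Energy_ge_neg (r : R) (k : int) n g : 0 < r -> r <= 1 -> in_Mk k n g ->
  (((2 * r ^+ 2 - 1) * (4 * pi * k%:~R))%:E <= Energy r n g)%E.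
Proof.
move=> r0 r1 M; apply: (Energy_ge_degree M).
move=> n1 n2 n3 a1 a2 a3 b1 b2 b3 h1 h2 h3.
have B := bogomolny r^-1 h1 h2 h3.
have := jac_bound h1 h2 h3; rewrite ler_norml => /andP[J _].
have r2 : 0 <= 1 - r ^+ 2 by rewrite subr_ge0 exprn_ile1// ltW.
move: B J; move: (grad2 _ _ _ _ _ _) (jac _ _ _ _ _ _ _ _ _) (hel _ _ _ _ _ _ _) => G J0 H B J.
have J' := ler_wpM2l r2 J.
have B' := ler_wpM2l (sqr_ge0 r) B.
have E : r ^+ 2 * (2^-1 * G + r^-1 * H + r^-1 ^+ 2 * (2^-1 * (1 - n3) ^+ 2)) =
    r ^+ 2 * (2^-1 * G) + r * H + 2^-1 * (1 - n3) ^+ 2.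
  by field; rewrite gt_eqF.
by rewrite E in B'; move: B' J'; set w := r ^+ 2; lra.
Qed.

End lower_bound.

(** * Compactly supported C^1 configurations *)

Section continuous_plane.
Context {R : realType}.
Notation mu := (@lebesgue_measure R).
Notation mu2 := (mu \x mu)%E.

(** The plane carries the product sigma-algebra, so open sets are shown to be measurable by writing
    them as countable unions of boxes with rational centres and radii 1/(n + 1). *)
Lemma open_measurable_plane (U : set (R * R)) : open U -> measurable U.
Proof.
move=> oU.
pose box (q q' : rat) (n : nat) : set (R * R) :=
  ball (ratr q : R) n.+1%:R^-1 `*` ball (ratr q' : R) n.+1%:R^-1.
pose B (k : nat) : set (R * R) :=
  if unpickle k is Some (q, q', n) then
    (if `[< box q q' n `<=` U >] then box q q' n else set0) else set0.
have -> : U = \bigcup_k B k.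
  apply/seteqP; split => [z Uz|z [k _]]; last first.
    rewrite /B; case: unpickle => [[[q q'] n]|]//; case: asboolP => // + bz; exact.
  have /nbhs_ballP[e /= e0 He] := open_nbhs_nbhs (conj oU Uz).
  (* The centre of the box is within 1/(n + 1) of z in each coordinate and so are its points of the
     centre, hence the box stays within distance e of z. *)
  have [n ne] : exists n, n.+1%:R^-1 < e / 2 :> R.
    have e20 : 0 < e / 2 by rewrite divr_gt0.
    by have [N _ HN] := near_infty_natSinv_lt (PosNum e20); exists N; exact: (HN N (leqnn N)).
  have n0 : 0 < n.+1%:R^-1 :> R by rewrite invr_gt0.
  have approx (x : R) : exists q : rat, `|ratr q - x| < n.+1%:R^-1.
    have [|q] := @rat_in_itvoo R (x - n.+1%:R^-1) (x + n.+1%:R^-1).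
      by rewrite ltrBlDr -addrA ltrDl addr_gt0.
    by rewrite in_itv/= -ltr_distl => h; exists q.
  have [q hq] := approx z.1; have [q' hq'] := approx z.2.
  exists (pickle (q, q', n)); [exact: I|rewrite /B pickleK].
  case: asboolP => [_|]; first by split; rewrite /ball/=.
  case=> w [w1 w2]; apply: He; split => /=.
  - rewrite /ball/= in w1 *; rewrite (le_lt_trans (ler_distD (ratr q) _ _))//.
    by rewrite [e]splitr ltrD// 1?distrC (lt_trans _ ne)// distrC.
  - rewrite /ball/= in w2 *; rewrite (le_lt_trans (ler_distD (ratr q') _ _))//.
    by rewrite [e]splitr ltrD// 1?distrC (lt_trans _ ne)// distrC.
apply: bigcupT_measurable => k; rewrite /B.
case: unpickle => [[[q q'] n]|]; last exact: measurable0.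
by case: ifP => _; [apply: measurableX; exact: measurable_ball|exact: measurable0].
Qed.

Lemma continuous_measurable_plane (f : R * R -> R) : continuous f -> measurable_fun setT f.
Proof.
move=> /continuousP cf; apply: (measurability _ (RGenOpens.measurableE R)).
move=> _ [_ [a [b ->] <-]]; rewrite setTI; apply: open_measurable_plane.
by apply: cf; exact: interval_open.
Qed.

Lemma continuous_supp_bounded (f : R * R -> R) (M : R) : continuous f ->
  (forall z, ~~ insq M z -> f z = 0) -> exists C : R, forall z, `|f z| <= C.
Proof.
move=> cf f0.
have cS : compact (square M).
  by apply: compact_setX; exact: segment_compact.
have : compact (f @` square M).
  by apply: continuous_compact => //; exact: continuous_subspaceT.
move=> /compact_bounded[C [_ HC]]; exists (Num.max (C + 1) 0) => z.
have [/insqP zM|/f0 ->] := boolP (insq M z); last by rewrite normr0 le_max lexx orbT.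
by rewrite le_max HC ?ltrDl//; exists z.
Qed.

Lemma integrable_continuous_supp (f : R * R -> R) (M : R) : continuous f ->
  (forall z, ~~ insq M z -> f z = 0) -> mu2.-integrable setT (EFin \o f).
Proof.
move=> cf f0; have [C HC] := continuous_supp_bounded cf f0.
apply: (@integrable_bounded_supp _ _ _ mu2 (square M) f C) => //.
- exact: measurable_square.
- exact: square_fin.
- exact: continuous_measurable_plane.
- by move=> z zM; apply: f0; apply/negP => /insqP.
Qed.

Lemma continuous_pair_fun (T : topologicalType) (f g : T -> R) :
  continuous f -> continuous g -> continuous (fun x => (f x, g x)).
Proof.
by move=> cf cg x; exact: (@cvg_pair T R R (nbhs x) (nbhs (f x)) (nbhs (g x)) _ _ _ f g (cf x) (cg x)).
Qed.

Lemma Rintegral_coordz j (h : R * R -> R) : measurable_fun setT h ->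
  (\int[mu2]_z h (coordz j z) = \int[mu2]_z h z)%R.
Proof. by rewrite /coordz; case: (j == d1) => // mh; exact: Rintegral_swap. Qed.

Lemma continuous_coordz j : continuous (@coordz R j).
Proof.
rewrite /coordz; case: (j == d1) => z; first exact: cvg_id.
exact: swap_continuous.
Qed.

Lemma shift_coordz (j : 'I_2) (x y t : R) :
  Defs.shift j (coordz j (x, y)) t = coordz j (x + t, y).
Proof. by rewrite /Defs.shift /coordz; case: (j == d1). Qed.

Lemma is_derive_unshift (P : R -> R) (a l : R) :
  is_derive (0 : R) 1 (fun t => P (a + t)) l -> is_derive a 1 P l.
Proof.
move=> H; have K : is_derive a 1 (id - cst a) (1 - 0).
  by apply: is_deriveB.
rewrite subr0 in K.
have H' : is_derive ((id - cst a) a) 1 (fun t => P (a + t)) l.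
  by rewrite /= (_ : (id - cst a) a = 0)//; exact: subrr.
have := @is_derive1_comp _ (fun t => P (a + t)) (id - cst a) a l 1 H' K.
rewrite mulr1 (_ : _ \o _ = P)//; apply/funext => x /=.
by rewrite (_ : (id - cst a) x = x - a)// addrC subrK.
Qed.

(** On each line in direction [j] the integrand is the derivative of a function of compact support,
    so the slice integral is 0; Fubini concludes. *)
Lemma Rintegral_pd0 (j : 'I_2) (P k : R * R -> R) (M : R) : 0 <= M ->
  continuous k -> (forall z, ~~ insq M z -> P z = 0 /\ k z = 0) ->
  (forall z, is_derive (0 : R) 1 (fun t => P (Defs.shift j z t)) (k z)) ->
  (\int[mu2]_z k z = 0)%R.
Proof.
move=> M0 ck out dP.
rewrite -(Rintegral_coordz j); last exact: continuous_measurable_plane.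
pose h := k \o coordz j.
have ch : continuous h.
  by move=> z; apply: continuous_comp; [exact: continuous_coordz|exact: ck].
have insqc z : insq M (coordz j z) = insq M z.
  by rewrite /coordz; case: (j == d1) => //; rewrite /insq/= andbC.
have h0 z : ~~ insq M z -> h z = 0.
  by rewrite -insqc => /out[].
have Ih := integrable_continuous_supp ch h0.
suff E : (\int[mu2]_z (h z)%:E = 0)%E by rewrite /Rintegral [X in fine X]E.
rewrite -(integral21_prod_meas1 Ih); apply: integral0_eq => y _.
rewrite /fubini_G /=.
have -> : (\int[mu]_x (h (x, y))%:E = (\int[mu]_x h (x, y))%R%:E)%E.
  rewrite /Rintegral fineK//; apply: integrable_fin_num => //.
  have [C HC] := continuous_supp_bounded ch h0.
  apply: (@integrable_bounded_supp _ _ _ mu `[- M, M] (fun x => h (x, y)) C) => //.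
  - exact: lebesgue_measure_itvcc_fin.
  - exact: measurable_fun_pair1 (continuous_measurable_plane ch).
  - move=> x /=; rewrite in_itv/= -ler_norml => xM; apply: h0.
    by rewrite /insq/= negb_and; apply/orP; left; exact/negP.
congr EFin.
have Pout x : M < `|x| -> P (coordz j (x, y)) = 0.
  move=> xM; have [|//] := out (coordz j (x, y)).
  by rewrite insqc /insq/= negb_and -ltNge xM.
(* The interval is enlarged by 1 because [P] is known to vanish only strictly outside [-M, M], and
   its values at the end points are needed. *)
rewrite (@Rintegral_supp _ _ _ mu `[- (M + 1), M + 1]); last first.
  move=> x /=; rewrite in_itv/= -ler_norml => xM; apply: h0.
  rewrite /insq/= negb_and; apply/orP; left; apply/negP => xM'; apply: xM.
  by rewrite (le_trans xM')// lerDl.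
have dh (x : R) : is_derive x 1 (fun x : R => P (coordz j (x, y))) (h (x, y)).
  apply: is_derive_unshift; have := dP (coordz j (x, y)).
  by under [X in is_derive _ _ X _ -> _]eq_fun do rewrite shift_coordz.
have M1 : - (M + 1) <= M + 1 by rewrite ge0_cp// addr_ge0.
rewrite (FTC_Rintegral M1 dh).
- rewrite !Pout ?subrr//.
    by rewrite normrN ger0_norm ?addr_ge0// ltrDl.
  by rewrite ger0_norm ?addr_ge0// ltrDl.
- move=> x; apply: (@continuous_comp _ _ _ (fun x => (x, y)) h); last exact: ch.
  by apply: continuous_pair_fun => w; [exact: cvg_id|exact: cvg_cst].
Qed.

End continuous_plane.

(** * C^1 functions and their weak derivatives *)

Section C1_configurations.
Context {R : realType}.
Notation mu := (@lebesgue_measure R).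
Notation mu2 := (mu \x mu)%E.
Implicit Types (f : R * R -> R) (n : 'I_3 -> R * R -> R) (g : 'I_3 -> 'I_2 -> R * R -> R).

(** The gradient is an explicit argument: the rules below compute it while they prove regularity,
    and [C1_eq] then brings it to the wanted closed form. *)
Definition C1 f (df : 'I_2 -> R * R -> R) :=
  continuous f /\ forall j, continuous (df j) /\
    forall z, is_derive (0 : R) 1 (fun t => f (Defs.shift j z t)) (df j z).

Lemma shift0 (j : 'I_2) (z : R * R) : Defs.shift j z 0 = z.
Proof. by rewrite /Defs.shift !addr0; case: z => ? ?; case: ifP. Qed.

Lemma C1_cst (c : R) : C1 (cst c) (fun=> cst 0).
Proof.
by split=> [|j]; [|split]; try exact: cst_continuous; move=> z; exact: is_derive_cst.
Qed.

Lemma C1_eq f f' (df df' : 'I_2 -> R * R -> R) : f =1 f' -> (forall j, df j =1 df' j) ->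
  C1 f df -> C1 f' df'.
Proof.
move=> /funext <- H; rewrite (_ : df' = df)//.
by apply/funext => j; apply/funext => z; rewrite H.
Qed.

Lemma C1_add f f' (df df' : 'I_2 -> R * R -> R) : C1 f df -> C1 f' df' ->
  C1 (fun z => f z + f' z) (fun j z => df j z + df' j z).
Proof.
move=> [cf Hf] [cf' Hf']; split=> [z|j]; first by apply: cvgD; [exact: cf|exact: cf'].
have [c1 D1] := Hf j; have [c2 D2] := Hf' j; split=> z.
  by apply: cvgD; [exact: c1|exact: c2].
exact: (is_deriveD (D1 z) (D2 z)).
Qed.

Lemma C1_mul f f' (df df' : 'I_2 -> R * R -> R) : C1 f df -> C1 f' df' ->
  C1 (fun z => f z * f' z) (fun j z => f z * df' j z + df j z * f' z).
Proof.
move=> [cf Hf] [cf' Hf']; split=> [z|j].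
  by apply: (@continuousM _ _ f f'); [exact: cf|exact: cf'].
have [c1 D1] := Hf j; have [c2 D2] := Hf' j; split=> z.
  apply: cvgD.
    by apply: (@continuousM _ _ f (df' j)); [exact: cf|exact: c2].
  by apply: (@continuousM _ _ (df j) f'); [exact: c1|exact: cf'].
have := is_deriveM (D1 z) (D2 z).
by rewrite !shift0 /GRing.scale/= [f' z * _]mulrC.
Qed.

Lemma C1_inv f (df : 'I_2 -> R * R -> R) : (forall z, f z != 0) -> C1 f df ->
  C1 (fun z => (f z)^-1) (fun j z => - (f z) ^- 2 * df j z).
Proof.
move=> f0 [cf Hf]; have ci : continuous (fun z => (f z)^-1).
  by move=> z; apply: (@continuousV _ _ f) => //; exact: cf.
split=> // j; have [c1 D1] := Hf j; split=> z.
  apply: (@continuousM _ _ (fun z => - (f z) ^- 2) (df j)); last exact: c1.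
  rewrite (_ : (fun z => - (f z) ^- 2) = (fun z => - ((f z)^-1 * (f z)^-1))).
    by apply: cvgN; apply: (@continuousM _ _ (fun z => (f z)^-1) (fun z => (f z)^-1)); exact: ci.
  by apply/funext => w; rewrite -invfM expr2.
have f0z : f (Defs.shift j z 0) != 0 by [].
have := @is_deriveV R (fun t => f (Defs.shift j z t)) 0 (df j z) 1 f0z (D1 z).
by rewrite shift0 /GRing.scale/=.
Qed.

Lemma C1_comp f (df : 'I_2 -> R * R -> R) (h dh : R -> R) : C1 f df ->
  (forall x : R, is_derive x 1 h (dh x)) -> continuous dh ->
  C1 (fun z => h (f z)) (fun j z => dh (f z) * df j z).
Proof.
move=> [cf Hf] Dh cdh; have ch : continuous h by move=> x; exact: is_derive_cont.
split=> [z|j]; first by apply: (@continuous_comp _ _ _ f h); [exact: cf|exact: ch].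
have [c1 D1] := Hf j; split=> z.
  apply: (@continuousM _ _ (fun z => dh (f z)) (df j)); last exact: c1.
  by apply: (@continuous_comp _ _ _ f dh); [exact: cf|exact: cdh].
have Dhz : is_derive (f (Defs.shift j z 0)) 1 h (dh (f z)) by rewrite shift0.
exact: (@is_derive1_comp _ h (fun t => f (Defs.shift j z t)) 0 _ _ Dhz (D1 z)).
Qed.

Lemma C1_fst : C1 fst (fun j => cst (if j == d1 then 1 else 0)).
Proof.
split=> [z|j]; first exact: cvg_fst.
split=> z; first exact: cvg_cst.
rewrite /Defs.shift; case: ifP => _ /=; last exact: is_derive_cst.
by rewrite -[X in is_derive _ _ _ X]add0r; apply: is_deriveD.
Qed.

Lemma C1_snd : C1 snd (fun j => cst (if j == d1 then 0 else 1)).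
Proof.
split=> [z|j]; first exact: cvg_snd.
split=> z; first exact: cvg_cst.
rewrite /Defs.shift; case: ifP => _ /=; first exact: is_derive_cst.
by rewrite -[X in is_derive _ _ _ X]add0r; apply: is_deriveD.
Qed.

Lemma shift_translate (j : 'I_2) (s : R) (z : R * R) t :
  ((Defs.shift j z t).1 + s, (Defs.shift j z t).2) = Defs.shift j (z.1 + s, z.2) t.
Proof. by rewrite /Defs.shift; case: (j == d1) => //=; rewrite addrAC. Qed.

Lemma C1_translate f (df : 'I_2 -> R * R -> R) (s : R) : C1 f df ->
  C1 (fun z => f (z.1 + s, z.2)) (fun j z => df j (z.1 + s, z.2)).
Proof.
move=> [cf Hf].
have cs : continuous (fun z : R * R => (z.1 + s, z.2)).
  apply: continuous_pair_fun => z; last exact: cvg_snd.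
  by apply: cvgD; [exact: cvg_fst|exact: cvg_cst].
split=> [z|j].
  by apply: (@continuous_comp _ _ _ (fun z : R * R => (z.1 + s, z.2)) f); [exact: cs|exact: cf].
have [c1 D1] := Hf j; split=> z.
  by apply: (@continuous_comp _ _ _ (fun z : R * R => (z.1 + s, z.2)) (df j)); [exact: cs|exact: c1].
have := D1 (z.1 + s, z.2).
by under [X in is_derive _ _ X _ -> _]eq_fun do rewrite -shift_translate.
Qed.

(** With a margin of 1, a function supported in the smaller square vanishes along a whole segment
    around each point outside the larger one, so its partial derivatives vanish there as well. *)
Lemma insq_shift (M : R) (j : 'I_2) (z : R * R) (t : R) : `|t| < 1 ->
  ~~ insq (M + 1) z -> ~~ insq M (Defs.shift j z t).
Proof.
move=> t1; apply: contra => /andP[h1 h2].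
have key (x : R) : `|x + t| <= M -> `|x| <= M + 1.
  move=> h; have := ler_normB (x + t) t; rewrite addrK => h'.
  by rewrite (le_trans h')// lerD// ltW.
have M1 : M <= M + 1 by rewrite lerDl.
move: h1 h2; rewrite /Defs.shift /insq; case: ifP => _ /= h1 h2.
  by rewrite key//= (le_trans h2).
by rewrite (le_trans h1)//= key.
Qed.

(** Integration by parts: f phi has compact support, so the integral of its j-th derivative f d_j
    phi + phi d_j f is 0 by [Rintegral_pd0]. *)
Lemma weak_pd_C1 f (df : 'I_2 -> R * R -> R) j : C1 f df -> weak_pd j f (df j).
Proof.
move=> [cf Hf]; have [cdf Df] := Hf j; split.
  split; first exact: continuous_measurable_plane.
  move=> M; have cd2 : continuous (fun z => df j z ^+ 2).
    by move=> z; apply: (@continuousM _ _ (df j) (df j)); exact: cdf.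
  have : compact ((fun z => df j z ^+ 2) @` square M).
    apply: continuous_compact; first exact: continuous_subspaceT.
    by apply: compact_setX; exact: segment_compact.
  move=> /compact_bounded[C [_ HC]].
  rewrite (_ : leb2 (R:=R) = mu2)//.
  apply: (@le_lt_trans _ _ (\int[mu2]_(z in square M) (Num.max (C + 1) 0)%:E)%E).
    apply: ge0_le_integral => //.
    - exact: measurable_square.
    - by move=> z _; rewrite lee_fin sqr_ge0.
    - by apply/measurable_EFinP; apply: measurable_funTS; exact: continuous_measurable_plane.
    - move=> z zM; rewrite lee_fin (le_trans (ler_norm _))// le_max.
      by apply/orP; left; apply: HC; [rewrite ltrDl|exists z].
  rewrite integral_cst; last exact: measurable_square.
  by apply: lte_mul_pinfty => //; [rewrite lee_fin le_max lexx orbT|exact: square_fin].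
move=> phi [[M phi0] cphi Hphi]; have [Dphi cdphi] := Hphi j.
have phi0' z : ~~ insq M z -> phi z = 0.
  by move=> zM; apply: phi0 => /insqP h; rewrite h in zM.
have Dp z : is_derive (0 : R) 1 (fun t => phi (Defs.shift j z t)) (pd j phi z).
  by apply: DeriveDef => //; rewrite /pd derive1E.
have pd0 z : ~~ insq (M + 1) z -> pd j phi z = 0.
  move=> zM; have [_ <-] := Dp z.
  suff : is_derive (0 : R) 1 (fun t => phi (Defs.shift j z t)) 0 by case.
  have K : is_derive (0 : R) 1 (cst (0 : R)) (0 : R) by exact: is_derive_cst.
  apply: (near_eq_is_derive _ K).
  apply: filterS (nbhs0_lt (@ltr01 R)) => t t1.
  by apply/esym/phi0'; exact: insq_shift.
have phi1 z : ~~ insq (M + 1) z -> phi z = 0.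
  move=> zM; apply: phi0'; rewrite -(shift0 j z); apply: insq_shift => //.
  by rewrite normr0.
rewrite (_ : leb2 (R:=R) = mu2)//.
have I1 : mu2.-integrable setT (EFin \o (fun z => f z * pd j phi z)).
  apply: (@integrable_continuous_supp _ _ (M + 1)).
    by move=> z; apply: (@continuousM _ _ f (pd j phi)); [exact: cf|exact: cdphi].
  by move=> z /pd0 ->; rewrite mulr0.
have I2 : mu2.-integrable setT (EFin \o (fun z => df j z * phi z)).
  apply: (@integrable_continuous_supp _ _ (M + 1)).
    by move=> z; apply: (@continuousM _ _ (df j) phi); [exact: cdf|exact: cphi].
  by move=> z /phi1 ->; rewrite mulr0.
rewrite !integral_fineK// -EFinN; congr EFin; apply/eqP; rewrite -addr_eq0 -RintegralD//.
apply/eqP; pose M' := Num.max (M + 1) 0.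
have out z : ~~ insq M' z -> ~~ insq (M + 1) z.
  apply: contra => /andP[h1 h2].
  by rewrite /insq /M' !le_max h1 h2.
apply: (@Rintegral_pd0 _ j (fun z => f z * phi z) _ M').
- by rewrite le_max lexx orbT.
- move=> z; apply: cvgD.
    by apply: (@continuousM _ _ f (pd j phi)); [exact: cf|exact: cdphi].
  by apply: (@continuousM _ _ (df j) phi); [exact: cdf|exact: cphi].
- by move=> z /out zM; rewrite phi1// pd0// !mulr0 addr0.
- move=> z; have := is_deriveM (Df z) (Dp z).
  by rewrite !shift0 /GRing.scale/= [phi z * _]mulrC.
Qed.

End C1_configurations.

(** * Translation invariance of the integral *)

Section translation.
Context {R : realType}.
Notation mu := (@lebesgue_measure R).
Notation mu2 := (mu \x mu)%E.

(** The image of Lebesgue measure under a translation agrees with it on half-open intervals, and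
    uniqueness of the measure extends this to all measurable sets. *)
Lemma ge0_integral_translate (s : R) (f : R -> \bar R) : measurable_fun setT f ->
  (forall x, 0 <= f x)%E -> (\int[mu]_x f (x + s)%R = \int[mu]_x f x)%E.
Proof.
move=> mf f0.
have mphi : measurable_fun [set: measurableTypeR R] (fun x : measurableTypeR R => (x + s)%R : measurableTypeR R).
  by apply: measurable_funD => //; exact: measurable_cst.
pose mixin := isMeasurableFun.Build _ _ _ _ _ mphi.
pose phi : {mfun (measurableTypeR R) >-> (measurableTypeR R)} :=
  HB.pack (fun x : measurableTypeR R => (x + s)%R : measurableTypeR R) mixin.
have E A : measurable A -> mu A = pushforward mu phi A.
  apply: lebesgue_measure_unique => _ [[a b] _ <-] /=.
  rewrite /pushforward (_ : _ @^-1` _ = `]a - s, b - s]%classic); last first.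
    by apply/seteqP; split => x /=; rewrite !in_itv/= ltrBlDr lerBrDr.
  apply: etrans (lebesgue_measure_itv `]a, b]) _; apply: esym.
  apply: etrans (lebesgue_measure_itv `]a - s, b - s]) _ => /=.
  by rewrite !lte_fin ltrD2r; case: ifP => // _; rewrite -!EFinB opprB addrA addrNK.
have := @ge0_integral_pushforward _ _ _ _ R phi mphi mu setT f measurableT mf (fun x _ => f0 x).
rewrite preimage_setT => <-; apply: eq_measure_integral => A mA _.
exact: esym (E A mA).
Qed.

Lemma integral_translate (s : R) (F : R * R -> \bar R) : measurable_fun setT F ->
  (\int[mu2]_z F ((z.1 + s)%R, z.2) = \int[mu2]_z F z)%E.
Proof.
have ms : measurable_fun setT (fun z : R * R => (z.1 + s, z.2)).
  by apply: measurable_fun_pair => //; apply: measurable_funD.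
have H (G : R * R -> \bar R) : measurable_fun setT G -> (forall z, 0 <= G z)%E ->
    (\int[mu2]_z G ((z.1 + s)%R, z.2) = \int[mu2]_z G z)%E.
  move=> mG G0.
  have mGs : measurable_fun setT (fun z : R * R => G ((z.1 + s)%R, z.2)).
    exact: (measurableT_comp mG ms).
  apply: etrans (@fubini_tonelli2 _ _ _ _ R mu mu _ mGs (fun z => G0 _)) _.
  rewrite [RHS](@fubini_tonelli2 _ _ _ _ R mu mu G mG G0).
  apply: eq_integral => y _; rewrite /fubini_G /=.
  apply: (@ge0_integral_translate s (fun x => G (x, y))) => //.
  exact: measurable_fun_pair1.
move=> mF; rewrite integralE [RHS]integralE; congr (_ - _)%E.
- rewrite -(H _ (measurable_funepos mF) (fun z => funepos_ge0 F z)).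
  by apply: eq_integral => z _; rewrite !funeposE.
- rewrite -(H _ (measurable_funeneg mF) (fun z => funeneg_ge0 F z)).
  by apply: eq_integral => z _; rewrite !funenegE.
Qed.

Lemma Rintegral_translate (s : R) (h : R * R -> R) : measurable_fun setT h ->
  (\int[mu2]_z h (z.1 + s, z.2) = \int[mu2]_z h z)%R.
Proof.
move=> mh; rewrite /Rintegral; congr fine.
by apply: (@integral_translate s (EFin \o h)); exact/measurable_EFinP.
Qed.

End translation.

(** * Gluing of maps equal to e_3 outside a square *)

Section gluing.
Context {R : realType}.
Notation mu := (@lebesgue_measure R).
Notation mu2 := (mu \x mu)%E.
Implicit Types (n : 'I_3 -> R * R -> R) (g : 'I_3 -> 'I_2 -> R * R -> R).

Definition config n g (M : R) :=
  [/\ (forall i, C1 (n i) (g i)),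
      (forall z, n c1 z ^+ 2 + n c2 z ^+ 2 + n c3 z ^+ 2 = 1), 0 <= M &
      forall z, ~~ insq M z ->
        [/\ n c1 z = 0, n c2 z = 0, n c3 z = 1 & forall i j, g i j z = 0]].

Lemma contD (T : topologicalType) (f h : T -> R) : continuous f -> continuous h ->
  continuous (fun x => f x + h x).
Proof. by move=> cf ch x; apply: cvgD; [exact: cf|exact: ch]. Qed.

Lemma contB (T : topologicalType) (f h : T -> R) : continuous f -> continuous h ->
  continuous (fun x => f x - h x).
Proof. by move=> cf ch x; apply: cvgB; [exact: cf|exact: ch]. Qed.

Lemma contM (T : topologicalType) (f h : T -> R) : continuous f -> continuous h ->
  continuous (fun x => f x * h x).
Proof. by move=> cf ch x; apply: cvgM; [exact: cf|exact: ch]. Qed.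

Lemma cont_sqr (T : topologicalType) (f : T -> R) : continuous f ->
  continuous (fun x => f x ^+ 2).
Proof. by move=> cf; apply: contM. Qed.

Lemma config_integrable (r : R) n g (M : R) : config n g M ->
  [/\ mu2.-integrable setT (EFin \o dens_dir g),
      mu2.-integrable setT (EFin \o dens_hel n g),
      mu2.-integrable setT (EFin \o dens_pot n) &
      mu2.-integrable setT (EFin \o dens_deg n g)].
Proof.
move=> [C n1 M0 out].
have cn i : continuous (n i) by case: (C i).
have cg i j : continuous (g i j) by case: (C i) => _ /(_ j)[].
have cc (c : R) : continuous (fun _ : R * R => c) by exact: cst_continuous.
split; apply: (@integrable_continuous_supp _ _ M).
- by apply: contD; first apply: contD; apply: contD; apply: cont_sqr.
- by move=> z /out[_ _ _ g0]; rewrite /dens_dir /grad2 !g0 expr0n/= !addr0.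
- by apply: contD; [apply: contB; apply: contM|apply: contM; apply: contB].
- by move=> z /out[h1 h2 h3 g0]; rewrite /dens_hel /hel h1 h2 h3 subrr !mul0r subr0 addr0.
- by rewrite /dens_pot; apply: cont_sqr; apply: contB.
- by move=> z /out[h1 h2 h3 g0]; rewrite /dens_pot h3 subrr expr0n.
- by apply: contD; first apply: contD; apply: contM => //; apply: contB; apply: contM.
- by move=> z /out[h1 h2 h3 g0]; rewrite /dens_deg /jac !g0 !mul0r subr0 !mulr0 !addr0.
Qed.

(** A value reached within the class [config], which is stable under gluing. Degree and energy are
    kept as real integrals, so that they add without any case distinction on infinities. *)
Definition attained (r : R) (k : int) (E : R) := exists n g M,
  [/\ config n g M, (\int[mu2]_z dens_deg n g z)%R = 4 * pi * k%:~R &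
      (\int[mu2]_z dens_energy r n g z)%R = E].

Lemma attained_energy_values (r : R) (k : int) (E : R) : attained r k E ->
  energy_values r k E%:E.
Proof.
move=> [n [g [M [cf dE eE]]]]; exists n, g.
have [Id Ih Iv Iq] := config_integrable r cf.
have [_ EE] := EnergyE r Id Ih Iv.
split; last by rewrite EE eE.
case: cf => C n1 M0 out; split.
- split=> // i; apply: continuous_measurable_plane; by case: (C i).
- by move=> i j; exact: weak_pd_C1.
- by rewrite DirE integral_fineK// -EFinM ltry.
- by rewrite PotE integral_fineK// -EFinM ltry.
- by rewrite degree_Rintegral// dE mulrA mulVf ?mul1r// mulf_neq0// gt_eqF ?pi_gt0.
Qed.

Lemma Rintegral_eq0 (F : R * R -> R) : (forall z, F z = 0) -> (\int[mu2]_z F z = 0)%R.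
Proof.
by move=> F0; rewrite /Rintegral integral0_eq// => z _; rewrite F0.
Qed.

Lemma attained0 (r : R) : attained r 0 0.
Proof.
exists (fun i => if i == c3 then cst 1 else cst 0), (fun i j => cst 0), 0.
split.
- split=> //.
  + by move=> i; case: ifP => _; exact: C1_cst.
  + by move=> z /=; rewrite !expr0n/= !add0r expr1n.
- rewrite mulr0; apply: Rintegral_eq0 => z; rewrite /dens_deg /jac /=; ring.
- apply: Rintegral_eq0 => z; rewrite /dens_energy /dens_dir /dens_hel /dens_pot /grad2 /hel /=; ring.
Qed.

(** The sum n + n'(. + s) - e_3. At each point one of the two maps equals e_3 when the blocks are
    far apart, so the sum equals the other one and stays on the sphere. *)
Definition glue (s : R) n n' : 'I_3 -> R * R -> R :=
  fun i z => n i z + n' i (z.1 + s, z.2) + (if i == c3 then -1 else 0).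

Definition dglue (s : R) g g' : 'I_3 -> 'I_2 -> R * R -> R :=
  fun i j z => g i j z + g' i j (z.1 + s, z.2).

Lemma attained_add (r : R) (k k' : int) (E E' : R) :
  attained r k E -> attained r k' E' -> attained r (k + k') (E + E').
Proof.
move=> [n [g [M [cf dE eE]]]] [n' [g' [M' [cf' dE' eE']]]].
have [Id Ih Iv Iq] := config_integrable r cf.
have [Id' Ih' Iv' Iq'] := config_integrable r cf'.
have [Ie _] := EnergyE r Id Ih Iv; have [Ie' _] := EnergyE r Id' Ih' Iv'.
case: cf => C n1 M0 out; case: cf' => C' n1' M0' out'.
(* The second block is centred at -s on the first axis; since s exceeds M + M', the two squares are
   disjoint. *)
pose s := M + M' + 1.
have sep z : ~~ insq M z \/ ~~ insq M' (z.1 + s, z.2).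
  have [zM|] := boolP (insq M z); [right|by left].
  apply/negP => /andP[/= h _]; case/andP: zM => h' _.
  have := ler_normB (z.1 + s) z.1; rewrite addrAC subrr add0r ger0_norm; last first.
    by rewrite !addr_ge0.
  by rewrite /s => h''; have := le_trans h'' (lerD h h'); rewrite [M' + M]addrC gerDl ler10.
have nE z : [/\ glue s n n' c1 z = n c1 z + n' c1 (z.1 + s, z.2),
    glue s n n' c2 z = n c2 z + n' c2 (z.1 + s, z.2) &
    glue s n n' c3 z = n c3 z + n' c3 (z.1 + s, z.2) - 1].
  by rewrite /glue /= !addr0.
have locE z :
  [/\ dens_deg (glue s n n') (dglue s g g') z =
        dens_deg n g z + dens_deg n' g' (z.1 + s, z.2),
      dens_energy r (glue s n n') (dglue s g g') z =
        dens_energy r n g z + dens_energy r n' g' (z.1 + s, z.2) &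
      glue s n n' c1 z ^+ 2 + glue s n n' c2 z ^+ 2 + glue s n n' c3 z ^+ 2 = 1].
  have [e1 e2 e3] := nE z.
  rewrite /dens_energy /dens_deg /dens_dir /dens_hel /dens_pot e1 e2 e3 /dglue.
  case: (sep z) => [/out|/out'] [h1 h2 h3 g0].
  - rewrite h1 h2 h3 !g0 !add0r addrAC subrr add0r -(n1' (z.1 + s, z.2)).
    by rewrite /jac /grad2 /hel; split=> //; ring.
  - rewrite h1 h2 h3 !g0 !addr0 addrK -(n1 z).
    by rewrite /jac /grad2 /hel; split=> //; ring.
have meas (h : R * R -> R) : mu2.-integrable setT (EFin \o h) -> measurable_fun setT h.
  by move=> I0; have /measurable_EFinP := measurable_int _ I0.
have Itr (h : R * R -> R) : mu2.-integrable setT (EFin \o h) ->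
    mu2.-integrable setT (EFin \o (fun z => h (z.1 + s, z.2))).
  move=> Ih0; have mh := meas _ Ih0.
  have ms : measurable_fun setT (fun z : R * R => (z.1 + s, z.2)).
    by apply: measurable_fun_pair => //; apply: measurable_funD.
  apply/integrableP; split; first by apply/measurable_EFinP; exact: (measurableT_comp mh ms).
  case/integrableP : Ih0 => _.
  have mah : measurable_fun setT (fun z => `|(EFin \o h) z|%E).
    by apply: measurableT_comp => //; exact/measurable_EFinP.
  by rewrite -(integral_translate s mah).
(* The centred square must contain the shifted block, which reaches |z.1| = M' + s. *)
exists (glue s n n'), (dglue s g g'), (M + M' + s); split.
- split.
  + move=> i; have K := C1_add (C1_add (C i) (C1_translate s (C' i))) (C1_cst (if i == c3 then -1 else 0)).
    by apply: C1_eq K => [z|j z] //=; rewrite addr0.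
  + by move=> z; case: (locE z).
  + by rewrite !addr_ge0.
  + move=> z zM.
    have o1 : ~~ insq M z.
      apply: contra zM => /andP[h1 h2]; rewrite /insq.
      have MM : M <= M + M' + s by rewrite -addrA lerDl !addr_ge0.
      by rewrite (le_trans h1)//= (le_trans h2).
    have o2 : ~~ insq M' (z.1 + s, z.2).
      apply: contra zM => /andP[/= h1 h2]; rewrite /insq.
      have h1' : `|z.1| <= M' + s.
        have := ler_normB (z.1 + s) s; rewrite addrK => h.
        by rewrite (le_trans h)// lerD// ger0_norm// !addr_ge0.
      have M'M : M' + s <= M + M' + s by rewrite -addrA lerDr.
      have M'M2 : M' <= M' + s by rewrite lerDl !addr_ge0.
      by rewrite (le_trans h1')//= (le_trans h2)// (le_trans M'M2).
    have [h1 h2 h3 g0] := out _ o1; have [h1' h2' h3' g0'] := out' _ o2.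
    have [-> -> ->] := nE z.
    rewrite h1 h2 h3 h1' h2' h3' !addr0 addrK; split=> // i j.
    by rewrite /dglue g0 g0' addr0.
- have -> : (\int[mu2]_z dens_deg (glue s n n') (dglue s g g') z =
      \int[mu2]_z (dens_deg n g z + dens_deg n' g' (z.1 + s, z.2)))%R.
    by apply: eq_Rintegral => z _; case: (locE z).
  rewrite RintegralD//; last exact: (Itr (dens_deg n' g')).
  transitivity ((4 * pi * k%:~R + 4 * pi * k'%:~R) : R); last by rewrite intrD (mulrDr (4 * pi)).
  congr (_ + _); first exact: dE.
  by rewrite -dE'; apply: Rintegral_translate; exact: meas.
- have -> : (\int[mu2]_z dens_energy r (glue s n n') (dglue s g g') z =
      \int[mu2]_z (dens_energy r n g z + dens_energy r n' g' (z.1 + s, z.2)))%R.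
    by apply: eq_Rintegral => z _; case: (locE z).
  rewrite RintegralD//; last exact: (Itr (dens_energy r n' g')).
  congr (_ + _); first exact: eE.
  by rewrite -eE'; apply: Rintegral_translate; exact: meas.
Qed.

Lemma attained_muln (r : R) (k : int) (E : R) (p : nat) :
  attained r k E -> attained r (k *+ p) (E *+ p).
Proof.
move=> A; elim: p => [|p IH]; first by rewrite !mulr0n; exact: attained0.
by rewrite !mulrS; exact: attained_add.
Qed.

End gluing.

(** * Integrals of radial functions *)

Section radial_integration.
Context {R : realType}.
Notation mu := (@lebesgue_measure R).
Notation mu2 := (mu \x mu)%E.

Lemma ge0_integral_scale (a : R) (G : R -> R) : 0 < a -> continuous G ->
  (forall x, 0 <= G x) ->
  (\int[mu]_x (G x)%:E = \int[mu]_x (G (a * x) * a)%:E)%E.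
Proof.
move=> a0 cG G0.
have dF (x : R) : is_derive x 1 (fun y : R => a * y) a.
  by apply: is_derive_eq; rewrite /GRing.scale/=; ring.
have FE : derive1 (fun y : R => a * y) = cst a.
  by apply/funext => x; rewrite derive1E; exact: derive_val.
rewrite (@increasing_ge0_integration_by_substitutionT R (fun y => a * y) G)//.
- by apply: eq_integral => x _; rewrite FE.
- by move=> x y xy; rewrite ltr_pM2l.
- by rewrite FE; exact: cst_continuous.
- by rewrite FE; exact: is_cvg_cst.
- by rewrite FE; exact: is_cvg_cst.
- exact: gt0_cvgMrNy.
- exact: gt0_cvgMry.
Qed.

(** F(c x^2) / (2 c) is an antiderivative of f(c x^2) x, and evenness doubles the integral over the
    half line. On the line y = x s the constant c is 1 + s^2. *)
Lemma integral_radial_line (f F : R -> R) (L c : R) : 0 < c ->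
  (forall t, 0 <= t -> 0 <= f t) -> (forall t, 0 <= t -> {for t, continuous f}) ->
  (forall t : R, 0 <= t -> is_derive t 1 F (f t)) ->
  F x @[x --> +oo] --> L ->
  (\int[mu]_x (f (x ^+ 2 * c) * `|x|)%:E = ((L - F 0) / c)%:E)%E.
Proof.
move=> c0 f0 cf dF FL.
have sq0 (x : R) : 0 <= x ^+ 2 * c by rewrite mulr_ge0 ?sqr_ge0// ltW.
have csq : continuous (fun x : R => x ^+ 2 * c).
  by move=> x; apply: (@continuousM _ _ (fun x : R => x ^+ 2) (cst c)); [exact: exprn_continuous|exact: cvg_cst].
have ch : continuous (fun x : R => f (x ^+ 2 * c) * `|x|).
  move=> x; apply: cvgM; last by apply: cvg_norm; exact: cvg_id.
  by apply: (@continuous_comp _ _ _ (fun x : R => x ^+ 2 * c) f); [exact: csq|exact: cf].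
rewrite ge0_symfun_integralT//; last 2 first.
- by move=> x; rewrite mulr_ge0// f0.
- by move=> x /=; rewrite sqrrN normrN.
rewrite (_ : [set x | _] = `[0, +oo[%classic); last first.
  by apply/seteqP; split => x/=; rewrite in_itv/= andbT.
pose P x := F (x ^+ 2 * c) / (2 * c).
have dP (x : R) : is_derive x 1 P (f (x ^+ 2 * c) * x).
  have d1 : is_derive x 1 (fun x : R => x ^+ 2 * c) (2 * x * c).
    by apply: is_derive_eq; rewrite /GRing.scale/=; ring.
  have d2 := @is_derive1_comp _ F (fun x : R => x ^+ 2 * c) x _ _ (dF _ (sq0 x)) d1.
  have := is_deriveZ (2 * c)^-1 d2.
  rewrite /GRing.scale/= (_ : (2 * c)^-1 * (f (x ^+ 2 * c) * (2 * x * c)) = f (x ^+ 2 * c) * x); last first.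
    by field; rewrite gt_eqF.
  have -> : (2 * c)^-1 \*: (F \o (fun x : R => x ^+ 2 * c)) = P.
    by apply/funext => y; rewrite /P [RHS]mulrC.
  exact.
have PL : P x @[x --> +oo] --> L / (2 * c).
  apply: cvgM; last exact: cvg_cst.
  apply: (cvg_comp (fun x : R => x ^+ 2 * c) F _ FL).
  apply/cvgryPge => A; near=> x.
  have x1 : 1 <= x by near: x; exact: nbhs_pinfty_ge.
  apply: (@le_trans _ _ (x * c)); last first.
    by rewrite ler_pM2r// expr2 ler_peMl// (le_trans ler01).
  by rewrite -ler_pdivrMr//; near: x; exact: nbhs_pinfty_ge.
have cP : continuous P by move=> x; exact: is_derive_cont.
rewrite (_ : (\int[mu]_(x in `[0%R, +oo[) (f (x ^+ 2 * c) * `|x|)%:E =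
   \int[mu]_(x in `[0%R, +oo[) (f (x ^+ 2 * c) * x)%:E)%E); last first.
  by apply: eq_integral => x; rewrite inE/= in_itv/= andbT => x0; rewrite ger0_norm.
rewrite (@ge0_continuous_FTC2y R _ P 0 (L / (2 * c)))//.
- by rewrite /P expr0n/= mul0r -EFinB -EFinM; congr EFin; field; rewrite gt_eqF.
- by move=> x x0; rewrite mulr_ge0// f0.
- have cfx : continuous (fun x : R => f (x ^+ 2 * c) * x).
    move=> x; apply: cvgM; last exact: cvg_id.
    by apply: (@continuous_comp _ _ _ (fun x : R => x ^+ 2 * c) f); [exact: csq|exact: cf].
  exact: (continuous_subspaceT cfx).
- by apply: cvg_at_right_filter; exact: cP.
- by move=> x _; rewrite derive1E; exact: derive_val.
Unshelve. all: by end_near. Qed.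

Lemma integralT_oneDsqr : (\int[mu]_x (oneDsqr x)^-1%:E = pi%:E)%E.
Proof.
rewrite (@ge0_symfun_integralT R (fun x => (oneDsqr x)^-1)).
- rewrite (_ : [set x | _] = `[0, +oo[%classic); last first.
    by apply/seteqP; split => x/=; rewrite in_itv/= andbT.
  by rewrite integral0y_oneDsqr -EFinM mulrCA divff// mulr1.
- by move=> x; rewrite invr_ge0 ltW.
- exact: continuous_oneDsqrV.
- by move=> x /=; rewrite /oneDsqr sqrrN.
Qed.

(* Slicing by lines through the origin, y = x s, instead of polar coordinates. *)
Lemma integral_radial (f F : R -> R) (L : R) :
  (forall t, 0 <= t -> 0 <= f t) -> (forall t, 0 <= t -> {for t, continuous f}) ->
  (forall t : R, 0 <= t -> is_derive t 1 F (f t)) ->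
  F x @[x --> +oo] --> L ->
  (\int[mu2]_z (f (z.1 ^+ 2 + z.2 ^+ 2))%:E = (pi * (L - F 0))%:E)%E.
Proof.
move=> f0 cf dF FL.
have csqr (T : topologicalType) (u : T -> R) : continuous u -> continuous (fun z => u z ^+ 2).
  by move=> cu z; apply: (@continuous_comp _ _ _ u (fun x => x ^+ 2)); [exact: cu|exact: exprn_continuous].
have c1 : continuous (fun z : R * R => z.1) by move=> z; exact: cvg_fst.
have c2 : continuous (fun z : R * R => z.2) by move=> z; exact: cvg_snd.
have cA : continuous (fun z : R * R => f (z.1 ^+ 2 + z.2 ^+ 2)).
  move=> z; apply: (@continuous_comp _ _ _ (fun z : R * R => z.1 ^+ 2 + z.2 ^+ 2) f).
    by apply: cvgD; [exact: (csqr _ _ c1)|exact: (csqr _ _ c2)].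
  by apply: cf; rewrite addr_ge0 ?sqr_ge0.
have cB : continuous (fun z : R * R => f (z.1 ^+ 2 * oneDsqr z.2) * `|z.1|).
  move=> z; apply: (@continuousM _ _ (fun z : R * R => f (z.1 ^+ 2 * oneDsqr z.2)) (fun z => `|z.1|)).
    apply: (@continuous_comp _ _ _ (fun z : R * R => z.1 ^+ 2 * oneDsqr z.2) f).
      apply: (@continuousM _ _ (fun z : R * R => z.1 ^+ 2) (fun z => oneDsqr z.2)).
        exact: (csqr _ _ c1).
      by apply: (@continuous_comp _ _ _ snd oneDsqr); [exact: c2|exact: continuous_oneDsqr].
    by apply: cf; rewrite mulr_ge0 ?sqr_ge0// ltW.
  by apply: (@continuous_comp _ _ _ fst (fun x : R => `|x|)); [exact: c1|exact: norm_continuous].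
have mA : measurable_fun setT (fun z : R * R => (f (z.1 ^+ 2 + z.2 ^+ 2))%:E).
  by apply/measurable_EFinP; exact: continuous_measurable_plane.
have mB : measurable_fun setT (fun z : R * R => (f (z.1 ^+ 2 * oneDsqr z.2) * `|z.1|)%:E).
  by apply/measurable_EFinP; exact: continuous_measurable_plane.
have A0 (z : R * R) : (0 <= (f (z.1 ^+ 2 + z.2 ^+ 2))%:E)%E.
  by rewrite lee_fin f0// addr_ge0 ?sqr_ge0.
have B0 (z : R * R) : (0 <= (f (z.1 ^+ 2 * oneDsqr z.2) * `|z.1|)%:E)%E.
  by rewrite lee_fin mulr_ge0// f0// mulr_ge0 ?sqr_ge0// ltW.
(* The sign is read off from a nonnegative integral; it permits pulling this constant out of the
   final integral. *)
have L0 : 0 <= L - F 0.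
  rewrite -lee_fin -(divr1 (L - F 0)) -(@integral_radial_line f F L 1)//.
  by apply: integral_ge0 => x _; rewrite lee_fin mulr_ge0// f0// mulr1 sqr_ge0.
apply: etrans (@fubini_tonelli1 _ _ _ _ R mu mu _ mA A0) _.
(* On each vertical line, substitute y = |x| s, with Jacobian |x|. The substitution degenerates only
   at x = 0, a null set. *)
transitivity (\int[mu]_x fubini_F mu (fun z : R * R => (f (z.1 ^+ 2 * oneDsqr z.2) * `|z.1|)%:E) x)%E.
  apply: ae_eq_integral => //.
  - exact: measurable_fun_fubini_tonelli_F.
  - exact: measurable_fun_fubini_tonelli_F.
  - exists [set 0]; split => //; first exact: lebesgue_measure_set1.
    move=> x /=; apply: contra_notP => /eqP x0 _; rewrite /fubini_F /=.
    have ax0 : 0 < `|x| by rewrite normr_gt0.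
    rewrite (@ge0_integral_scale `|x| (fun y => f (x ^+ 2 + y ^+ 2)))//.
    + apply: eq_integral => s _; congr ((f _ * _)%:E).
      by rewrite exprMn real_normK ?num_real// /oneDsqr mulrDr mulr1.
    + move=> y; apply: (@continuous_comp _ _ _ (fun y : R => x ^+ 2 + y ^+ 2) f).
        by apply: cvgD; [exact: cvg_cst|exact: exprn_continuous].
      by apply: cf; rewrite addr_ge0 ?sqr_ge0.
    + by move=> y; rewrite f0// addr_ge0 ?sqr_ge0.
rewrite -(@fubini_tonelli1 _ _ _ _ R mu mu _ mB B0).
rewrite (@fubini_tonelli2 _ _ _ _ R mu mu _ mB B0).
transitivity (\int[mu]_s ((L - F 0)%:E * (oneDsqr s)^-1%:E))%E.
  apply: eq_integral => s _; rewrite /fubini_G/=.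
  by rewrite (@integral_radial_line f F L (oneDsqr s))// EFinM.
rewrite ge0_integralZl//.
- by rewrite integralT_oneDsqr -EFinM mulrC.
- by apply/measurable_EFinP; apply: continuous_measurable_fun; exact: continuous_oneDsqrV.
Qed.

End radial_integration.

(** * Equivariant skyrmions and antiskyrmions *)

Section profile_algebra.
Context {R : realFieldType}.
Variables (al t u v : R).
(* u, v stand for the cutoff and its derivative at t = x^2 + y^2 *)
Let D := u ^+ 2 + al ^+ 2 * t.
Let w := D^-1.

(** Inverse stereographic projection of (al / u)(x, y), cleared of fractions so that u = 0 gives
    e_3. When v = u', [pr_ds] and [pr_dc] are twice the derivatives of [pr_s] and [pr_c] in t, the
    factor 2 coming from d_j t = 2 x_j. *)
Definition pr_s : R := 2 * al * u * w.
Definition pr_ds : R := 4 * al * w ^+ 2 * (v * (al ^+ 2 * t - u ^+ 2) - al ^+ 2 * u).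
Definition pr_c : R := (al ^+ 2 * t - u ^+ 2) * w.
Definition pr_dc : R := 4 * al ^+ 2 * u * w ^+ 2 * (u - 2 * t * v).

Hypothesis D0 : D != 0.

Lemma pr_sphere : pr_s ^+ 2 * t + pr_c ^+ 2 = 1.
Proof. by move: D0; rewrite /pr_s /pr_c /w /D => h; field. Qed.

(** The derivative of [pr_sphere] in t, here an algebraic identity in [v]. *)
Lemma pr_rel : pr_s * (pr_ds * t + pr_s) = - pr_c * pr_dc.
Proof. by move: D0; rewrite /pr_s /pr_c /pr_ds /pr_dc /w /D => h; field. Qed.

End profile_algebra.

Section profile_densities.
Context {R : realFieldType}.
Implicit Types s p c q x y sg r : R.

(* n = (sg s y, s x, c), with s' = p / 2 and c' = q / 2 as functions of t = x^2 + y^2 *)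
Lemma jac_profile s p c q x y sg : s ^+ 2 * (x ^+ 2 + y ^+ 2) + c ^+ 2 = 1 ->
  s * (p * (x ^+ 2 + y ^+ 2) + s) = - c * q ->
  jac (sg * (s * y)) (s * x) c (sg * (p * y * x)) (p * x * x + s) (q * x)
    (sg * (p * y * y + s)) (p * x * y) (q * y) = sg * q.
Proof.
move=> e1 e2.
have -> : jac (sg * (s * y)) (s * x) c (sg * (p * y * x)) (p * x * x + s) (q * x)
    (sg * (p * y * y + s)) (p * x * y) (q * y) =
  sg * (q * (s ^+ 2 * (x ^+ 2 + y ^+ 2) + c ^+ 2)
    - c * (s * (p * (x ^+ 2 + y ^+ 2) + s) + c * q)).
  by rewrite /jac; ring.
by rewrite e1 e2; ring.
Qed.

Lemma grad2_profile s p q x y sg : sg ^+ 2 = 1 ->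
  grad2 (sg * (p * y * x)) (p * x * x + s) (q * x) (sg * (p * y * y + s)) (p * x * y) (q * y)
  = (p * (x ^+ 2 + y ^+ 2) + s) ^+ 2 + s ^+ 2 + q ^+ 2 * (x ^+ 2 + y ^+ 2).
Proof.
move=> e.
have -> : grad2 (sg * (p * y * x)) (p * x * x + s) (q * x) (sg * (p * y * y + s)) (p * x * y) (q * y)
  = sg ^+ 2 * ((p * y * x) ^+ 2 + (p * y * y + s) ^+ 2)
    + ((p * x * x + s) ^+ 2 + (p * x * y) ^+ 2) + q ^+ 2 * (x ^+ 2 + y ^+ 2).
  by rewrite /grad2; ring.
by rewrite e; ring.
Qed.

(** The orientation decides the helicity: for sg = -1 the density is radial, while for sg = 1 it
    carries the factor y^2 - x^2 and averages to 0. *)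
Lemma hel_profileN s p c q x y :
  hel (-1 * (s * y)) (s * x) c (p * x * x + s) (q * x) (-1 * (p * y * y + s)) (q * y) =
  - (s * q * (x ^+ 2 + y ^+ 2)) + (c - 1) * (p * (x ^+ 2 + y ^+ 2) + 2 * s).
Proof. by rewrite /hel; ring. Qed.

Lemma hel_profileP s p c q x y :
  hel (1 * (s * y)) (s * x) c (p * x * x + s) (q * x) (1 * (p * y * y + s)) (q * y) =
  (s * q + (1 - c) * p) * (y ^+ 2 - x ^+ 2).
Proof. by rewrite /hel; ring. Qed.

End profile_densities.

(** * Densities on the core and on the tail *)

Section core_and_tail.
Context {R : realFieldType}.
Variables (al t : R).
Hypotheses (al0 : 0 < al) (t0 : 0 <= t).

Let den1 : 1 + al ^+ 2 * t != 0.
Proof. by rewrite gt_eqF// ltr_pwDl// mulr_ge0 ?sqr_ge0. Qed.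

(** At u = 1, v = 0 the map is exactly stereographic, hence conformal up to orientation, and half of
    |grad n|^2 is the modulus of the degree density. *)
Lemma core_grad2 :
  (pr_ds al t 1 0 * t + pr_s al t 1) ^+ 2 + pr_s al t 1 ^+ 2 + pr_dc al t 1 0 ^+ 2 * t
  = 2 * pr_dc al t 1 0.
Proof. by rewrite /pr_ds /pr_s /pr_dc !expr1n; field; rewrite den1. Qed.

(** On the core every density is a multiple of q = [pr_dc]. For sg = -1 the energy density is q (1 -
    2 r / al + 1 / (2 al^2)), which is smallest at al = 1 / (2 r), with value (1 - 2 r^2) q. *)
Lemma core_hel :
  - (pr_s al t 1 * pr_dc al t 1 0 * t) + (pr_c al t 1 - 1) * (pr_ds al t 1 0 * t + 2 * pr_s al t 1)
  = - (2 * al^-1 * pr_dc al t 1 0).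
Proof. by rewrite /pr_ds /pr_s /pr_dc /pr_c !expr1n; field; rewrite den1 gt_eqF. Qed.

Lemma core_pot : (1 - pr_c al t 1) ^+ 2 = al^-1 ^+ 2 * pr_dc al t 1 0.
Proof. by rewrite /pr_dc /pr_c !expr1n; field; rewrite den1 gt_eqF. Qed.

Variables (u v : R).
Hypotheses (u0 : 0 <= u) (u1 : u <= 1) (v0 : v <= 0) (vt : - v * t <= 8) (tp : 0 < t).

Let D := u ^+ 2 + al ^+ 2 * t.
Let a2t : 0 < al ^+ 2 * t. Proof. by rewrite mulr_gt0// exprn_gt0. Qed.
Let D0 : 0 < D. Proof. by rewrite ltr_wpDl// sqr_ge0. Qed.
Let w := D^-1.
Let w0 : 0 < w. Proof. by rewrite invr_gt0. Qed.
(** The tail estimates drop u^2 from the denominator, since no positive lower bound on u survives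
    where the cutoff reaches 0. *)
Let wle : w <= (al ^+ 2 * t)^-1.
Proof. by rewrite lef_pV2 ?posrE// lerDr sqr_ge0. Qed.

Lemma tail_s : 0 <= pr_s al t u <= 2 / (al * t).
Proof.
rewrite /pr_s -/D -/w; apply/andP; split.
  by rewrite !mulr_ge0// ltW.
have -> : 2 / (al * t) = 2 * al * 1 * (al ^+ 2 * t)^-1 by field; rewrite !gt_eqF.
by rewrite ler_pM// ?ler_pM// ?mulr_ge0 ?(ltW w0) ?(ltW al0).
Qed.

Lemma tail_c : 0 <= 1 - pr_c al t u <= 2 / (al ^+ 2 * t).
Proof.
have -> : 1 - pr_c al t u = 2 * (u ^+ 2 * w).
  by have h := D0; move: h; rewrite /pr_c /w /D => h; field; rewrite gt_eqF.
apply/andP; split; first by rewrite !mulr_ge0 ?sqr_ge0 ?(ltW w0).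
rewrite ler_pM2l// -[leRHS]mul1r ler_pM ?sqr_ge0 ?(ltW w0)// exprn_ile1//.
Qed.

Lemma pr_dc_ge0 : 0 <= pr_dc al t u v.
Proof.
rewrite /pr_dc; apply: mulr_ge0.
  apply: mulr_ge0; last exact: sqr_ge0.
  by apply: mulr_ge0 => //; apply: mulr_ge0 => //; exact: sqr_ge0.
by rewrite subr_ge0 (le_trans _ u0)// mulr_ge0_le0// mulr_ge0.
Qed.

Lemma tail_dc : pr_dc al t u v <= 68 / (al * t) ^+ 2.
Proof.
rewrite /pr_dc -/D -/w.
have -> : 68 / (al * t) ^+ 2 = 4 * al ^+ 2 * 1 * ((al ^+ 2 * t)^-1) ^+ 2 * 17 by field; rewrite !gt_eqF.
(* 17 = 1 + 2 * 8, from u <= 1 and - v t <= 8; it produces 68 = 4 * 17. *)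
have h : u - 2 * t * v <= 17 by move: vt u1; nra.
have h0 : 0 <= u - 2 * t * v by rewrite subr_ge0 (le_trans _ u0)// mulr_ge0_le0// mulr_ge0.
have w2 : w ^+ 2 <= ((al ^+ 2 * t)^-1) ^+ 2 by rewrite !expr2; apply: ler_pM => //; exact: ltW.
have a4 : 0 <= 4 * al ^+ 2 by rewrite mulr_ge0 ?sqr_ge0.
have a4u : 0 <= 4 * al ^+ 2 * u by exact: mulr_ge0.
apply: ler_pM => //; first by rewrite mulr_ge0 ?sqr_ge0.
apply: ler_pM => //; first exact: sqr_ge0.
exact: ler_wpM2l.
Qed.

(** The terms are regrouped so that one factor w is absorbed by al^2 t - u^2, their product being at
    most 1 in modulus. The constant is 36 = 4 * (8 + 1). *)
Lemma tail_ds : `|pr_ds al t u v| <= 36 / (al * t ^+ 2).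
Proof.
rewrite /pr_ds -/D -/w.
have -> : 4 * al * w ^+ 2 * (v * (al ^+ 2 * t - u ^+ 2) - al ^+ 2 * u) =
   4 * al * (w * (v * (w * (al ^+ 2 * t - u ^+ 2))) - w ^+ 2 * (al ^+ 2 * u)) by ring.
have b1 : `|w * (al ^+ 2 * t - u ^+ 2)| <= 1.
  rewrite normrM (gtr0_norm w0) /w ler_pdivrMl// mulr1 ler_norml /D.
  by have := sqr_ge0 u; move: a2t; move=> ? ?; apply/andP; split; lra.
have b2 : `|v| <= 8 / t.
  by rewrite ler0_norm// ler_pdivlMr.
have e1 : `|w * (v * (w * (al ^+ 2 * t - u ^+ 2)))| <= (al ^+ 2 * t)^-1 * (8 / t).
  rewrite normrM (gtr0_norm w0); apply: ler_pM => //; first exact: ltW.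
  by rewrite normrM -[leRHS]mulr1; apply: ler_pM.
have e2 : `|w ^+ 2 * (al ^+ 2 * u)| <= ((al ^+ 2 * t)^-1) ^+ 2 * (al ^+ 2 * 1).
  rewrite ger0_norm; last by rewrite mulr_ge0 ?sqr_ge0// mulr_ge0 ?sqr_ge0.
  apply: ler_pM; rewrite ?sqr_ge0//; first by rewrite mulr_ge0 ?sqr_ge0.
    by rewrite !expr2; apply: ler_pM => //; exact: ltW.
  by apply: ler_wpM2l => //; exact: sqr_ge0.
rewrite normrM (gtr0_norm (_ : 0 < 4 * al)) ?mulr_gt0//.
have -> : 36 / (al * t ^+ 2) = 4 * al * ((al ^+ 2 * t)^-1 * (8 / t) + ((al ^+ 2 * t)^-1) ^+ 2 * (al ^+ 2 * 1)).
  by field; rewrite !gt_eqF.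
by rewrite ler_pM2l ?mulr_gt0// (le_trans (ler_normB _ _))// lerD.
Qed.

Hypothesis t1 : 1 <= t.

(** The constants are 724 = (38^2 + 2^2) / 2, where 38 = 36 + 2, and 2312 = 68^2 / 2. The last term
    decays like 1/t^3, and 1 <= t lowers this to the common rate 1/t^2. *)
Lemma tail_dir :
  2^-1 * ((pr_ds al t u v * t + pr_s al t u) ^+ 2 + pr_s al t u ^+ 2 + pr_dc al t u v ^+ 2 * t)
  <= (724 / al ^+ 2 + 2312 / al ^+ 4) / t ^+ 2.
Proof.
have /andP[s0 s1] := tail_s; have q0 := pr_dc_ge0; have q1 := tail_dc; have p1 := tail_ds.
have b1 : `|pr_ds al t u v * t + pr_s al t u| <= 38 / (al * t).
  have -> : 38 / (al * t) = 36 / (al * t ^+ 2) * t + 2 / (al * t) by field; rewrite !gt_eqF.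
  rewrite (le_trans (ler_normD _ _))// lerD//; last by rewrite ger0_norm.
  by rewrite normrM (gtr0_norm tp) ler_pM2r.
have B1 : (pr_ds al t u v * t + pr_s al t u) ^+ 2 <= (38 / (al * t)) ^+ 2.
  by rewrite -[leLHS]real_normK ?num_real// !expr2; apply: ler_pM.
have B2 : pr_s al t u ^+ 2 <= (2 / (al * t)) ^+ 2 by rewrite !expr2; apply: ler_pM.
have B3 : pr_dc al t u v ^+ 2 * t <= 4624 / al ^+ 4 / t ^+ 2.
  apply: (@le_trans _ _ ((68 / (al * t) ^+ 2) ^+ 2 * t)).
    by rewrite ler_pM2r// !expr2; apply: ler_pM => //; rewrite -expr2.
  have -> : (68 / (al * t) ^+ 2) ^+ 2 * t = 4624 / al ^+ 4 / t ^+ 2 * t^-1.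
    by field; rewrite !gt_eqF.
  apply: ler_piMr; last by rewrite invf_le1.
  apply: divr_ge0; last exact: sqr_ge0.
  apply: divr_ge0; first exact: ler0n.
  by apply: exprn_ge0; exact: ltW.
apply: (@le_trans _ _ (2^-1 * ((38 / (al * t)) ^+ 2 + (2 / (al * t)) ^+ 2 + 4624 / al ^+ 4 / t ^+ 2))).
  rewrite ler_pM2l; last by rewrite invr_gt0.
  by apply: lerD; [exact: lerD|exact: B3].
by rewrite le_eqVlt; apply/orP; left; apply/eqP; field; rewrite !gt_eqF.
Qed.

(** The constant is 216 = 2 * 68 + 2 * (36 + 2 * 2). *)
Lemma tail_hel :
  `|- (pr_s al t u * pr_dc al t u v * t) + (pr_c al t u - 1) * (pr_ds al t u v * t + 2 * pr_s al t u)|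
  <= 216 / al ^+ 3 / t ^+ 2.
Proof.
have /andP[s0 s1] := tail_s; have q0 := pr_dc_ge0; have q1 := tail_dc; have p1 := tail_ds.
have /andP[d0 d1] := tail_c.
have -> : 216 / al ^+ 3 / t ^+ 2 = 2 / (al * t) * (68 / (al * t) ^+ 2) * t +
    2 / (al ^+ 2 * t) * (36 / (al * t ^+ 2) * t + 2 * (2 / (al * t))).
  by field; rewrite !gt_eqF.
rewrite (le_trans (ler_normD _ _))// lerD//.
  rewrite normrN ger0_norm; last by apply: mulr_ge0 => //; exact: mulr_ge0.
  by rewrite ler_pM2r//; apply: ler_pM.
rewrite normrM; apply: ler_pM => //; first by rewrite distrC ger0_norm.
rewrite (le_trans (ler_normD _ _))// lerD//.
  by rewrite normrM (gtr0_norm tp) ler_pM2r.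
rewrite ger0_norm; last exact: mulr_ge0.
exact: ler_wpM2l.
Qed.

Lemma tail_pot : (1 - pr_c al t u) ^+ 2 <= 4 / al ^+ 4 / t ^+ 2.
Proof.
have /andP[d0 d1] := tail_c.
apply: (@le_trans _ _ ((2 / (al ^+ 2 * t)) ^+ 2)); first by rewrite !expr2; apply: ler_pM.
by rewrite le_eqVlt; apply/orP; left; apply/eqP; field; rewrite !gt_eqF.
Qed.

End core_and_tail.

(* The constant is hidden behind an existential because large numerals of an abstract field are unary. *)
Lemma tail_bounds (R : realFieldType) : exists C : R, 0 <= C /\
  forall al t u v : R, 0 < al -> 0 <= u -> u <= 1 -> v <= 0 -> - v * t <= 8 -> 1 <= t ->
  [/\ 2^-1 * ((pr_ds al t u v * t + pr_s al t u) ^+ 2 + pr_s al t u ^+ 2 + pr_dc al t u v ^+ 2 * t)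
        <= C * (al ^- 2 + al ^- 4) * t ^- 2,
      - (pr_s al t u * pr_dc al t u v * t) + (pr_c al t u - 1) * (pr_ds al t u v * t + 2 * pr_s al t u)
        <= C * al ^- 3 * t ^- 2,
      (1 - pr_c al t u) ^+ 2 <= C * al ^- 4 * t ^- 2 &
      pr_dc al t u v <= C * al ^- 2 * t ^- 2].
Proof.
(* The largest constant in the four tail bounds; [add] makes up the difference for the smaller
   ones. *)
exists 2312; split; first exact: ler0n.
move=> al t u v al0 u0 u1 v0 vt t1.
have tp : 0 < t := lt_le_trans ltr01 t1; have t0 := ltW tp.
have pos k : 0 <= al ^- k * t ^- 2.
  by apply: mulr_ge0; rewrite invr_ge0; apply: exprn_ge0; exact: ltW.
have add (x y : R) (m k : nat) : x <= y - m%:R * (al ^- k * t ^- 2) -> x <= y.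
  by move=> /le_trans; apply; rewrite gerBl; apply: mulr_ge0; [exact: ler0n|exact: pos].
split.
- apply: le_trans (tail_dir al0 t0 u0 u1 v0 vt tp t1) _; apply: (add _ _ 1588 2%N).
  by rewrite le_eqVlt; apply/orP; left; apply/eqP; field; rewrite !gt_eqF.
- apply: le_trans (le_trans (ler_norm _) (tail_hel al0 t0 u0 u1 v0 vt tp)) _.
  apply: (add _ _ 2096 3%N).
  by rewrite le_eqVlt; apply/orP; left; apply/eqP; field; rewrite !gt_eqF.
- apply: le_trans (tail_pot al0 u0 u1 tp) _; apply: (add _ _ 2308 4%N).
  by rewrite le_eqVlt; apply/orP; left; apply/eqP; field; rewrite !gt_eqF.
- apply: le_trans (tail_dc al0 t0 u0 u1 v0 vt tp) _; apply: (add _ _ 2244 2%N).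
  by rewrite le_eqVlt; apply/orP; left; apply/eqP; field; rewrite !gt_eqF.
Qed.

(** * The cutoff in the squared radius *)

Section cutoff.
Context {R : realType}.
Variable T : R.
Hypothesis T0 : 0 < T.
Implicit Type t : R.

(* C^1 cutoff: 1 on [0, T], 0 beyond 2 T *)
Definition zet t : R := sqpos (1 - sqpos ((t - T) / T)).
Definition dzet t : R := 2 * pos (1 - sqpos ((t - T) / T)) * (- (2 * pos ((t - T) / T) / T)).

Lemma zet_core t : t <= T -> zet t = 1 /\ dzet t = 0.
Proof.
move=> tT; have h : (t - T) / T <= 0 by rewrite pmulr_lle0 ?invr_gt0// subr_le0.
rewrite /zet /dzet (sqpos_le0E h) (pos_le0E h) subr0 sqpos_gt0E// expr1n; split=> //.
by rewrite mulr0 mul0r oppr0 mulr0.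
Qed.

Lemma zet_out t : 2 * T <= t -> zet t = 0 /\ dzet t = 0.
Proof.
move=> tT; have h : 1 <= (t - T) / T by rewrite ler_pdivlMr// mul1r; lra.
have h1 : 1 - sqpos ((t - T) / T) <= 0.
  by rewrite sqpos_gt0E ?(le_trans _ h)// subr_le0 exprn_ege1.
by rewrite /zet /dzet sqpos_le0E// pos_le0E// mulr0 mul0r.
Qed.

Lemma zet_01 t : 0 <= zet t <= 1.
Proof.
rewrite sqpos_ge0/=; have [h|h] := leP 0 (1 - sqpos ((t - T) / T)).
  rewrite /zet sqpos_gt0E// exprn_ile1// lerBlDr lerDl; exact: sqpos_ge0.
by rewrite /zet sqpos_le0E ?ltW.
Qed.

Lemma dzet_le0 t : dzet t <= 0.
Proof.
rewrite /dzet mulrN oppr_le0 mulr_ge0//; first by rewrite mulr_ge0// pos_ge0.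
by rewrite divr_ge0 ?(ltW T0)// mulr_ge0// pos_ge0.
Qed.

(** The cutoff depends on t / T only, so the bound is free of T. With x = (t - T) / T in [0, 1] the
    left side is 4 (1 - x^2) x (1 + x), at most 4 * 1 * 2. *)
Lemma dzet_bound t : - dzet t * t <= 8.
Proof.
have [tT|tT] := leP t T; first by rewrite (zet_core tT).2 oppr0 mul0r.
have [tT2|tT2] := leP (2 * T) t; first by rewrite (zet_out tT2).2 oppr0 mul0r.
pose x := (t - T) / T.
have x0 : 0 <= x by rewrite divr_ge0 ?(ltW T0)// subr_ge0 ltW.
have x1 : x <= 1 by rewrite ler_pdivrMr// mul1r; lra.
have tE : t = T * (1 + x) by rewrite /x; field; rewrite gt_eqF.
have x2 : 0 <= 1 - x ^+ 2 by rewrite subr_ge0 exprn_ile1.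
have -> : - dzet t * t = 4 * ((1 - x ^+ 2) * (x * (1 + x))).
  rewrite /dzet -/x sqpos_gt0E// !pos_gt0E// [X in _ * X = _]tE; field; by rewrite gt_eqF.
have h1 : 1 - x ^+ 2 <= 1 by rewrite gerBl sqr_ge0.
have h2 : x * (1 + x) <= 2 by nra.
have : (1 - x ^+ 2) * (x * (1 + x)) <= 1 * 2 by apply: ler_pM => //; rewrite mulr_ge0// addr_ge0.
by lra.
Qed.

Lemma continuous_ratio : continuous (fun t => (t - T) / T).
Proof.
apply: contM; last exact: cst_continuous.
by apply: contB; [move=> x; exact: cvg_id|exact: cst_continuous].
Qed.

Lemma continuous_inner : continuous (fun t => 1 - sqpos ((t - T) / T)).
Proof.
apply: contB; first exact: cst_continuous.
move=> x; apply: (@continuous_comp _ _ _ (fun t => (t - T) / T) sqpos).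
  exact: continuous_ratio.
exact: continuous_sqpos.
Qed.

Lemma continuous_zet : continuous zet.
Proof.
move=> x; apply: (@continuous_comp _ _ _ (fun t => 1 - sqpos ((t - T) / T)) sqpos).
  exact: continuous_inner.
exact: continuous_sqpos.
Qed.

Lemma continuous_dzet : continuous dzet.
Proof.
have c2 : continuous (fun _ : R => 2 : R) by exact: cst_continuous.
apply: contM; first apply: contM => //.
  move=> x; apply: (@continuous_comp _ _ _ (fun t => 1 - sqpos ((t - T) / T)) pos).
    exact: continuous_inner.
  exact: continuous_pos.
move=> x; apply: cvgN; move: x; apply: contM; last exact: cst_continuous.
apply: contM => // x; apply: (@continuous_comp _ _ _ (fun t => (t - T) / T) pos).
  exact: continuous_ratio.
exact: continuous_pos.
Qed.

Lemma is_derive_zet t : is_derive (t : R) 1 zet (dzet t).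
Proof.
have r1 : is_derive (t : R) 1 (fun t : R => (t - T) / T) T^-1.
  have h : is_derive (t : R) 1 (fun t : R => T^-1 *: (t - T)) (T^-1 *: (1 - 0)).
    by apply: is_deriveZ.
  move: h; rewrite subr0 /GRing.scale/= mulr1.
  by under [X in is_derive _ _ X _ -> _]eq_fun do rewrite mulrC.
have r2 := @is_derive1_comp _ sqpos (fun t : R => (t - T) / T) t _ _ (is_derive_sqpos ((t - T) / T)) r1.
have r3 : is_derive (t : R) 1 (fun t : R => 1 - sqpos ((t - T) / T)) (0 - (2 * pos ((t - T) / T)) * T^-1).
  by apply: is_deriveB.
have := @is_derive1_comp _ sqpos (fun t : R => 1 - sqpos ((t - T) / T)) t _ _ (is_derive_sqpos (1 - sqpos ((t - T) / T))) r3.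
by rewrite sub0r.
Qed.

End cutoff.

(** * Radial integrals over the plane *)

Section radial.
Context {R : realType}.
Notation mu := (@lebesgue_measure R).
Notation mu2 := (mu \x mu)%E.

Definition nsq (z : R * R) : R := z.1 ^+ 2 + z.2 ^+ 2.

Lemma nsq_ge0 z : 0 <= nsq z. Proof. by rewrite addr_ge0 ?sqr_ge0. Qed.

Lemma continuous_nsq : continuous nsq.
Proof. by apply: contD; apply: cont_sqr => z; [exact: cvg_fst|exact: cvg_snd]. Qed.

Lemma radial_Rintegral (f F : R -> R) (L : R) :
  (forall t, 0 <= t -> 0 <= f t) -> (forall t, 0 <= t -> {for t, continuous f}) ->
  (forall t : R, 0 <= t -> is_derive t 1 F (f t)) ->
  F x @[x --> +oo] --> L ->
  mu2.-integrable setT (EFin \o (fun z => f (nsq z))) /\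
  (\int[mu2]_z f (nsq z) = pi * (L - F 0))%R.
Proof.
move=> f0 cf dF FL; have E := integral_radial f0 cf dF FL.
have mf : measurable_fun setT (fun z => f (nsq z)).
  apply: continuous_measurable_plane => z.
  apply: (@continuous_comp _ _ _ nsq f); first exact: continuous_nsq.
  by apply: cf; exact: nsq_ge0.
split; last by rewrite /Rintegral E.
apply/integrableP; split; first exact/measurable_EFinP.
rewrite (_ : (\int[mu2]_z `|(EFin \o (fun z => f (nsq z))) z|)%E =
  (\int[mu2]_z (f (z.1 ^+ 2 + z.2 ^+ 2))%:E)%E); first by rewrite E ltry.
by apply: eq_integral => z _ /=; rewrite ger0_norm// f0// nsq_ge0.
Qed.

(** A comparison function for 1/t^2 on t >= T that is regular at the origin, so that the tail error
    is integrated over the whole plane without splitting the domain. *)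
Lemma radial_tail (T : R) : 0 < T ->
  mu2.-integrable setT (EFin \o (fun z => (nsq z + T) ^- 2)) /\
  (\int[mu2]_z (nsq z + T) ^- 2 = pi / T)%R.
Proof.
move=> T0; have tT (t : R) : 0 <= t -> t + T != 0 by move=> t0; rewrite gt_eqF// ltr_wpDl.
have -> : pi / T = pi * (0 - (fun t : R => - (t + T)^-1) 0) :> R by rewrite add0r opprK add0r.
have dD (t : R) : is_derive (t : R) 1 (fun t : R => t + T) 1.
  by apply: is_derive_eq; rewrite addr0.
apply: (@radial_Rintegral (fun t : R => (t + T) ^- 2) (fun t => - (t + T)^-1) 0).
- by move=> t t0; rewrite invr_ge0 sqr_ge0.
- move=> t t0; apply: cvgV; first by rewrite expf_neq0// tT.
  by move: (t); apply: cont_sqr; apply: contD; [move=> x; exact: cvg_id|exact: cst_continuous].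
- move=> t t0; have dV := is_deriveN (@is_deriveV R (fun t : R => t + T) t _ 1 (tT _ t0) (dD t)).
  by move: dV; rewrite /GRing.scale/= mulr1 opprK.
- rewrite -oppr0; apply: cvgN; apply/cvgrPdist_le => e e0; near=> t.
  have t0 : 0 < t by near: t; exact: nbhs_pinfty_gt.
  rewrite sub0r normrN gtr0_norm ?invr_gt0 ?addr_gt0//.
  rewrite invf_ple ?posrE ?addr_gt0//; apply: (@le_trans _ _ t); last by rewrite lerDl ltW.
  by near: t; apply: nbhs_pinfty_ge; exact: num_real.
Unshelve. all: by end_near. Qed.

End radial.

(** * The blocks of degree 1 and -1 *)

Section block.
Context {R : realType}.
Notation mu := (@lebesgue_measure R).
Notation mu2 := (mu \x mu)%E.
Variables (al T sg : R).
Hypotheses (al0 : 0 < al) (T0 : 0 < T) (sg2 : sg ^+ 2 = 1).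
Implicit Types (t : R) (z : R * R).

Definition prS t : R := pr_s al t (zet T t).
Definition prDS t : R := pr_ds al t (zet T t) (dzet T t).
Definition prC t : R := pr_c al t (zet T t).
Definition prDC t : R := pr_dc al t (zet T t) (dzet T t).

Definition blk (i : 'I_3) z : R :=
  if i == c1 then sg * (prS (nsq z) * z.2) else
  if i == c2 then prS (nsq z) * z.1 else prC (nsq z).

Definition crd (j : 'I_2) z : R := if j == d1 then z.1 else z.2.

Definition dblk (i : 'I_3) (j : 'I_2) z : R :=
  if i == c1 then sg * (prDS (nsq z) * z.2 * crd j z + (if j == d1 then 0 else prS (nsq z))) else
  if i == c2 then prDS (nsq z) * z.1 * crd j z + (if j == d1 then prS (nsq z) else 0) else
  prDC (nsq z) * crd j z.

(** The two terms never vanish together: the cutoff is 1 up to T, and t > 0 beyond. *)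
Lemma den_gt0 t : 0 <= t -> 0 < zet T t ^+ 2 + al ^+ 2 * t.
Proof.
move=> t0; have [tT|tT] := leP t T.
  by rewrite (zet_core T0 tT).1 expr1n ltr_pwDl// mulr_ge0 ?sqr_ge0.
by rewrite ltr_wpDl ?sqr_ge0// mulr_gt0 ?exprn_gt0// (lt_trans T0).
Qed.

Lemma den_neq0 t : 0 <= t -> zet T t ^+ 2 + al ^+ 2 * t != 0.
Proof. by move=> /den_gt0 h; rewrite gt_eqF. Qed.

Lemma C1_nsq : C1 nsq (fun j z => 2 * crd j z).
Proof.
have C := C1_add (C1_mul (@C1_fst R) (@C1_fst R)) (C1_mul (@C1_snd R) (@C1_snd R)).
apply: C1_eq C => [z|j z]; first by rewrite /nsq !expr2.
by rewrite /crd /=; case: ifP => _; rewrite !(mulr1, mulr0, mul1r, mul0r, addr0, add0r); ring.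
Qed.

Lemma C1_zet : C1 (fun z => zet T (nsq z)) (fun j z => dzet T (nsq z) * (2 * crd j z)).
Proof.
apply: C1_comp C1_nsq _ _; first by move=> x; exact: is_derive_zet.
exact: continuous_dzet.
Qed.

Lemma C1_invden : C1 (fun z => (zet T (nsq z) ^+ 2 + al ^+ 2 * nsq z)^-1)
  (fun j z => - (zet T (nsq z) ^+ 2 + al ^+ 2 * nsq z) ^- 2 *
    (2 * zet T (nsq z) * (dzet T (nsq z) * (2 * crd j z)) + al ^+ 2 * (2 * crd j z))).
Proof.
apply: (@C1_inv R (fun z => zet T (nsq z) ^+ 2 + al ^+ 2 * nsq z)
  (fun j z => 2 * zet T (nsq z) * (dzet T (nsq z) * (2 * crd j z)) + al ^+ 2 * (2 * crd j z))).
  by move=> z; rewrite den_neq0// nsq_ge0.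
have C := C1_add (C1_mul C1_zet C1_zet) (C1_mul (C1_cst (al ^+ 2)) C1_nsq).
by apply: C1_eq C => [z|j z] /=; rewrite ?expr2//; ring.
Qed.

Lemma C1_prS : C1 (fun z => prS (nsq z)) (fun j z => prDS (nsq z) * crd j z).
Proof.
have C := C1_mul (C1_mul (C1_cst (2 * al)) C1_zet) C1_invden.
apply: C1_eq C => [z|j z] //=; have := den_neq0 (nsq_ge0 z).
by rewrite /prDS /pr_ds; move: (nsq z) (crd j z) (zet T (nsq z)) (dzet T (nsq z)) => t x u v h; field.
Qed.

Lemma C1_prC : C1 (fun z => prC (nsq z)) (fun j z => prDC (nsq z) * crd j z).
Proof.
have C := C1_mul (C1_add (C1_mul (C1_cst (al ^+ 2)) C1_nsq)
  (C1_mul (C1_cst (-1)) (C1_mul C1_zet C1_zet))) C1_invden.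
apply: C1_eq C => [z|j z] /=.
  by rewrite /prC /pr_c; congr (_ * _); ring.
have := den_neq0 (nsq_ge0 z).
by rewrite /prDC /pr_dc; move: (nsq z) (crd j z) (zet T (nsq z)) (dzet T (nsq z)) => t x u v h; field.
Qed.

Lemma C1_blk i : C1 (blk i) (dblk i).
Proof.
rewrite /blk /dblk; case: (i == c1); last case: (i == c2); last exact: C1_prC.
- have C := C1_mul (C1_cst sg) (C1_mul C1_prS (@C1_snd R)).
  apply: C1_eq C => [z|j z] //=.
  by case: (j == d1); rewrite /= ?mulr1 ?mulr0 mul0r; ring.
- have C := C1_mul C1_prS (@C1_fst R).
  apply: C1_eq C => [z|j z] //=.
  by case: (j == d1); rewrite /= ?mulr1 ?mulr0; ring.
Qed.

Lemma nsq_out z : ~~ insq (2 * T + 1) z -> 2 * T <= nsq z.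
Proof.
have h (x y : R) : 2 * T + 1 < `|x| -> 2 * T <= x ^+ 2 + y ^+ 2.
  move=> hx; have := sqr_ge0 y; rewrite -(real_normK (num_real x)).
  by move: T0 hx; nra.
by rewrite negb_and -!ltNge => /orP[/h|/h] // k; rewrite /nsq // addrC.
Qed.

Lemma config_blk : config blk dblk (2 * T + 1).
Proof.
split; first exact: C1_blk.
- move=> z; rewrite /blk /= -/(prS _) exprMn sg2 mul1r.
  have := pr_sphere (den_neq0 (nsq_ge0 z)); rewrite -/(prS _) -/(prC _) => <-.
  by rewrite [X in _ = _ ^+ 2 * X + _]/nsq; ring.
- by rewrite addr_ge0// mulr_ge0// ltW.
- move=> z /nsq_out zT; have [u0 v0] := zet_out T0 zT.
  have t0 : 0 < nsq z by rewrite (lt_le_trans _ zT)// mulr_gt0.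
  have S0 : prS (nsq z) = 0 by rewrite /prS /pr_s u0 mulr0 mul0r.
  have DS0 : prDS (nsq z) = 0 by rewrite /prDS /pr_ds u0 v0 mul0r mulr0 subr0 mulr0.
  have DC0 : prDC (nsq z) = 0 by rewrite /prDC /pr_dc u0 mulr0 !mul0r.
  split.
  + by rewrite /blk /= S0 mul0r mulr0.
  + by rewrite /blk /= S0 mul0r.
  + rewrite /blk /= /prC /pr_c u0 expr0n subr0 add0r mulfV// gt_eqF// mulr_gt0// exprn_gt0//.
  + move=> i j; rewrite /dblk S0 DS0 DC0.
    by do ?case: ifP => _; rewrite !(mul0r, mulr0, addr0).
Qed.

Lemma dens_deg_blk z : dens_deg blk dblk z = sg * prDC (nsq z).
Proof.
have D0 := den_neq0 (nsq_ge0 z).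
have := @jac_profile R (prS (nsq z)) (prDS (nsq z)) (prC (nsq z)) (prDC (nsq z)) z.1 z.2 sg
  (pr_sphere D0) (pr_rel _ D0) => <-.
by rewrite /dens_deg /blk /dblk /crd /= !addr0.
Qed.

Lemma dens_dir_blk z : dens_dir dblk z =
  (prDS (nsq z) * nsq z + prS (nsq z)) ^+ 2 + prS (nsq z) ^+ 2 + prDC (nsq z) ^+ 2 * nsq z.
Proof.
rewrite -(@grad2_profile R (prS (nsq z)) (prDS (nsq z)) (prDC (nsq z)) z.1 z.2 sg sg2).
by rewrite /dens_dir /dblk /crd /= !addr0.
Qed.

Lemma dens_pot_blk z : dens_pot blk z = (1 - prC (nsq z)) ^+ 2.
Proof. by []. Qed.

Lemma continuous_prDC t : 0 <= t -> {for t, continuous prDC}.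
Proof.
move=> t0; rewrite /prDC /pr_dc.
have cz : continuous (zet T) by exact: continuous_zet.
have cdz : continuous (dzet T) by exact: continuous_dzet.
have cid : continuous (fun t : R => t) by move=> x; exact: cvg_id.
have cc (c : R) : continuous (fun _ : R => c) by exact: cst_continuous.
have cD : continuous (fun t => zet T t ^+ 2 + al ^+ 2 * t).
  by apply: contD; [exact: cont_sqr|exact: contM].
have cw : (fun t => (zet T t ^+ 2 + al ^+ 2 * t)^-1) x @[x --> t] -->
    (zet T t ^+ 2 + al ^+ 2 * t)^-1.
  by apply: cvgV; [exact: den_neq0|exact: cD].
apply: cvgM; last by move: (t); apply: contB => //; apply: contM => //; exact: contM.
apply: cvgM; first by move: (t); exact: contM.
by rewrite expr2; under eq_fun do rewrite expr2; apply: cvgM.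
Qed.

Lemma is_derive_prC t : 0 <= t -> is_derive (t : R) 1 (fun t => 2 * prC t) (prDC t).
Proof.
move=> t0; have D0 := den_neq0 t0.
have zd := is_derive_zet T t.
have dN : is_derive (t : R) 1 (fun t : R => al ^+ 2 * t - zet T t ^+ 2)
    (al ^+ 2 - 2 * zet T t * dzet T t).
  by apply: is_derive_eq; rewrite /GRing.scale/=; ring.
have dD : is_derive (t : R) 1 (fun t : R => zet T t ^+ 2 + al ^+ 2 * t)
    (2 * zet T t * dzet T t + al ^+ 2).
  by apply: is_derive_eq; rewrite /GRing.scale/=; ring.
have dV := @is_deriveV R (fun t : R => zet T t ^+ 2 + al ^+ 2 * t) t _ 1 D0 dD.
have dP := is_deriveZ 2 (is_deriveM dN dV).
case: dP => dd de; apply: DeriveDef; [exact: dd|apply: (etrans de)].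
by move: D0; rewrite /GRing.scale/= /prDC /pr_dc; move: (zet T t) (dzet T t) => u v D0; field.
Qed.

Lemma prDC_ge0 t : 0 <= t -> 0 <= prDC t.
Proof.
by move=> t0; case/andP: (zet_01 T t) => u0 _; exact: (pr_dc_ge0 _ t0 u0 (dzet_le0 T0 t)).
Qed.

(** Since [prDC] is the derivative of 2 c, only boundary values count: c runs from -1 at the origin
    to 1 beyond the cutoff, which gives pi (2 + 2) for every [al] and [T]. *)
Lemma integral_prDC : mu2.-integrable setT (EFin \o (fun z => prDC (nsq z))) /\
  (\int[mu2]_z prDC (nsq z) = 4 * pi)%R.
Proof.
have F0 : 2 * prC 0 = -2.
  by have [h _] := zet_core T0 (ltW T0); rewrite /prC /pr_c h expr1n mulr0 addr0 add0r invr1 mulr1 mulrN1.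
have -> : 4 * pi = pi * (2 - 2 * prC 0) :> R by rewrite F0; ring.
apply: (radial_Rintegral prDC_ge0 continuous_prDC is_derive_prC).
apply: cvg_near_cst; exists (2 * T); split; [exact: num_real|move=> t tT].
rewrite /prC /pr_c (zet_out T0 (ltW tT)).1 expr0n subr0 add0r mulfV ?mulr1//.
by rewrite gt_eqF// mulr_gt0 ?exprn_gt0// (lt_trans _ tT)// mulr_gt0.
Qed.

End block.

(** * Blocks of nearly optimal energy *)

Section families.
Context {R : realType}.
Notation mu := (@lebesgue_measure R).
Notation mu2 := (mu \x mu)%E.
Implicit Types (al T sg r e : R) (z : R * R).

(** The same integer, 1 or -1, is both the orientation sign of the block and its degree. *)
Lemma attained_blk al T (k : int) r : 0 < al -> 0 < T -> (k%:~R : R) ^+ 2 = 1 ->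
  attained r k (\int[mu2]_z dens_energy r (blk al T k%:~R) (dblk al T k%:~R) z)%R.
Proof.
move=> al0 T0 k2; have cf := config_blk al0 T0 k2.
exists (blk al T k%:~R), (dblk al T k%:~R), (2 * T + 1); split=> //.
have [Iq Eq] := integral_prDC al0 T0.
rewrite mulrC -Eq -RintegralZl//.
by apply: eq_Rintegral => z _; exact: dens_deg_blk.
Qed.

(** Both comparison functions have explicit integrals, so an energy estimate reduces to one
    pointwise inequality on the plane. *)
Lemma Rintegral_le_profile al T (A B : R) (h : R * R -> R) : 0 < al -> 0 < T ->
  mu2.-integrable setT (EFin \o h) ->
  (forall z, h z <= A * prDC al T (nsq z) + B * (nsq z + T) ^- 2) ->
  (\int[mu2]_z h z)%R <= A * (4 * pi) + B * (pi / T).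
Proof.
move=> al0 T0 Ih hle.
have [Iq Eq] := integral_prDC al0 T0; have [It Et] := radial_tail T0.
have IA := integrable_scale A measurableT Iq.
have IB := integrable_scale B measurableT It.
rewrite -Eq -Et -(RintegralZl A measurableT Iq) -(RintegralZl B measurableT It) -RintegralD//.
apply: le_Rintegral => //.
exact: integrable_add measurableT IA IB.
Qed.

(** For t >= T one has t + T <= 2 t, whence the factor 4. *)
Lemma inv_sq_tail (t T : R) : 0 < T -> T <= t -> t ^- 2 <= 4 * (t + T) ^- 2.
Proof.
move=> T0 Tt; have t0 := lt_le_trans T0 Tt.
rewrite ler_pdivlMr ?exprn_gt0 ?addr_gt0// ler_pdivrMl ?exprn_gt0//; nra.
Qed.

(* On the core the density is exactly (1 - 2 r^2) times the degree density for al = 1 / (2 r). *)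
Lemma antiskyrmion r e : 0 < r -> 0 < e ->
  exists E, attained r (-1) E /\ E <= 4 * pi * (1 - 2 * r ^+ 2) + e.
Proof.
move=> r0 e0; pose al := (2 * r)^-1.
have al0 : 0 < al by rewrite invr_gt0 mulr_gt0.
have pi0 : 0 < pi :> R := pi_gt0 R.
have [C [C0 HC]] := tail_bounds R.
have alk k : 0 <= al ^- k by rewrite invr_ge0 exprn_ge0// ltW.
(* The tail constants, weighted as in the energy. The last summand pays for the term - 2 r^2 [prDC]
   of the target, which is negative on the tail as well. *)
pose K := C * (al ^- 2 + al ^- 4) + r * (C * al ^- 3) + 2^-1 * (C * al ^- 4)
  + 2 * r ^+ 2 * (C * al ^- 2).
have K0 : 0 <= K.
  rewrite /K; move: (alk 2) (alk 3) (alk 4); move: (al ^- 2) (al ^- 3) (al ^- 4) => x y z x0 y0 z0.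
  by rewrite !addr_ge0// !mulr_ge0 ?sqr_ge0 ?addr_ge0 ?invr_ge0 ?(ltW r0)//.
(* Chosen so that the tail error 4 K pi / T is at most e; the summand 1 ensures t >= 1 on the
   tail. *)
pose T := 1 + 4 * K * pi / e.
have T1 : 1 <= T by rewrite lerDl divr_ge0 ?(ltW e0)// !mulr_ge0// ltW.
have T0 : 0 < T by rewrite (lt_le_trans ltr01).
have N1 : ((-1)%:~R : R) = -1 by rewrite mulrN1z.
have N2 : (((-1)%:~R : R)) ^+ 2 = 1 by rewrite N1 sqrrN expr1n.
exists (\int[mu2]_z dens_energy r (blk al T (-1)%:~R) (dblk al T (-1)%:~R) z)%R.
split; first exact: attained_blk.
have [Id Ih Iv _] := config_integrable r (config_blk al0 T0 N2).
have [Ie _] := EnergyE r Id Ih Iv.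
apply: (@le_trans _ _ ((1 - 2 * r ^+ 2) * (4 * pi) + 4 * K * (pi / T))); last first.
  rewrite [_ * (4 * pi)]mulrC lerD2l mulrA ler_pdivrMr//.
  have -> : e * T = e + 4 * K * pi by rewrite /T; field; rewrite gt_eqF.
  by rewrite lerDr ltW.
apply: (Rintegral_le_profile al0) => // z; set t := nsq z.
have t0 : 0 <= t by exact: nsq_ge0.
have hE : dens_hel (blk al T (-1)%:~R) (dblk al T (-1)%:~R) z =
    - (prS al T t * prDC al T t * t) + (prC al T t - 1) * (prDS al T t * t + 2 * prS al T t).
  by rewrite -hel_profileN /dens_hel N1 /blk /dblk /crd.
have eE : dens_energy r (blk al T (-1)%:~R) (dblk al T (-1)%:~R) z =
   2^-1 * ((prDS al T t * t + prS al T t) ^+ 2 + prS al T t ^+ 2 + prDC al T t ^+ 2 * t)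
   + r * (- (prS al T t * prDC al T t * t) + (prC al T t - 1) * (prDS al T t * t + 2 * prS al T t))
   + 2^-1 * (1 - prC al T t) ^+ 2.
  by rewrite /dens_energy hE dens_pot_blk dens_dir_blk.
rewrite {}eE; have B0 : 0 <= 4 * K * (t + T) ^- 2.
  by rewrite mulr_ge0 ?invr_ge0 ?sqr_ge0// mulr_ge0.
have [tT|/ltW tT] := leP t T.
  have [u1 v1] := zet_core T0 tT.
  rewrite /prS /prC /prDS /prDC u1 v1 core_grad2// core_hel// core_pot//.
  apply: ler_wpDr => //; rewrite le_eqVlt; apply/orP; left; apply/eqP.
  by rewrite /al; move: (pr_dc _ _ _ _) => q; field; rewrite gt_eqF.
have [u0 u1] := andP (zet_01 T t); have v0 := dzet_le0 T0 t; have vt := dzet_bound T0 t.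
have t1 : 1 <= t := le_trans T1 tT.
have [Hd Hh Hp Hq] := HC al t _ _ al0 u0 u1 v0 vt t1.
have Hq0 := prDC_ge0 al T0 t0.
have Kt := ler_wpM2l K0 (inv_sq_tail T0 tT).
have r2 := ler_wpM2l (ltW r0) Hh.
have r3 := ler_wpM2l (mulr_ge0 (ler0n R 2) (sqr_ge0 r)) Hq.
rewrite -/(prS al T t) -/(prC al T t) -/(prDS al T t) -/(prDC al T t) in Hd r2 Hp r3.
have KE : K * t ^- 2 = C * (al ^- 2 + al ^- 4) * t ^- 2 + r * (C * al ^- 3 * t ^- 2)
    + 2^-1 * (C * al ^- 4 * t ^- 2) + 2 * r ^+ 2 * (C * al ^- 2 * t ^- 2).
  by rewrite /K; ring.
move: Hd r2 Hp r3 Kt; rewrite KE => Hd r2 Hp r3 Kt; lra.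
Qed.

Lemma hel_swap al T z :
  dens_hel (blk al T 1%:~R) (dblk al T 1%:~R) (swapz z) = - dens_hel (blk al T 1%:~R) (dblk al T 1%:~R) z.
Proof.
have hE w : dens_hel (blk al T 1%:~R) (dblk al T 1%:~R) w =
    (prS al T (nsq w) * prDC al T (nsq w) + (1 - prC al T (nsq w)) * prDS al T (nsq w)) * (w.2 ^+ 2 - w.1 ^+ 2).
  have N1 : (1%:~R : R) = 1 by [].
  by rewrite -hel_profileP /dens_hel N1 /blk /dblk /crd.
have nE : nsq (swapz z) = nsq z by rewrite /nsq /swapz /= addrC.
by rewrite !hE nE /swapz /=; ring.
Qed.

(* The helicity density is odd under the swap of coordinates, and al -> oo kills the potential. *)
Lemma skyrmion r e : 0 < e -> exists E, attained r 1 E /\ E <= 4 * pi + e.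
Proof.
move=> e0; have pi0 : 0 < pi :> R := pi_gt0 R.
have [C [C0 HC]] := tail_bounds R.
(* With a = al^-2 <= 1, the potential on the core costs 4 pi a / 2 and the tail at most 4 pi * 3 C
   a, so that c a bounds the whole excess over 4 pi. *)
pose c : R := 4 * pi * (2^-1 + 3 * C).
have c0 : 0 < c by rewrite !mulr_gt0// ltr_pwDl ?invr_gt0// mulr_ge0.
(* This makes c a <= c / al <= e. The cutoff radius stays at T = 1; smallness comes from
   concentrating the block. *)
pose al := 1 + c / e.
have al1 : 1 <= al by rewrite lerDl divr_ge0// ltW.
have al0 : 0 < al by rewrite (lt_le_trans ltr01).
pose a := al ^- 2.
have a0 : 0 <= a by rewrite invr_ge0 sqr_ge0.
have aal : a <= al^-1 by rewrite lef_pV2 ?posrE ?exprn_gt0// expr2 ler_peMl// ltW.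
have a1 : a <= 1 by rewrite (le_trans aal)// invf_le1.
have a4 : al ^- 4 = a ^+ 2 by rewrite /a -exprVn -[in RHS]exprVn -exprM.
have ca : c * a <= e.
  rewrite (le_trans (ler_wpM2l (ltW c0) aal))// ler_pdivrMr// /al mulrDr mulr1 mulrCA mulfV ?mulr1 ?gt_eqF//.
  by rewrite lerDr ltW.
have N1 : (1%:~R : R) = 1 by [].
have N2 : (1%:~R : R) ^+ 2 = 1 by rewrite expr1n.
exists (\int[mu2]_z dens_energy r (blk al 1 1%:~R) (dblk al 1 1%:~R) z)%R.
split; first exact: attained_blk.
have [Id Ih Iv _] := config_integrable r (config_blk al0 ltr01 N2).
have h0 : (\int[mu2]_z dens_hel (blk al 1 1%:~R) (dblk al 1 1%:~R) z = 0)%R.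
  have mh : measurable_fun setT (dens_hel (blk al 1 1%:~R) (dblk al 1 1%:~R)).
    by have /measurable_EFinP := measurable_int _ Ih.
  have := Rintegral_swap mh.
  have -> : (\int[mu2]_z dens_hel (blk al 1 1%:~R) (dblk al 1 1%:~R) (swapz z) =
     \int[mu2]_z (-1 * dens_hel (blk al 1 1%:~R) (dblk al 1 1%:~R) z))%R.
    by apply: eq_Rintegral => z _; rewrite hel_swap mulN1r.
  by rewrite RintegralZl// => h; lra.
pose h z := 2^-1 * dens_dir (dblk al 1 1%:~R) z + 2^-1 * dens_pot (blk al 1 1%:~R) z.
have Ihh : mu2.-integrable setT (EFin \o h).
  apply: (integrable_add measurableT).
    exact: (integrable_scale _ measurableT Id).
  exact: (integrable_scale _ measurableT Iv).
have -> : (\int[mu2]_z dens_energy r (blk al 1 1%:~R) (dblk al 1 1%:~R) z = \int[mu2]_z h z)%R.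
  transitivity (\int[mu2]_z (h z + r * dens_hel (blk al 1 1%:~R) (dblk al 1 1%:~R) z))%R.
    by apply: eq_Rintegral => z _; rewrite /dens_energy /h addrAC.
  have Irh := integrable_scale r measurableT Ih.
  by rewrite RintegralD// RintegralZl// h0 mulr0 addr0.
pose K := C * (a + a ^+ 2) + 2^-1 * (C * a ^+ 2).
apply: (@le_trans _ _ ((1 + 2^-1 * a) * (4 * pi) + 4 * K * (pi / 1))); last first.
  have aa : a ^+ 2 <= a by rewrite expr2 ler_piMl.
  have K3 : K <= 3 * C * a by rewrite /K; have := ler_wpM2l C0 aa; have := mulr_ge0 C0 a0; lra.
  have := ler_wpM2l (ltW pi0) K3; move: ca; rewrite /c divr1; lra.
apply: (Rintegral_le_profile al0) => // z; set t := nsq z.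
have t0 : 0 <= t by exact: nsq_ge0.
rewrite /h dens_dir_blk// dens_pot_blk -/t.
have K0 : 0 <= K by rewrite addr_ge0// !mulr_ge0 ?invr_ge0 ?addr_ge0 ?sqr_ge0.
have B0 : 0 <= 4 * K * (t + 1) ^- 2.
  by rewrite mulr_ge0 ?invr_ge0 ?sqr_ge0// mulr_ge0.
have [tT|/ltW tT] := leP t 1.
  have [u1 v1] := zet_core ltr01 tT.
  rewrite /prS /prC /prDS /prDC u1 v1 core_grad2// core_pot//.
  apply: ler_wpDr => //; rewrite le_eqVlt; apply/orP; left; apply/eqP.
  by rewrite /a -exprVn; field; rewrite gt_eqF.
have [u0 u1] := andP (zet_01 1 t); have v0 := dzet_le0 ltr01 t; have vt := dzet_bound ltr01 t.
have [Hd _ Hp _] := HC al t _ _ al0 u0 u1 v0 vt tT.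
have Hq0 := prDC_ge0 al (@ltr01 R) t0.
have Kt := ler_wpM2l K0 (inv_sq_tail ltr01 tT).
rewrite -/(prS al 1 t) -/(prC al 1 t) -/(prDS al 1 t) -/(prDC al 1 t) a4 -/a in Hd Hp.
(* On the tail the second term of the majorant already dominates, and the first only has to be
   nonnegative. *)
have Hx : 0 <= (1 + 2^-1 * a) * prDC al 1 t by rewrite mulr_ge0// addr_ge0// mulr_ge0.
have KE : K * t ^- 2 = (C * (a + a ^+ 2)) * t ^- 2 + 2^-1 * (C * a ^+ 2 * t ^- 2).
  by rewrite /K; ring.
move: Hd Hp Kt; rewrite KE => Hd Hp Kt; lra.
Qed.

End families.

(** * The infimum *)

Section infimum.
Context {R : realType}.
Implicit Types (r B E : R) (k : int).

Lemma ereal_inf_muln r k B (p : nat) :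
  (forall e, 0 < e -> exists E, attained r k E /\ E <= B + e) ->
  (ereal_inf (energy_values r (k *+ p)) <= (B *+ p)%:E)%E.
Proof.
move=> H; apply/lee_addgt0Pr => e e0.
(* The tolerance is shared among the p copies; dividing by p + 1 includes the case p = 0. *)
have [E [AE EB]] := H (e / p.+1%:R) (divr_gt0 e0 (ltr0Sn R p)).
apply: (@le_trans _ _ (E *+ p)%:E).
  by apply: ereal_inf_lbound; apply: attained_energy_values; exact: attained_muln.
rewrite -EFinD lee_fin; apply: le_trans (ler_wMn2r p EB) _.
rewrite mulrnDl lerD2l -[leLHS]mulr_natr mulrAC ler_pdivrMr ?ltr0Sn//.
by rewrite ler_pM2l// ler_nat leqnSn.
Qed.

Lemma attained_exists r k : 0 < r -> exists E, attained r k E.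
Proof.
move=> r0; case: k => p.
  have [E [AE _]] := skyrmion r (@ltr01 R).
  by exists (E *+ p); have := attained_muln p AE; rewrite pmulrn intz.
have [E [AE _]] := antiskyrmion r0 (@ltr01 R).
by exists (E *+ p.+1); have := attained_muln p.+1 AE; rewrite mulNrn pmulrn intz.
Qed.

(* A skyrmion together with an antiskyrmion has degree 0 and energy close to 8 pi (1 - r^2) < 0. *)
Lemma attained_unbounded r k B : 1 < r -> exists E, attained r k E /\ E <= B.
Proof.
move=> r1; have r0 : 0 < r := lt_trans ltr01 r1.
have pi0 : 0 < pi :> R := pi_gt0 R.
(* The ideal energy 8 pi (1 - r^2) of a pair is -4 d, so two errors of size d leave at most -2 d. *)
pose d := 2 * pi * (r ^+ 2 - 1).
have d0 : 0 < d by rewrite !mulr_gt0// subr_gt0 exprn_egt1.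
have [E1 [A1 B1]] := skyrmion r d0.
have [E2 [A2 B2]] := antiskyrmion r0 d0.
have [E0 A0] := attained_exists k r0.
have F0 : E1 + E2 <= - d.
  have : 4 * pi + d + (4 * pi * (1 - 2 * r ^+ 2) + d) = -2 * d by rewrite /d; ring.
  by move: B1 B2 d0; lra.
(* Each pair lowers the energy by at least d, so N pairs bring E0 below B. *)
pose N := Num.bound `|(E0 - B) / d|.
have A12 := attained_muln N (attained_add A1 A2).
exists (E0 + (E1 + E2) *+ N); split.
  by have := attained_add A0 A12; rewrite subrr mul0rn addr0.
have hN : (E0 - B) / d < N%:R.
  exact: (le_lt_trans (ler_norm _) (archi_boundP (normr_ge0 _))).
have := ler_wMn2r N F0; rewrite mulNrn -[d *+ N]mulr_natl.
by rewrite ltr_pdivrMr// in hN; move: hN; lra.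
Qed.

End infimum.

Theorem theorem1p1 (R : realType) (k : int) (r : R) (hr : 0 < r) :
  (r <= 1 ->
     ereal_inf (energy_values r k) =
       (if (k < 0)%R then (4 * pi * `|k|%:~R * (1 - 2 * r ^+ 2))%:E
        else (4 * pi * k%:~R)%:E)) /\
  (1 < r -> ereal_inf (energy_values r k) = -oo%E).
Proof.
split=> [r1|r1]; last first.
  apply: eq_ninfty => B; have [E [AE EB]] := attained_unbounded k B r1.
  apply: ge_ereal_inf; exists E%:E; last by rewrite lee_fin.
  exact: attained_energy_values.
apply/le_anti/andP; split; last first.
  apply: le_ereal_inf_tmp => _ [n [g [nM ->]]]; case: ifP => k0.
    apply: le_trans (Energy_ge_neg hr r1 nM).
    by rewrite lee_fin ltr0_norm// mulrNz; lra.
  exact: Energy_ge_pos.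
case: k => p.
  rewrite ltNge lez_nat leq0n/=.
  have H : forall e, 0 < e -> exists E, attained r 1 E /\ E <= 4 * pi + e.
    by move=> e; exact: skyrmion.
  by have := ereal_inf_muln p H; rewrite pmulrn intz -[4 * pi *+ p]mulr_natr.
(* [Negz p] stands for -(p + 1), hence p + 1 copies of the block of degree -1. *)
have H : forall e, 0 < e -> exists E, attained r (-1) E /\ E <= 4 * pi * (1 - 2 * r ^+ 2) + e.
  by move=> e; exact: antiskyrmion.
have := ereal_inf_muln p.+1 H; rewrite mulNrn pmulrn intz -NegzE.
suff -> : 4 * pi * (1 - 2 * r ^+ 2) *+ p.+1 = 4 * pi * `|Negz p|%:~R * (1 - 2 * r ^+ 2) by [].
by rewrite NegzE normrN -mulr_natr mulrAC.
Qed.
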